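(* Let $\alpha>-1$ and let $v\in C^1_{loc}(\mathbb R^N)$ be a self-similar profile with exponent $\alpha$, i.e. $\nabla\cdot v=0$ and, for some scalar function $q$, $\frac{1}{1+\alpha}\,y\cdot\nabla v+\frac{\alpha}{1+\alpha}\,v=v\cdot\nabla v+\nabla q$ on $\mathbb R^N$. Let $\varsigma=\frac12\{\partial_iv_j+\partial_jv_i\}_{i,j=1}^N$ be the strain tensor and $\omega=\frac12\{\partial_iv_j-\partial_jv_i\}_{i,j=1}^N$ the vorticity tensor of $v$. Suppose that (i) $|\varsigma(y)|=o(1)$ as $|y|\to\infty$; (ii) $\omega\in L^p(\mathbb R^N)$, i.e. $\int_{\mathbb R^N}|\omega|^p\,dy<\infty$, for some $0<p<\frac{N}{1+\alpha}$. Then $v$ is a constant vector field.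
   Context: $N\ge 2$ is the space dimension; $v:\mathbb R^N\to\mathbb R^N$ is a vector field; the equations are understood in the sense of distributions. These are the equations of the profile of a self-similar solution $u(x,t)=t^{-\alpha/(1+\alpha)}v(x\,t^{-1/(1+\alpha)})$, $p(x,t)=t^{-2\alpha/(1+\alpha)}q(x\,t^{-1/(1+\alpha)})$, $t>0$, of the incompressible Euler equations $u_t+u\cdot\nabla u+\nabla p=0$, $\nabla\cdot u=0$ (collapse at time $t=0$, time reversed). In terms of vorticity they imply $$\omega+\frac1{1+\alpha}\,y\cdot\nabla\omega=v\cdot\nabla\omega-\omega\varsigma-\varsigma\omega .$$ *)

(* Defs.v *)
From HB Require Import structures.
From mathcomp Require Import all_boot all_order all_algebra.
From mathcomp Require Import all_classical all_reals all_analysis.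

Set Implicit Arguments.
Unset Strict Implicit.
Unset Printing Implicit Defensive.

Import Order.TTheory GRing.Theory Num.Theory.
Import numFieldNormedType.Exports.

Local Open Scope classical_set_scope.
Local Open Scope ring_scope.

(* The library has no Lebesgue measure on R^n; it is built here as the n-fold
   product of [lebesgue_measure], on the Borel product sigma-algebra that the
   library puts on [n.-tuple R]. *)
Section lebesgue_measure_tuple.
Context {R : realType}.
Local Notation RR := (measurableTypeR R).

Definition tcons (n : nat) (x : RR * n.-tuple RR) : n.+1.-tuple RR :=
  [tuple of x.1 :: x.2].

Lemma measurable_tcons (n : nat) : measurable_fun setT (@tcons n).
Proof. exact: measurable_cons. Qed.

Section step.
Variables (n : nat) (m : {sigma_finite_measure set (n.-tuple RR) -> \bar R}).

Local Notation prodm := (product_measure1 (@lebesgue_measure R) m).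

Definition lebesgue_step : set (n.+1.-tuple RR) -> \bar R :=
  pushforward prodm (@tcons n).

Let lebesgue_step0 : lebesgue_step set0 = 0%E.
Proof. by rewrite /lebesgue_step /pushforward preimage_set0 measure0. Qed.

Let lebesgue_step_ge0 A : (0 <= lebesgue_step A)%E.
Proof. by rewrite /lebesgue_step /pushforward measure_ge0. Qed.

Let lebesgue_step_sigma_additive : semi_sigma_additive lebesgue_step.
Proof.
have mt A : measurable A -> measurable (@tcons n @^-1` A).
  by move=> mA; rewrite -[X in measurable X]setTI; exact: measurable_tcons.
move=> F mF tF mUF; rewrite /lebesgue_step /pushforward preimage_bigcup.
apply: measure_semi_sigma_additive.
- by move=> k; exact: mt.
- apply/trivIsetP => /= i j _ _ ij; rewrite -preimage_setI.
  by move/trivIsetP : tF => /(_ _ _ _ _ ij) ->//; rewrite preimage_set0.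
- by rewrite -preimage_bigcup; exact: mt.
Qed.

HB.instance Definition _ := isMeasure.Build _ _ _ lebesgue_step
  lebesgue_step0 lebesgue_step_ge0 lebesgue_step_sigma_additive.

Lemma lebesgue_step_sigma_finite : sigma_finite setT lebesgue_step.
Proof.
have /sigma_finiteP[F [FT ndF Foo]] := sigma_finiteT (@lebesgue_measure R).
have /sigma_finiteP[G [GT ndG Goo]] := sigma_finiteT m.
pose g (t : n.+1.-tuple RR) : RR * n.-tuple RR :=
  (tnth t ord0, [tuple of behead t]).
have mg : measurable_fun setT g.
  apply/measurable_fun_pairP; split => /=; first exact: measurable_tnth.
  exact: measurable_behead.
have gK x : g (tcons x) = x.
  by case: x => x t; rewrite /g /tcons; congr pair; exact/val_inj.
exists (fun k => g @^-1` (F k `*` G k)).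
  rewrite -preimage_bigcup; apply/esym; rewrite -subTset => t _ /=.
  have [i _ Fi] : (\bigcup_i F i) (g t).1 by rewrite -FT.
  have [j _ Gj] : (\bigcup_j G j) (g t).2 by rewrite -GT.
  exists (maxn i j) => //; split.
  - exact: (subsetPset _ _ (ndF _ _ (leq_maxl i j))).
  - exact: (subsetPset _ _ (ndG _ _ (leq_maxr i j))).
move=> k; have [mF Fk] := Foo k; have [mG Gk] := Goo k; split.
  by rewrite -[X in measurable X]setTI; apply: mg => //; exact: measurableX.
rewrite /lebesgue_step /pushforward.
rewrite (_ : _ @^-1` _ = F k `*` G k); last first.
  by rewrite -comp_preimage (_ : g \o @tcons n = id) ?preimage_id//; exact/funext.
by rewrite product_measure1E// lte_mul_pinfty// ge0_fin_numE.
Qed.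

HB.instance Definition _ := Measure_isSigmaFinite.Build _ _ _ lebesgue_step
  lebesgue_step_sigma_finite.

End step.

Fixpoint lebesgue_tuple (n : nat) :
    {sigma_finite_measure set (n.-tuple RR) -> \bar R} :=
  if n is n'.+1 return {sigma_finite_measure set (n.-tuple RR) -> \bar R}
  then lebesgue_step (lebesgue_tuple n') else dirac [tuple].

Lemma measurable_tuple_box (n : nat) (A : 'I_n -> set RR) :
  (forall i, measurable (A i)) ->
  measurable [set t : n.-tuple RR | forall i, A i (tnth t i)].
Proof.
move=> mA.
rewrite (_ : [set t | _] =
    \bigcap_(i in [set: 'I_n]) (@tnth n RR ^~ i @^-1` A i)); last first.
  by apply/seteqP; split=> t /= At i => [_|]; exact: At.
apply: fin_bigcap_measurable => // i _.
by rewrite -[X in measurable X]setTI; exact: measurable_tnth.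
Qed.

Lemma lebesgue_tuple_box (n : nat) (A : 'I_n -> set RR) :
  (forall i, measurable (A i)) ->
  lebesgue_tuple n [set t | forall i, A i (tnth t i)] =
  (\prod_(i < n) (@lebesgue_measure R) (A i))%E.
Proof.
elim: n A => [|n IHn] A mA.
  by rewrite big_ord0 /= diracE mem_set//= => -[].
rewrite big_ord_recl -(IHn (A \o lift ord0))//=.
rewrite /lebesgue_step /pushforward.
rewrite -product_measure1E//; last first.
  by apply: (@measurable_tuple_box n (A \o lift ord0)) => i; exact: mA.
congr (product_measure1 _ _ _); apply/seteqP; split=> -[x t] /=.
  move=> At; split=> [|i]; first exact: (At ord0).
  by have := At (lift ord0 i); rewrite tnthS.
move=> [Ax At] i; case: (unliftP ord0 i) => [j ->|-> //].
by rewrite tnthS; exact: At.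
Qed.

End lebesgue_measure_tuple.

Section euclidean_space.
Context {R : realType} {N : nat}.
Local Notation RN := 'rV[R]_N.

(* Borel measurability and integrals on R^N go through the coordinates:
   [lebesgue_tuple] lives on tuples, the normed space structure on ['rV_N]. *)
Definition row_of (t : N.-tuple (measurableTypeR R)) : RN :=
  \row_i tnth t i.

Definition integralRN (D : set RN) (f : RN -> \bar R) : \bar R :=
  (\int[lebesgue_tuple N]_(t in row_of @^-1` D) f (row_of t))%E.

Definition locally_integrableRN (f : RN -> R) : Prop :=
  measurable_fun setT (f \o row_of) /\
  forall K : set RN, compact K -> (integralRN K (fun y => `|f y|%:E) < +oo)%E.

Definition partial (i : 'I_N) (f : RN -> R) (y : RN) : R :=
  'D_(delta_mx 0 i) f y.

Fixpoint Ck (k : nat) (f : RN -> R) : Prop :=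
  continuous f /\
  if k is k'.+1 then
    forall i : 'I_N, (forall y, derivable f y (delta_mx 0 i)) /\
                     Ck k' (partial i f)
  else True.

Definition test_function (phi : RN -> R) : Prop :=
  (forall k, Ck k phi) /\ compact (closure [set y | phi y != 0]).

(* Distributions on R^N, as functionals compared on test functions only;
   [regular_distribution f] is the one given by a locally integrable [f]. *)
Definition RNdistribution : Type := (RN -> R) -> R.

Definition eq_distribution (S T : RNdistribution) : Prop :=
  forall phi, test_function phi -> S phi = T phi.

Definition regular_distribution (f : RN -> R) : RNdistribution :=
  fun phi => fine (integralRN setT (fun y => (f y * phi y)%:E)).

Definition add_distribution (S T : RNdistribution) : RNdistribution :=
  fun phi => S phi + T phi.

Definition partial_distribution (i : 'I_N) (T : RNdistribution) :
    RNdistribution :=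
  fun phi => - T (partial i phi).

(* Frobenius norm; on row vectors, the Euclidean norm. *)
Definition frobenius (m n : nat) (A : 'M[R]_(m, n)) : R :=
  Num.sqrt (\sum_i \sum_j A i j ^+ 2).

Definition is_o1_at_infinity (m n : nat) (F : RN -> 'M[R]_(m, n)) : Prop :=
  forall eps : R, 0 < eps ->
    exists r : R, forall y, r < frobenius y -> frobenius (F y) < eps.

Section vector_field.
Variable v : RN -> RN.

Definition component (i : 'I_N) (y : RN) : R := v y 0 i.

Definition C1_field : Prop := forall i, Ck 1 (component i).

Definition divergence (y : RN) : R := \sum_i partial i (component i) y.

(* The [i]-th component of [w . grad v]. *)
Definition advection (w : RN -> RN) (i : 'I_N) (y : RN) : R :=
  \sum_j w y 0 j * partial j (component i) y.

Definition strain (y : RN) : 'M[R]_N :=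
  \matrix_(i, j) (2^-1 *
    (partial i (component j) y + partial j (component i) y)).

Definition vorticity (y : RN) : 'M[R]_N :=
  \matrix_(i, j) (2^-1 *
    (partial i (component j) y - partial j (component i) y)).

(* The derivatives of the C^1 field [v] are classical ones, that of the
   pressure profile [q], which is only locally integrable, is distributional. *)
Definition self_similar_profile (alpha : R) : Prop :=
  eq_distribution (regular_distribution divergence)
                  (regular_distribution (fun=> 0)) /\
  exists q : RN -> R, locally_integrableRN q /\
    forall i : 'I_N,
      eq_distribution
        (regular_distribution
           (fun y => (1 + alpha)^-1 * advection id i y
                     + alpha / (1 + alpha) * component i y))
        (add_distribution
           (regular_distribution (advection v i))
           (partial_distribution i (regular_distribution q))).

End vector_field.

Definition in_Lp (m n : nat) (p : R) (F : RN -> 'M[R]_(m, n)) : Prop :=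
  (integralRN setT (fun y => (frobenius (F y) `^ p)%:E) < +oo)%E.

End euclidean_space.

(* Main.v *)
(* The profile equation transports [v], and hence its vorticity [w], along the
   field [b = y / (1 + alpha) - v], whose divergence is the constant
   [d = N / (1 + alpha)]: with [s] the strain, [b . grad w = - w + s w + w s].
   As [v] is only [C^1] this holds weakly; mollifying, with a commutator estimate,
   renormalises it to
     [int |w|^q ((d - q (1 + 2 N |s|)) chi + b . grad chi) <= 0]
   for all [q > 0] and all compactly supported [C^1] cutoffs [chi >= 0]. Since
   [s = o(1)], [b . y] is positive far away. For [q = p < d] and [chi] vanishing in
   a large ball and decaying logarithmically, [w] vanishes outside a ball; then,
   for [q] small, the bracket is positive on that ball and [w = 0]. Now [grad v]
   is symmetric and trace free, so its entries are weakly harmonic; they tend to 0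
   at infinity, hence vanish by the maximum principle. *)
Require Import Defs.
From mathcomp Require Import all_boot all_order all_algebra.
From mathcomp Require Import all_classical all_reals all_analysis.
From mathcomp Require Import measurable_realfun lra ring.

Set Implicit Arguments.
Unset Strict Implicit.
Unset Printing Implicit Defensive.

Import Order.TTheory GRing.Theory Num.Theory.
Import numFieldNormedType.Exports.

Local Open Scope classical_set_scope.
Local Open Scope ring_scope.

(** * Integration of compactly supported continuous functions *)

Section integral_of_continuous.
Context {R : realType}.
Local Notation RR := (measurableTypeR R).

(** The obstacle is regularity: the vorticity of a C^1 field is only continuous, so
    [drift . grad vort] has no pointwise meaning and every derivative must rest on a test function.
    The weak equations are tested on one explicit radial kernel, [rbump], and its derivatives: its
    second derivatives are visibly symmetric, and this symmetry is what eliminates the pressure. The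
    integrands are almost always continuous with compact support, so integration by parts reduces to
    Fubini and the fundamental theorem of calculus. As [q] may be small, [|w|^q] need not be
    differentiable at the zeros of [w]; the identity is proved for [(|w|^2 + a)^(q/2)] before [a]
    tends to 0. The growth of [b . y] is governed by the strain alone, because the derivative of
    [v(t y) . y] in [t] is the quadratic form of [grad v], blind to its antisymmetric part. Hence
    [b . y] is at most quadratic, and a cutoff built on [1 - tau ln(1 + |y|^2)] makes an error of
    order [tau], paid for by the integrability of [|w|^p]. The bound [p < d] is the positivity of
    [d - p (1 + o(1))] at infinity. *)

Lemma norm_coord_le (N : nat) (y : 'rV[R]_N) i : `|y 0 i| <= `|y|.
Proof.
rewrite {2}/Num.norm/= mx_normrE.
exact: (le_bigmax _ (fun ij : 'I_1 * 'I_N => `|y ij.1 ij.2|) (0, i)).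
Qed.

Lemma norm_row_le (N : nat) (y : 'rV[R]_N) (r : R) :
  0 <= r -> (forall i, `|y 0 i| <= r) -> `|y| <= r.
Proof.
move=> r0 H; rewrite {1}/Num.norm/= mx_normrE.
by apply: bigmax_le => // -[i j] _; rewrite /= ord1.
Qed.

Lemma norm_row_lt (N : nat) (y : 'rV[R]_N) (r : R) :
  0 < r -> (forall i, `|y 0 i| < r) -> `|y| < r.
Proof.
move=> r0 H; rewrite {1}/Num.norm/= mx_normrE.
by apply: bigmax_lt => // -[i j] _; rewrite /= ord1.
Qed.

(** The product sigma-algebra only knows coordinates, so an open set is exhibited as the union of
    the boxes with rational corners that it contains; [pickle] makes this union countable. *)
Lemma measurable_row_of_open (N : nat) (U : set 'rV[R]_N) :
  open U -> measurable (@row_of R N @^-1` U).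
Proof.
move=> oU.
pose box (q : {ffun 'I_N -> rat * rat}) : set (N.-tuple RR) :=
  [set t | forall i, `]ratr (q i).1, ratr (q i).2[%classic (tnth t i)].
pose F (n : nat) := if unpickle n is Some q then box q else set0.
have mF n : measurable (F n).
  rewrite /F; case: unpickle => [q|//].
  by apply: (measurable_tuple_box
      (A := fun i => `]ratr (q i).1, ratr (q i).2[%classic)) => i.
rewrite (_ : _ @^-1` _ =
    \bigcup_(n in [set n | F n `<=` @row_of R N @^-1` U]) F n); last first.
  apply/seteqP; split=> [t /= Ut|t [n /= Fn /Fn]//].
  have /nbhs_ballP[e /= e0 He] := open_nbhs_nbhs (conj oU Ut).
  have Hq i : exists q : rat * rat,
      [/\ tnth t i - e < ratr q.1, ratr q.1 < tnth t i,
          tnth t i < ratr q.2 & ratr q.2 < tnth t i + e].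
    have [a ] : exists q : rat, ratr q \in `]tnth t i - e, tnth t i[.
      by apply: rat_in_itvoo; rewrite ltrBlDr ltrDl.
    have [b ] : exists q : rat, ratr q \in `]tnth t i, tnth t i + e[.
      by apply: rat_in_itvoo; rewrite ltrDl.
    by rewrite !in_itv/= => /andP[? ?] /andP[? ?]; exists (a, b); split.
  have [q qP] := choice Hq.
  exists (pickle [ffun i => q i]); last first.
    rewrite /F pickleK => i /=; rewrite ffunE in_itv/=.
    by have [? -> -> ?] := qP i.
  rewrite /= /F pickleK => s /= bs; apply: He.
  rewrite -ball_normE/=; apply: norm_row_lt => // i; rewrite !mxE.
  have := bs i; rewrite /= ffunE in_itv/= => /andP[? ?].
  have [? ? ? ?] := qP i.
  by rewrite ltr_norml; apply/andP; split; lra.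
exact: bigcup_measurable.
Qed.

Lemma measurable_row_of (N : nat) (F : 'rV[R]_N -> R) :
  continuous F -> measurable_fun setT (F \o @row_of R N).
Proof.
move=> /continuousP cF _.
apply: (measurability _ (RGenOpens.measurableE R)) => //.
move=> _ [_ [a [b ->] <-]].
rewrite setTI comp_preimage; apply: measurable_row_of_open.
by apply: cF; exact: interval_open.
Qed.
End integral_of_continuous.

(** * The integral on continuous functions of bounded support *)

Section compactly_supported.
Context {R : realType} {N : nat}.
Local Notation RR := (measurableTypeR R).
Local Notation RN := 'rV[R]_N.
Local Notation mu := (@lebesgue_tuple R N).

Implicit Types F G : RN -> R.

Definition C0c (F : RN -> R) : Prop :=
  continuous F /\ exists M, forall y, M < `|y| -> F y = 0.

(** [fine] sends an infinite integral to 0, so the linearity and comparison rules below ask for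
    [C0c]. *)
Definition Int (F : RN -> R) : R := fine (integralRN setT (fun y => (F y)%:E)).

Lemma IntE F : Int F = (\int[mu]_t F (row_of t))%R.
Proof. by rewrite /Int /integralRN preimage_setT. Qed.

Definition tuple_box (M : R) : set (N.-tuple RR) :=
  [set t | forall i, `[- M, M]%classic (tnth t i)].

Lemma measurable_tuple_cube (M : R) : measurable (tuple_box M).
Proof.
exact: (@measurable_tuple_box R N (fun=> `[- M, M]%classic)).
Qed.

Lemma lebesgue_tuple_cube (M : R) : (mu (tuple_box M) < +oo)%E.
Proof.
rewrite (@lebesgue_tuple_box R N (fun=> `[- M, M]%classic)) => [|i]; last first.
  exact: measurable_itv.
rewrite (eq_bigr (fun=> (fine (@lebesgue_measure R `[- M, M]%classic))%:E)).
  by rewrite prodEFin ltry.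
move=> i _; rewrite fineK// lebesgue_measure_itv/=.
by case: ifP.
Qed.

Lemma ball_compact (M : R) : compact [set y : RN | `|y| <= M].
Proof.
apply: bounded_closed_compact.
  exists M; split; first exact: num_real.
  by move=> x Mx y /= /le_trans; apply; exact: ltW.
apply: (@closed_comp _ _ (fun y : RN => `|y|) [set x | x <= M]).
  by move=> y _; exact: norm_continuous.
exact: closed_le.
Qed.

Lemma bounded_on_ball (F : RN -> R) (M : R) : continuous F ->
  exists C, forall y, `|y| <= M -> `|F y| <= C.
Proof.
move=> cF.
have /compact_bounded[C [_ HC]] : compact (F @` [set y : RN | `|y| <= M]).
  apply: continuous_compact; last exact: ball_compact.
  exact: continuous_subspaceT.
exists (`|C| + 1) => y yM; apply: HC; last by exists y.
by rewrite (le_lt_trans (ler_norm _))// ltrDl.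
Qed.

Lemma C0c_bounded (F : RN -> R) : C0c F -> exists C, forall y, `|F y| <= C.
Proof.
move=> [cF [M FM]]; have [C HC] := bounded_on_ball M cF.
exists (Num.max C 0) => y; have [/HC|/FM ->] := leP `|y| M.
  by move=> h; rewrite le_max h.
by rewrite normr0 le_max lexx orbT.
Qed.

Lemma norm_row_of_le (t : N.-tuple RR) (M : R) :
  0 <= M -> (`|row_of t : RN| <= M) <-> tuple_box M t.
Proof.
move=> M0; split=> [tM i/=|tM].
  rewrite in_itv/= -ler_norml; have := norm_coord_le (row_of t) i.
  by rewrite mxE => /le_trans; apply.
apply: norm_row_le => // i; rewrite mxE.
by have := tM i; rewrite /= in_itv/= -ler_norml.
Qed.

(** A bounded function on a cube of finite measure. It is stated for measurable [F] because the
    majorant in [Int_cvg] jumps at the boundary of a ball. *)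
Lemma integrable_bounded_support (F : RN -> R) (C M : R) :
  measurable_fun setT (F \o @row_of R N) -> (forall y, `|F y| <= C) ->
  (forall y, M < `|y| -> F y = 0) ->
  mu.-integrable setT (fun t => (F (row_of t))%:E).
Proof.
move=> mF FC FM; pose M' := Num.max M 0.
rewrite (_ : (fun t => _) = (EFin \o (F \o @row_of R N)) \_ (tuple_box M')).
  apply: (integrable_mkcond _ (measurable_tuple_cube M')).1.
  apply: measurable_bounded_integrable.
  - exact: measurable_tuple_cube.
  - exact: lebesgue_tuple_cube.
  - exact: measurable_funTS.
  - exists C; split; first exact: num_real.
    by move=> x Cx t _ /=; rewrite (le_trans (FC _))// ltW.
apply/funext => t; rewrite /patch; case: ifPn => //.
rewrite notin_setE => nt; rewrite FM//.
rewrite ltNge; apply/negP => h; apply: nt.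
apply/norm_row_of_le; first by rewrite le_max lexx orbT.
by rewrite le_max h.
Qed.

Lemma C0c_integrable (F : RN -> R) : C0c F ->
  mu.-integrable setT (EFin \o (F \o @row_of R N)).
Proof.
move=> cF; have [C FC] := C0c_bounded cF.
case: cF => cF [M FM].
by apply: (integrable_bounded_support (measurable_row_of cF) FC FM).
Qed.

Lemma C0cD F G : C0c F -> C0c G -> C0c (fun y => F y + G y).
Proof.
move=> [cF [M FM]] [cG [M' GM]]; split.
  by move=> y; apply: continuousD; [exact: cF|exact: cG].
exists (Num.max M M') => y; rewrite gt_max => /andP[? ?].
by rewrite FM// GM// addr0.
Qed.

Lemma C0cN F : C0c F -> C0c (fun y => - F y).
Proof.
move=> [cF [M FM]]; split.
  by move=> y; apply: continuousN; exact: cF.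
by exists M => y ?; rewrite FM// oppr0.
Qed.

Lemma C0cB F G : C0c F -> C0c G -> C0c (fun y => F y - G y).
Proof. by move=> cF cG; apply: C0cD => //; exact: C0cN. Qed.

Lemma C0cMr F G : C0c F -> continuous G -> C0c (fun y => F y * G y).
Proof.
move=> [cF [M FM]] cG; split.
  by move=> y; apply: continuousM; [exact: cF|exact: cG].
by exists M => y ?; rewrite FM// mul0r.
Qed.

Lemma C0cMl F G : continuous F -> C0c G -> C0c (fun y => F y * G y).
Proof.
move=> cF cG; under eq_fun do rewrite mulrC; exact: C0cMr.
Qed.

Lemma C0cZ (c : R) F : C0c F -> C0c (fun y => c * F y).
Proof. by move=> cF; apply: C0cMl => //; exact: cst_continuous. Qed.

Lemma C0c_norm F : C0c F -> C0c (fun y => `|F y|).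
Proof.
move=> [cF [M FM]]; split.
  move=> y; apply: (@continuous_comp _ _ _ F (fun x => `|x|)); first exact: cF.
  exact: norm_continuous.
by exists M => y ?; rewrite FM// normr0.
Qed.

Lemma C0c0 : C0c (fun=> 0).
Proof. by split; [exact: cst_continuous|exists 0]. Qed.

Lemma C0c_sum (J : Type) (s : seq J) (P : pred J) (F : J -> RN -> R) :
  (forall j, P j -> C0c (F j)) -> C0c (fun y => \sum_(j <- s | P j) F j y).
Proof.
move=> cF; elim: s => [|j s IHs].
  by under eq_fun do rewrite big_nil; exact: C0c0.
case Pj : (P j); under eq_fun do rewrite big_cons Pj; last exact: IHs.
by apply: C0cD => //; exact: cF.
Qed.

Lemma IntD F G : C0c F -> C0c G -> Int (fun y => F y + G y) = Int F + Int G.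
Proof. by move=> cF cG; rewrite !IntE RintegralD//; exact: C0c_integrable. Qed.

Lemma IntB F G : C0c F -> C0c G -> Int (fun y => F y - G y) = Int F - Int G.
Proof. by move=> cF cG; rewrite !IntE RintegralB//; exact: C0c_integrable. Qed.

Lemma IntZ c F : C0c F -> Int (fun y => c * F y) = c * Int F.
Proof. by move=> cF; rewrite !IntE RintegralZl//; exact: C0c_integrable. Qed.

Lemma Int0 : Int (fun=> 0) = 0.
Proof. by rewrite IntE /Rintegral integral0. Qed.

Lemma IntN F : C0c F -> Int (fun y => - F y) = - Int F.
Proof.
move=> cF; rewrite -mulN1r -IntZ//; congr Int; apply/funext => y.
by rewrite mulN1r.
Qed.

Lemma Int_sum (J : Type) (s : seq J) (P : pred J) (F : J -> RN -> R) :
  (forall j, P j -> C0c (F j)) ->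
  Int (fun y => \sum_(j <- s | P j) F j y) = \sum_(j <- s | P j) Int (F j).
Proof.
move=> cF; elim: s => [|j s IHs].
  by under eq_fun do rewrite big_nil; rewrite big_nil Int0.
rewrite big_cons; case: ifP => Pj; under eq_fun do rewrite big_cons Pj; last exact: IHs.
by rewrite IntD ?IHs//; [exact: cF|exact: C0c_sum].
Qed.

Lemma le_Int F G : C0c F -> C0c G -> (forall y, F y <= G y) -> Int F <= Int G.
Proof.
move=> cF cG FG; rewrite !IntE; apply: le_Rintegral => //.
- exact: C0c_integrable.
- exact: C0c_integrable.
Qed.

Lemma Int_ge0 F : (forall y, 0 <= F y) -> 0 <= Int F.
Proof. by move=> F0; rewrite IntE; apply: Rintegral_ge0. Qed.

Lemma ler_norm_Int F : C0c F -> `|Int F| <= Int (fun y => `|F y|).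
Proof.
by move=> cF; rewrite !IntE; apply: le_normr_Rintegral => //; exact: C0c_integrable.
Qed.

(** By continuity [F] exceeds [F y0 / 2] on a sup-norm ball around [y0], which is a box of volume
    [(2 e)^N]. *)
Lemma Int_gt0 F y0 : C0c F -> (forall y, 0 <= F y) -> 0 < F y0 -> 0 < Int F.
Proof.
move=> cF F0 Fy0.
have [cF0 _] := cF.
have /cvgrPdist_lt/(_ (F y0 / 2)) := cF0 y0.
move=> /(_ _)/nbhs_ballP[]; first by rewrite divr_gt0.
move=> e /= e0 He.
pose B : set (N.-tuple RR) :=
  [set t | forall i, `]y0 0 i - e, y0 0 i + e[%classic (tnth t i)].
have mB : measurable B.
  by apply: (@measurable_tuple_box R N (fun i => `]y0 0 i - e, y0 0 i + e[%classic)) => i.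
have muB : mu B = ((e *+ 2) ^+ N)%:E.
  rewrite (@lebesgue_tuple_box R N (fun i => `]y0 0 i - e, y0 0 i + e[%classic)) => [|i]; last first.
    exact: measurable_itv.
  rewrite (eq_bigr (fun=> (e *+ 2)%:E)).
    by rewrite prodEFin prodr_const card_ord.
  move=> i _; rewrite lebesgue_measure_itv/= lte_fin.
  rewrite ifT; last by lra.
  by rewrite -EFinB; congr EFin; rewrite mulr2n; ring.
have int0 : mu.-integrable setT (EFin \o (\1_B : _ -> R)).
  apply/integrableP; split; first exact/measurable_EFinP/measurable_indic.
  under eq_integral => t _ do rewrite /= ger0_norm//.
  by rewrite integral_indic// setIT [X in (X < _)%E]muB ltry.
have int1 : mu.-integrable setT (EFin \o (fun t => F y0 / 2 * \1_B t)).
  rewrite (_ : EFin \o _ = (fun t => (F y0 / 2)%:E * (\1_B t)%:E)%E)//.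
  exact: integrableZl.
apply: (@lt_le_trans _ _ (\int[mu]_t (F y0 / 2 * \1_B t))%R).
  rewrite RintegralZl//.
    rewrite /Rintegral integral_indic// setIT [X in fine X]muB /=.
    rewrite mulr_gt0 ?divr_gt0// exprn_gt0//.
    by rewrite mulr2n addr_gt0.
rewrite IntE; apply: le_Rintegral => //; first exact: C0c_integrable.
move=> t _; rewrite indicE; have [tB|_] := boolP (t \in B); last by rewrite mulr0.
rewrite mulr1; have : ball y0 e (row_of t).
  rewrite -ball_normE/=; apply: norm_row_lt => // i; rewrite !mxE.
  move: tB; rewrite inE => /(_ i)/=; rewrite in_itv/= => /andP[? ?].
  by rewrite ltr_norml; apply/andP; split; lra.
by move=> /He /=; rewrite ltr_norml => /andP[? ?]; lra.
Qed.

Lemma Int_eq0 F : C0c F -> (forall y, 0 <= F y) -> Int F <= 0 ->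
  forall y, F y = 0.
Proof.
move=> cF F0 IF y; apply/eqP; rewrite eq_le F0 andbT leNgt.
by apply/negP => /(Int_gt0 cF F0); rewrite ltNge IF.
Qed.

(** Dominated convergence, with majorant [C] on the ball of radius [M] and 0 outside. *)
Lemma Int_cvg (F_ : nat -> RN -> R) (F : RN -> R) (C M : R) :
  (forall n, continuous (F_ n)) ->
  (forall n y, `|F_ n y| <= C) -> (forall n y, M < `|y| -> F_ n y = 0) ->
  (forall y, F_ n y @[n --> \oo] --> F y) ->
  Int (F_ n) @[n --> \oo] --> Int F.
Proof.
move=> cF FC FM cvgF.
have mF_ n : measurable_fun setT (fun t => (F_ n (@row_of R N t))%:E).
  by apply/measurable_EFinP; exact: measurable_row_of.
have cvgE t : (F_ n (@row_of R N t))%:E @[n --> \oo] --> (F (row_of t))%:E.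
  by apply: cvg_EFin; [exact: nearW|exact: cvgF].
pose g := fun y : RN => if `|y| <= M then C else 0.
have ig : mu.-integrable setT (fun t => (g (row_of t))%:E).
  apply: (@integrable_bounded_support g `|C| M).
  - rewrite /g /comp; apply: measurable_fun_ifT => //=.
    apply: measurable_fun_ler => //=.
    exact: (measurable_row_of (@norm_continuous _ RN)).
  - by move=> y; rewrite /g; case: ifP => //; rewrite normr0.
  - by move=> y; rewrite /g ltNge; case: ifP.
have mF := emeasurable_fun_cvg _ _ mF_ (fun t _ => cvgE t).
have FG t n : setT t -> (`|(F_ n (@row_of R N t))%:E| <= (g (row_of t))%:E)%E.
  move=> _; rewrite lee_fin /g; have [tM|tM] := leP `|row_of t : RN| M; first exact: FC.
  by rewrite FM// normr0.
have [iF _ h] := dominated_convergence measurableT mF_ mF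
  (aeW _ (fun t _ => cvgE t)) ig (aeW _ FG).
under eq_fun do rewrite IntE; rewrite IntE.
apply: fine_cvg; rewrite fineK//.
exact: integrable_fin_num.
Qed.


End compactly_supported.

(** * Partial derivatives and integration by parts *)

Section directional_derivatives.
Context {R : realType}.

(** Along the direction [u] the two difference quotients are the same function of [h], so no chain
    rule and no differentiability in other directions is involved. *)
Lemma is_derive_comp_affine (U V W : normedModType R) (f : V -> W) (g : U -> V)
    (a u : U) (v : V) (df : W) :
  (forall h : R, g (h *: u + a) = h *: v + g a) ->
  is_derive (g a) v f df -> is_derive a u (f \o g) df.
Proof.
move=> gE [dvf <-].
have E : (fun h : R => h^-1 *: (((f \o g) \o shift a) (h *: u) - (f \o g) a)) =
    (fun h => h^-1 *: ((f \o shift (g a)) (h *: v) - f (g a))).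
  by apply/funext => h /=; rewrite gE.
by split; [rewrite /derivable E|rewrite /derive E].
Qed.

(** A C^1 function is carried as [N] separate axis derivatives; [C1_is_derive] recovers the other
    directions from their continuity. *)
Definition isp (N : nat) (i : 'I_N) (F G : 'rV[R]_N -> R) : Prop :=
  forall y, is_derive y (delta_mx 0 i : 'rV[R]_N) F (G y).

Lemma isp_partial (N : nat) (i : 'I_N) (F G : 'rV[R]_N -> R) :
  isp i F G -> partial i F = G.
Proof. by move=> FG; apply/funext => y; rewrite /partial; have [_ ->] := FG y. Qed.

Lemma isp_supp (N : nat) (i : 'I_N) (F G : 'rV[R]_N -> R) (M : R) :
  isp i F G -> (forall y, M < `|y| -> F y = 0) -> forall y, M < `|y| -> G y = 0.
Proof.
move=> FG FM y My; have [_ <-] := FG y.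
suff : is_derive y (delta_mx 0 i : 'rV[R]_N) F 0 by case.
apply: near_eq_is_derive (is_derive_cst (0 : R) y (delta_mx 0 i : 'rV[R]_N)).
have : \forall z \near y, M < `|z|.
  have : (fun z : 'rV[R]_N => `|z|) @ y --> `|y| by exact: norm_continuous.
  by move/cvgr_gt; apply.
by apply: filterS => z /FM ->.
Qed.

Lemma isp_C0c (N : nat) (i : 'I_N) (F G : 'rV[R]_N -> R) :
  isp i F G -> C0c F -> continuous G -> C0c G.
Proof. by move=> FG [_ [M FM]] cG; split => //; exists M; exact: isp_supp FG FM. Qed.

Lemma is_derive1_continuous (f : R -> R) (df : R -> R) :
  (forall x : R, is_derive x (1 : R) f (df x)) -> continuous f.
Proof.
by move=> fd x; apply: differentiable_continuous; apply/derivable1_diffP; case: (fd x).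
Qed.

Lemma integral_derivative0 (f df : R -> R) (M : R) :
  (forall x : R, is_derive x (1 : R) f (df x)) -> continuous df ->
  (forall x, M < `|x| -> f x = 0) -> (forall x, M < `|x| -> df x = 0) ->
  (\int[lebesgue_measure]_x (df x)%:E = 0)%E.
Proof.
(* Both endpoints of [[-M', M']] lie strictly beyond [M], so [f] vanishes there and the fundamental
   theorem gives 0. *)
move=> fd cdf fM dfM; pose M' : R := `|M| + 1.
have MM' : M < M' by rewrite /M' (le_lt_trans (ler_norm _))// ltrDl.
have M'0 : 0 < M' by rewrite ltr_wpDl.
transitivity (\int[lebesgue_measure]_(x in `[(- M')%R, M']%classic) (df x)%:E)%E.
  rewrite [RHS]integral_mkcond; apply: eq_integral => x _.
  rewrite patchE; case: ifPn => // /negP xM.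
  rewrite dfM//; rewrite ltNge; apply/negP => xM'; apply: xM.
  by rewrite inE/= in_itv/= -ler_norml (le_trans xM')// ltW.
have cf := is_derive1_continuous fd.
rewrite (@continuous_FTC2 _ _ f).
- by rewrite !fM ?normrN ?gtr0_norm// -EFinB subrr.
- by rewrite gtrN.
- exact: continuous_subspaceT.
- split; first by move=> x _; case: (fd x).
  + by apply: cvg_at_right_filter; exact: cf.
  + by apply: cvg_at_left_filter; exact: cf.
- by move=> x _; rewrite derive1E; have [_ ->] := fd x.
Qed.

End directional_derivatives.

(** * The integral of a partial derivative vanishes *)

Section integral_partial.
Context {R : realType}.
Local Notation RR := (measurableTypeR R).

(** Row-vector counterpart of [tcons]: through it the product structure of the measure becomes a
    splitting of R^(N+1). *)
Definition crow (N : nat) (x : R) (t : 'rV[R]_N) : 'rV[R]_N.+1 :=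
  \row_i (if unlift ord0 i is Some j then t 0 j else x).

Lemma crow_norm_le N x (t : 'rV[R]_N) M : 0 <= M -> `|x| <= M -> `|t| <= M -> `|crow x t| <= M.
Proof.
move=> M0 xM tM; apply: norm_row_le => // i; rewrite mxE; case: unlift => // j.
exact: le_trans (norm_coord_le _ _) tM.
Qed.

Lemma norm_crow_ge N x (t : 'rV[R]_N) : `|x| <= `|crow x t| /\ `|t| <= `|crow x t|.
Proof.
split.
  by apply: le_trans (norm_coord_le (crow x t) ord0); rewrite mxE unlift_none.
apply: norm_row_le => // j.
by apply: le_trans (norm_coord_le (crow x t) (lift ord0 j)); rewrite mxE liftK.
Qed.

Lemma crowB N x x' (t t' : 'rV[R]_N) : crow x t - crow x' t' = crow (x - x') (t - t').
Proof. by apply/rowP => i; rewrite !mxE; case: unlift => //= j; rewrite !mxE. Qed.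

Lemma crow_continuousl N (t : 'rV[R]_N) : continuous (fun x : R => crow x t).
Proof.
move=> x; apply/cvgrPdist_lt => e e0; near=> x'.
apply: (@le_lt_trans _ _ `|x - x'|); last by near: x'; apply: cvgr_dist_lt.
by rewrite crowB subrr; apply: crow_norm_le => //; rewrite normr0.
Unshelve. all: by end_near. Qed.

Lemma crow_continuousr N x : continuous (fun t : 'rV[R]_N => crow x t).
Proof.
move=> t; apply/(@cvgrPdist_lt _ _ _ (nbhs t)) => e e0.
apply/nbhs_ballP; exists e => // t'; rewrite -ball_normE; apply: le_lt_trans.
by rewrite crowB subrr; apply: crow_norm_le => //; rewrite normr0.
Qed.

Lemma row_of_tcons N (x : R) (t : N.-tuple RR) : row_of (tcons (x, t)) = crow x (row_of t).
Proof.
apply/rowP => i; rewrite !mxE; case: unliftP => [j ->|->].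
  by rewrite mxE tnthS.
by [].
Qed.

Lemma crow_shiftl N x (t : 'rV[R]_N) (h : R) :
  crow (h *: 1 + x) t = h *: delta_mx 0 ord0 + crow x t.
Proof.
apply/rowP => k; rewrite !mxE !eqxx /=; case: unliftP => [j ->|->].
  by rewrite eq_sym (negbTE (neq_lift _ _)) mulr0 add0r.
by rewrite eqxx.
Qed.

Lemma crow_shiftr N x (t : 'rV[R]_N) (j : 'I_N) (h : R) :
  crow x (h *: delta_mx 0 j + t) = h *: delta_mx 0 (lift ord0 j) + crow x t.
Proof.
apply/rowP => k; rewrite !mxE !eqxx /=; case: unliftP => [k' ->|->].
  by rewrite !mxE !eqxx /= (inj_eq (@lift_inj _ _)).
by rewrite (negbTE (neq_lift _ _)) mulr0 add0r.
Qed.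

(** Induction on the dimension by Fubini, the order of integration depending on [i]. If [i] is the
    first axis, the inner integral is over that coordinate and the fundamental theorem applies;
    otherwise it is over the remaining ones and the induction hypothesis applies. *)
Lemma Int_isp0 (N : nat) (i : 'I_N) (F G : 'rV[R]_N -> R) :
  isp i F G -> C0c F -> continuous G -> Int G = 0.
Proof.
elim: N i F G => [[]//|N IHN] i F G FG cF cG.
have cG0 : C0c G := isp_C0c FG cF cG.
have [M GM] := cG0.2; have [M1 FM] := cF.2.
have iG := C0c_integrable cG0.
rewrite IntE /Rintegral/=.
have mG : measurable_fun setT (fun t => (G (@row_of R N.+1 t))%:E).
  by apply/measurable_EFinP; exact: measurable_row_of.
pose H p := (G (crow p.1 (@row_of R N p.2)))%:E.
have HE : (fun t => (G (@row_of R N.+1 t))%:E) \o @tcons R N = H.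
  by apply/funext => -[x t]; rewrite /= row_of_tcons.
(* The measure on R^(N+1) is a pushforward of the product measure, so integrability has to be pulled
   back before Fubini can be used. *)
have iH : (product_measure1 (@lebesgue_measure R) (lebesgue_tuple N)).-integrable setT H.
  move/integrableP : iG => [_ iG]; apply/integrableP; split.
    by rewrite -HE; apply: measurableT_comp => //; exact: measurable_tcons.
  move: iG; rewrite /= ge0_integral_pushforward//; last 2 first.
    exact: measurable_tcons.
    apply: measurableT_comp => //.
    exact: measurableT_comp (measurable_row_of cG).
  rewrite preimage_setT => h; rewrite (le_lt_trans _ h)//.
  rewrite le_eqVlt; apply/orP; left; apply/eqP.
  by apply: eq_integral => -[x t] _ /=; rewrite row_of_tcons.
rewrite integral_pushforward//; first last.
- by rewrite preimage_setT HE.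
- exact: measurable_tcons.
rewrite preimage_setT HE; case: (unliftP ord0 i) => [j ij|i0].
- rewrite -integral12_prod_meas1// /fubini_F/=.
  under eq_integral => x _.
    have -> : (\int[lebesgue_tuple N]_y H (x, y) = 0)%E.
      have cGx : C0c (fun t => G (crow x t)).
        split; first by move=> t; apply: continuous_comp; [exact: crow_continuousr|exact: cG].
        by exists M => t Mt; apply: GM; rewrite (lt_le_trans Mt)//; have [] := norm_crow_ge x t.
      have := IHN j (F \o crow x) (G \o crow x).
      rewrite IntE /Rintegral => IH.
      rewrite -[LHS]fineK; last exact: (integrable_fin_num _ (C0c_integrable cGx)).
      congr EFin; apply: IH.
      + move=> t; apply: (@is_derive_comp_affine _ _ _ _ F (crow x) t _ (delta_mx 0 i)).
          by move=> h; rewrite crow_shiftr ij.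
        exact: FG.
      + split; first by move=> t; apply: continuous_comp; [exact: crow_continuousr|exact: cF.1].
        by exists M1 => t Mt; apply: FM; rewrite (lt_le_trans Mt)//; have [] := norm_crow_ge x t.
      + exact: cGx.1.
    over.
  by rewrite integral0.
- rewrite -integral21_prod_meas1// /fubini_G/=.
  under eq_integral => t _.
    have -> : (\int[lebesgue_measure]_x H (x, t) = 0)%E.
      apply: (@integral_derivative0 R (fun x => F (crow x (row_of t)))
        (fun x => G (crow x (row_of t))) (Num.max M M1)).
      + move=> x; apply: (@is_derive_comp_affine _ _ _ _ F (fun x : R => crow x (row_of t)) x _
          (delta_mx 0 i)).
          by move=> h; rewrite crow_shiftl i0.
        exact: FG.
      + by move=> x; apply: continuous_comp; [exact: crow_continuousl|exact: cG].
      + move=> x; rewrite gt_max => /andP[_ Mx]; apply: FM.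
        by rewrite (lt_le_trans Mx)//; have [] := norm_crow_ge x (row_of t).
      + move=> x; rewrite gt_max => /andP[Mx _]; apply: GM.
        by rewrite (lt_le_trans Mx)//; have [] := norm_crow_ge x (row_of t).
    over.
  by rewrite integral0.
Qed.

End integral_partial.

(** * Calculus of partial derivatives *)

Section partial_calculus.
Context {R : realType} {N : nat}.
Local Notation RN := 'rV[R]_N.
Implicit Types (F G : RN -> R) (i k : 'I_N).

(** Brings directional derivatives back to functions of one real variable, where the one-dimensional
    chain rule is available. *)
Lemma is_derive_along (a v : RN) F (d : R) :
  is_derive a v F d <-> is_derive (0 : R) (1 : R) (fun h : R => F (h *: v + a)) d.
Proof.
have E : (fun h : R => h^-1 *: ((F \o shift a) (h *: v) - F a)) =
    (fun h : R => h^-1 *: (((fun h : R => F (h *: v + a)) \o shift 0) (h *: (1 : R))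
       - F ((0 : R) *: v + a))).
  by apply/funext => h /=; rewrite addr0 scale0r add0r [h *: 1]mulr1.
by split=> -[dF <-]; split; rewrite /derivable/derive ?E// -?E.
Qed.

Lemma isp_ext i F F1 G G1 : isp i F1 G1 -> F =1 F1 -> G =1 G1 -> isp i F G.
Proof. by move=> dF /funext -> /funext ->. Qed.

Lemma isp_cst i (c : R) : isp i (fun=> c) (fun=> 0).
Proof. by move=> y; exact: is_derive_cst. Qed.

Lemma isp_coord i k : isp i (fun y : RN => y 0 k) (fun=> (k == i)%:R).
Proof.
move=> y; apply/is_derive_along.
rewrite (_ : (fun h : R => _) = (k == i)%:R \*: id + cst (y 0 k)); last first.
  by apply/funext => h; rewrite !mxE eqxx mulrC.
have H : is_derive (0 : R) (1 : R) ((k == i)%:R \*: id + cst (y 0 k))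
    ((k == i)%:R *: 1 + 0).
  by apply: is_deriveD.
by move: H; rewrite addr0 [_ *: _]mulr1.
Qed.

Lemma isp_add i F F' G G' : isp i F F' -> isp i G G' ->
  isp i (fun y => F y + G y) (fun y => F' y + G' y).
Proof. by move=> dF dG y; exact: (is_deriveD (dF y) (dG y)). Qed.

Lemma isp_opp i F F' : isp i F F' -> isp i (fun y => - F y) (fun y => - F' y).
Proof. by move=> dF y; exact: (is_deriveN (dF y)). Qed.

Lemma isp_sub i F F' G G' : isp i F F' -> isp i G G' ->
  isp i (fun y => F y - G y) (fun y => F' y - G' y).
Proof. by move=> dF dG; apply: isp_add => //; exact: isp_opp. Qed.

Lemma isp_mul i F F' G G' : isp i F F' -> isp i G G' ->
  isp i (fun y => F y * G y) (fun y => F' y * G y + F y * G' y).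
Proof.
move=> dF dG y; apply: (is_derive_eq (is_deriveM (dF y) (dG y))).
by rewrite addrC [_ *: _]mulrC.
Qed.

Lemma isp_scale i (c : R) F F' : isp i F F' -> isp i (fun y => c * F y) (fun y => c * F' y).
Proof.
move=> dF; apply: (isp_ext (isp_mul (isp_cst i c) dF)) => // y.
by rewrite mul0r add0r.
Qed.

Lemma isp_sum i (J : Type) (s : seq J) (F F' : J -> RN -> R) :
  (forall j, isp i (F j) (F' j)) ->
  isp i (fun y => \sum_(j <- s) F j y) (fun y => \sum_(j <- s) F' j y).
Proof.
move=> dF; elim: s => [|j s IHs].
  by apply: (isp_ext (isp_cst i 0)) => y; rewrite big_nil.
by apply: (isp_ext (isp_add (dF j) IHs)) => y; rewrite big_cons.
Qed.

Lemma isp_comp i (f f' : R -> R) F F' :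
  (forall y, is_derive (F y) (1 : R) f (f' (F y))) -> isp i F F' ->
  isp i (fun y => f (F y)) (fun y => f' (F y) * F' y).
Proof.
move=> df dF y; apply/is_derive_along.
have /is_derive_along h := dF y.
apply: (@is_derive1_comp _ f (fun h : R => F (h *: delta_mx 0 i + y))).
by rewrite scale0r add0r.
Qed.

Lemma isp_shift i F F' (a : RN) : isp i F F' -> isp i (fun y => F (y - a)) (fun y => F' (y - a)).
Proof.
move=> dF y; apply: (@is_derive_comp_affine _ _ _ _ F (fun y => y - a) y _ (delta_mx 0 i)) => //.
by move=> h; rewrite addrA.
Qed.

Lemma isp_reflect i F F' (a : RN) : isp i F F' -> isp i (fun y => F (a - y)) (fun y => - F' (a - y)).
Proof.
move=> dF y; apply/is_derive_along.
have /is_derive_along h := dF (a - y).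
rewrite (_ : (fun h => _) = (fun h : R => F (h *: delta_mx 0 i + (a - y))) \o -%R); last first.
  by apply/funext => t /=; rewrite scaleNr opprD addrCA.
rewrite -mulrN1.
by apply: (@is_derive1_comp _ _ (-%R : R -> R)); rewrite oppr0.
Qed.

Lemma Int_ibp i F F' G G' : isp i F F' -> isp i G G' -> C0c F ->
  continuous F' -> continuous G -> continuous G' ->
  Int (fun y => F' y * G y) = - Int (fun y => F y * G' y).
Proof.
move=> dF dG cF cF' cG cG'; have cF'0 : C0c F' := isp_C0c dF cF cF'.
apply/eqP; rewrite -addr_eq0 -IntD; [|exact: C0cMr..]; apply/eqP.
apply: (Int_isp0 (isp_mul dF dG)); first exact: C0cMr.
by apply: (C0cD (C0cMr _ _) (C0cMr _ _)).1 => //.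
Qed.

Lemma Int_ibpr i F F' G G' : isp i F F' -> isp i G G' -> C0c G ->
  continuous F -> continuous F' -> continuous G' ->
  Int (fun y => F' y * G y) = - Int (fun y => F y * G' y).
Proof.
move=> dF dG cG cF cF' cG'.
rewrite (_ : (fun y => F y * G' y) = (fun y => G' y * F y)); last first.
  by apply/funext => y; rewrite mulrC.
rewrite (Int_ibp dG dF cG cG' cF cF') opprK; congr Int.
by apply/funext => y; rewrite mulrC.
Qed.

(** [b] may have either sign or be 0, and the last case forces the non-strict bound on [c]. *)
Lemma mvt_origin (f df : R -> R) (b : R) :
  (forall x : R, is_derive x (1 : R) f (df x)) ->
  exists2 c, `|c| <= `|b| & f b - f 0 = df c * b.
Proof.
move=> fd; have cf := is_derive1_continuous fd.
have [b0|b0|->] := ltgtP b 0; last first.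
- by exists 0 => //; rewrite subrr mulr0.
- have [c] := @MVT _ f df _ _ b0 (fun x _ => fd x) (continuous_subspaceT cf).
  rewrite in_itv/= => /andP[c0 cb] ->; exists c; last by rewrite subr0.
  by rewrite !gtr0_norm// ltW.
- have [c] := @MVT _ f df _ _ b0 (fun x _ => fd x) (continuous_subspaceT cf).
  rewrite in_itv/= => /andP[c0 cb] E; exists c; last first.
    by rewrite -opprB E sub0r mulrN opprK.
  by rewrite !ltr0_norm// lerN2 ltW.
Qed.

Lemma is_derive_affine_path (a w : RN) F (d : R) (t : R) :
  is_derive (t *: w + a) w F d -> is_derive t (1 : R) (fun t : R => F (t *: w + a)) d.
Proof.
move=> dF; apply: (@is_derive_comp_affine _ _ _ _ F (fun t : R => t *: w + a) t _ w) => //.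
by move=> h; rewrite addrA -scalerDl [h *: 1]mulr1.
Qed.

Lemma isp_mvt i F F' (a : RN) (b : R) : isp i F F' ->
  exists2 c : R, `|c| <= `|b| &
    F (b *: delta_mx 0 i + a) - F a = F' (c *: delta_mx 0 i + a) * b.
Proof.
move=> dF; have := @mvt_origin (fun t : R => F (t *: delta_mx 0 i + a))
  (fun t : R => F' (t *: delta_mx 0 i + a)) b.
case=> [t|c cb E]; first by apply: is_derive_affine_path; exact: dF.
by exists c => //; rewrite -E scale0r add0r.
Qed.

Lemma norm_delta_le i : `|delta_mx 0 i : RN| <= 1.
Proof.
by apply: norm_row_le => // k; rewrite mxE/= normr_nat lern1 leq_b1.
Qed.

(** The classical argument: go from [a] to [a + h w] one coordinate at a time, use the mean value
    theorem on each leg, and compare with the partial derivatives at [a] by continuity. *)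
Lemma C1_is_derive F (F' : 'I_N -> RN -> R) :
  (forall i, isp i F (F' i)) -> (forall i, continuous (F' i)) ->
  forall a w : RN, is_derive a w F (\sum_i w 0 i * F' i a).
Proof.
move=> dF cF' a w; set L := \sum_i _.
suff : (fun h : R => h^-1 *: ((F \o shift a) (h *: w) - F a)) @ 0^' --> L.
  by move=> H; split; [apply/cvg_ex; exists L|exact/cvg_lim].
apply/cvgrPdist_le => e e0.
pose S := \sum_i `|w 0 i|.
have S0 : 0 <= S by apply: sumr_ge0.
(* The added 1 avoids dividing by 0 when [w = 0]. *)
pose e' := e / (S + 1).
have e'0 : 0 < e' by rewrite divr_gt0// ltr_wpDl.
have [d d0 Hd] : exists2 d : R, 0 < d & forall z : RN, `|z| < d ->
    forall i, `|F' i (z + a) - F' i a| <= e'.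
  have : \forall z \near a, forall i, `|F' i a - F' i z| <= e'.
    have FF : Filter (nbhs a) by exact: nbhs_filter.
    apply: (@filter_forall RN _ (fun i z => `|F' i a - F' i z| <= e') (nbhs a) FF) => i.
    by have /cvgrPdist_le/(_ _ e'0) := cF' i a.
  move=> /nbhs_ballP[d d0 Hd]; exists d => // z zd i; rewrite distrC.
  by apply: Hd; rewrite -ball_normE/= opprD addrA addrAC subrr add0r normrN.
(* [s] lists the coordinates already moved; [|h| * S < d] keeps every intermediate point where the
   partial derivatives are within [e'] of their values at [a]. *)
have key (h : R) (s : seq 'I_N) : `|h| * S < d ->
    \sum_(i <- s) `|w 0 i| <= S ->
    `|F (h *: (\sum_(i <- s) w 0 i *: delta_mx 0 i) + a) - F a
        - h * \sum_(i <- s) w 0 i * F' i a| <= `|h| * (\sum_(i <- s) `|w 0 i|) * e'.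
  move=> hS; elim: s => [|i s IHs] sS.
    by rewrite !big_nil scaler0 add0r subrr mulr0 subrr normr0 mulr0 mul0r.
  rewrite !big_cons; set W := \sum_(j <- s) _ *: _.
  move: sS; rewrite big_cons => sS.
  have {}IHs := IHs (le_trans (ler_wpDl (normr_ge0 _) (lexx _)) sS).
  have [c cb E] := isp_mvt (h *: W + a) (h * w 0 i) (dF i).
  rewrite (_ : h *: (_ + W) + a = (h * w 0 i) *: delta_mx 0 i + (h *: W + a)); last first.
    by rewrite scalerDr scalerA addrA.
  set X := F (_ + (_ + a)) in E *.
  rewrite (_ : X - F a - _ = (F' i (c *: delta_mx 0 i + (h *: W + a)) - F' i a) * (h * w 0 i)
     + (F (h *: W + a) - F a - h * \sum_(j <- s) w 0 j * F' j a)); last first.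
    by rewrite mulrBl -E; ring.
  rewrite (le_trans (ler_normD _ _))// mulrDr mulrDl lerD// normrM mulrC normrM.
  rewrite ler_wpM2l ?mulr_ge0// addrA; apply: Hd.
  rewrite (le_lt_trans _ hS)// (le_trans _ (ler_wpM2l (normr_ge0 h) sS))//.
  rewrite (le_trans (ler_normD _ _))// mulrDr lerD//.
    rewrite normrZ (le_trans _ (_ : `|h * w 0 i| * 1 <= _))//.
      by rewrite ler_pM// norm_delta_le.
    by rewrite mulr1 normrM.
  rewrite normrZ ler_wpM2l// (le_trans (ler_norm_sum _ _ _))//.
  apply: ler_sum => j _; rewrite normrZ -[leRHS]mulr1 ler_wpM2l//.
  exact: norm_delta_le.
have wE : w = \sum_i w 0 i *: delta_mx 0 i by exact: row_sum_delta.
near=> h.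
have h0 : h != 0 by near: h; exact: nbhs_dnbhs_neq.
have hS : `|h| * S < d.
  have : `|h| < d / (S + 1).
    near: h; apply: dnbhs0_lt; by rewrite divr_gt0// ltr_wpDl.
  rewrite ltr_pdivlMr ?ltr_wpDl// => /(le_lt_trans _); apply.
  by rewrite ler_wpM2l// lerDl.
have := key h (index_enum 'I_N) hS (lexx _); rewrite -wE => K.
rewrite -(ler_pM2l (_ : 0 < `|h|)) ?normr_gt0// -normrM mulrBr /=.
rewrite [h * (_ *: _)]mulrA divff// mul1r distrC (le_trans K)//.
rewrite -mulrA ler_wpM2l// /e' mulrCA -[leRHS]mulr1 ler_wpM2l ?ltW//.
by rewrite ltr_pdivrMr ?ltr_wpDl// mul1r ltrDl.
Unshelve. all: by end_near. Qed.

(** A local Lipschitz bound: mean value theorem on the segment from [y] to [z], which stays in the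
    ball by convexity. *)
Lemma C1_continuous F (F' : 'I_N -> RN -> R) :
  (forall i, isp i F (F' i)) -> (forall i, continuous (F' i)) ->
  forall (M : R), exists2 L, 0 <= L & forall y z : RN, `|y| <= M -> `|z| <= M ->
    `|F z - F y| <= L * \sum_i `|(z - y) 0 i|.
Proof.
move=> dF cF' M.
have /choice[C HC] : forall i, exists C, forall y, `|y| <= M -> `|F' i y| <= C.
  by move=> i; exact: bounded_on_ball.
exists (\sum_i `|C i|) => [|y z yM zM]; first by apply: sumr_ge0.
have H (t : R) : is_derive t (1 : R) (fun t : R => F (t *: (z - y) + y))
    (\sum_i (z - y) 0 i * F' i (t *: (z - y) + y)).
  by apply: is_derive_affine_path; exact: C1_is_derive.
have [c] := @MVT _ (fun t : R => F (t *: (z - y) + y)) _ 0 1 ltr01 (fun t _ => H t)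
  (continuous_subspaceT (is_derive1_continuous H)).
rewrite in_itv/= => /andP[c0 c1].
rewrite scale1r scale0r subrK add0r subr0 mulr1 => ->.
rewrite mulr_sumr (le_trans (ler_norm_sum _ _ _))//; apply: ler_sum => i _.
rewrite normrM mulrC ler_wpM2r//.
have cM : `|c *: (z - y) + y| <= M.
  rewrite (_ : _ + _ = c *: z + (1 - c) *: y); last first.
    by rewrite scalerBr scalerBl scale1r; rewrite addrAC addrA.
  rewrite (le_trans (ler_normD _ _))// !normrZ (gtr0_norm c0) gtr0_norm ?subr_gt0//.
  have -> : M = c * M + (1 - c) * M by ring.
  by rewrite lerD// ler_wpM2l ?subr_ge0// ltW.
rewrite (le_trans (HC i _ cM))// (le_trans (ler_norm _))//.
by rewrite (bigD1 i)//= lerDl sumr_ge0.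
Qed.

End partial_calculus.

(** * Radial bump functions and mollification *)

Section flat_functions.
Context {R : realType}.

(** Serves functions defined by cases, at points where the two branches meet: [flat] at 0 and the
    squared positive part. *)
Lemma is_derive_quadratic (f : R -> R) (x l C : R) :
  (forall h, `|f (h + x) - f x - h * l| <= C * h ^+ 2) -> is_derive x (1 : R) f l.
Proof.
move=> H.
suff : (fun h : R => h^-1 *: ((f \o shift x) (h *: (1 : R)) - f x)) @ 0^' --> l.
  by move=> K; split; [apply/cvg_ex; exists l|exact/cvg_lim].
apply/cvgrPdist_le => e e0.
have C1 : 0 < `|C| + 1 by rewrite ltr_wpDl.
near=> h.
have h0 : h != 0 by near: h; exact: nbhs_dnbhs_neq.
have hd : `|h| < e / (`|C| + 1) by near: h; apply: dnbhs0_lt; rewrite divr_gt0.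
rewrite -(ler_pM2l (_ : 0 < `|h|)) ?normr_gt0// -normrM mulrBr /=.
rewrite [h * (_ *: _)]mulrA divff// mul1r distrC [h *: 1]mulr1.
rewrite (le_trans (H h))// -(real_normK (num_real h)) expr2 mulrCA ler_wpM2l//.
move: hd; rewrite ltr_pdivlMr// => /ltW; apply: le_trans.
by rewrite mulrC ler_wpM2l// (le_trans (ler_norm _))// lerDl.
Unshelve. all: by end_near. Qed.

(* A family stable under derivation, whose members are all smooth. *)
Definition flat (j : nat) (x : R) : R :=
  if 0 < x then x^-1 ^+ j * expR (- x^-1) else 0.

Lemma flat_ge0 j x : 0 <= flat j x.
Proof.
rewrite /flat; case: ifP => // x0.
by rewrite mulr_ge0 ?expR_ge0// exprn_ge0// invr_ge0 ltW.
Qed.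

Lemma flat_gt0 j x : 0 < x -> 0 < flat j x.
Proof. by move=> x0; rewrite /flat x0 mulr_gt0 ?expR_gt0// exprn_gt0// invr_gt0. Qed.

Lemma flat_le0 j x : x <= 0 -> flat j x = 0.
Proof. by rewrite /flat ltNge => ->. Qed.

(** [expR t] is the [n]-th power of [expR (t / n)], which is at least [t / n]. *)
Lemma exprn_le_expR (n : nat) (t : R) : 0 <= t -> t ^+ n <= n%:R ^+ n * expR t.
Proof.
case: n => [|n] t0; first by rewrite !expr0 mul1r -expR0 ler_expR.
have -> : expR t = expR (t / n.+1%:R) ^+ n.+1.
  by rewrite -expRM_natl mulrC divfK.
rewrite -exprMn; apply: lerXn2r.
- by rewrite nnegrE.
- by rewrite nnegrE mulr_ge0// expR_ge0.
- rewrite -ler_pdivrMl// mulrC (le_trans _ (expR_ge1Dx _))//.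
  by rewrite lerDr.
Qed.

(** [exprn_le_expR] at [t = x^-1] with exponent [j + 2], the two extra powers giving [x ^+ 2]. It
    makes the derivative of [flat j] at 0 vanish. *)
Lemma flat_quadratic j : exists C, forall x, `|flat j x| <= C * x ^+ 2.
Proof.
exists (j.+2%:R ^+ j.+2) => x; rewrite ger0_norm ?flat_ge0//.
rewrite /flat; case: ifP => x0; last first.
  by rewrite mulr_ge0 ?sqr_ge0// exprn_ge0.
have xV0 : 0 < x^-1 by rewrite invr_gt0.
have := @exprn_le_expR j.+2 x^-1 (ltW xV0).
rewrite -(ler_pM2r (expR_gt0 (- x^-1))) -[leRHS]mulrA expRxMexpNx_1 mulr1.
have x2 : 0 < x ^+ 2 by rewrite exprn_gt0.
rewrite -(ler_pM2r x2); apply: le_trans; rewrite le_eqVlt; apply/orP; left.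
apply/eqP; rewrite !exprS expr0; field.
exact: lt0r_neq0.
Qed.

Lemma is_derive_flat j (x : R) :
  is_derive x (1 : R) (flat j) (flat j.+2 x - j%:R * flat j.+1 x).
Proof.
have [x0|x0|->] := ltgtP x 0; last first.
- have [C HC] := flat_quadratic j.
  rewrite !flat_le0// mulr0 subrr; apply: (@is_derive_quadratic _ _ _ C) => h.
  by rewrite addr0 mulr0 (flat_le0 _ (lexx 0)) !subr0.
- have H : is_derive x (1 : R) (fun x => x^-1 ^+ j * expR (- x^-1))
     (flat j.+2 x - j%:R * flat j.+1 x).
    have x0' : x != 0 by rewrite gt_eqF.
    have dV := is_deriveV x0' (is_derive_id x (1 : R)).
    have dX := is_deriveX j dV.
    have dE := @is_derive1_comp _ expR (fun y : R => - y^-1) x _ _ (is_derive_expR _) (is_deriveN dV).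
    rewrite (_ : (fun x => _) = (fun y : R => y^-1) ^+ j * (fun y : R => expR (- y^-1))); last first.
      by apply/funext => y; rewrite [RHS]/GRing.mul/= exprfctE.
    apply: (is_derive_eq (is_deriveM dX dE)).
    rewrite /flat x0 !scaler1 /GRing.scale/=.
    case: j {dX} => [|j]; rewrite /= exprfctE -!exprVn ?exprS; ring.
  apply: near_eq_is_derive H; near=> y; rewrite /flat ifT//.
  by near: y; exact: lt_nbhsr.
- rewrite !flat_le0 ?ltW// mulr0 subrr.
  apply: near_eq_is_derive (is_derive_cst (0 : R) x (1 : R)).
  near=> y; rewrite flat_le0// ltW//.
  by near: y; exact: lt_nbhsl.
Unshelve. all: by end_near. Qed.

Lemma flat_continuous j : continuous (flat j).
Proof. exact: is_derive1_continuous (is_derive_flat j). Qed.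

End flat_functions.

(** * Smooth radial kernels *)

Section smooth_kernels.
Context {R : realType} {N : nat}.
Local Notation RN := 'rV[R]_N.
Implicit Types (F G K : RN -> R) (i : 'I_N) (y z : RN).

Lemma coordinate_continuous i : continuous (fun y : RN => y 0 i).
Proof. exact: coord_continuous. Qed.

Lemma sum_continuous (J : Type) (s : seq J) (P : pred J) (F : J -> RN -> R) :
  (forall j, continuous (F j)) -> continuous (fun y => \sum_(j <- s | P j) F j y).
Proof.
move=> cF; elim: s => [|j s IHs].
  by under eq_fun do rewrite big_nil; exact: cst_continuous.
case Pj : (P j); under eq_fun do rewrite big_cons Pj; last exact: IHs.
by move=> y; apply: continuousD; [exact: cF|exact: IHs].
Qed.

Lemma continuous_mul F G : continuous F -> continuous G -> continuous (fun y => F y * G y).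
Proof. by move=> cF cG y; apply: continuousM; [exact: cF|exact: cG]. Qed.

Lemma continuous_add F G : continuous F -> continuous G -> continuous (fun y => F y + G y).
Proof. by move=> cF cG y; apply: continuousD; [exact: cF|exact: cG]. Qed.

Lemma continuous_sub F G : continuous F -> continuous G -> continuous (fun y => F y - G y).
Proof. by move=> cF cG y; apply: continuousB; [exact: cF|exact: cG]. Qed.

Lemma continuous_scale (c : R) F : continuous F -> continuous (fun y => c * F y).
Proof. by move=> cF; apply: continuous_mul => //; exact: cst_continuous. Qed.

Lemma continuous_real_comp (f : R -> R) F : continuous f -> continuous F -> continuous (fun y => f (F y)).
Proof. by move=> cf cF y; apply: continuous_comp; [exact: cF|exact: cf]. Qed.

Lemma continuous_translate F (a : RN) : continuous F -> continuous (fun y : RN => F (y - a)).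
Proof.
move=> cF y; apply: (@continuous_comp _ _ _ (fun y : RN => y - a)); last exact: cF.
by apply: continuousB; [exact: cvg_id|exact: cst_continuous].
Qed.

(** Squared Euclidean norm; on rows, [|y|] is the sup norm, which is not smooth away from the
    origin. *)
Definition nsq (y : RN) : R := \sum_i y 0 i ^+ 2.

Lemma nsq_ge0 y : 0 <= nsq y.
Proof. by apply: sumr_ge0 => i _; exact: sqr_ge0. Qed.

Lemma nsq_continuous : continuous nsq.
Proof.
apply: sum_continuous => i.
by apply: (@continuous_mul (fun y : RN => y 0 i) (fun y : RN => y 0 i)); exact: coordinate_continuous.
Qed.

Lemma nsq_coord y i : y 0 i ^+ 2 <= nsq y.
Proof.
by rewrite /nsq (bigD1 i)//= lerDl sumr_ge0// => k _; exact: sqr_ge0.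
Qed.

Lemma nsq_ge_norm (y : RN) : `|y| ^+ 2 <= nsq y.
Proof.
rewrite -(@sqr_sqrtr _ (nsq y)) ?nsq_ge0//.
rewrite ler_pXn2r// ?nnegrE ?sqrtr_ge0//.
apply: norm_row_le => [|i]; first exact: sqrtr_ge0.
by rewrite -sqrtr_sqr ler_sqrt ?nsq_ge0// nsq_coord.
Qed.

Lemma nsq_le_norm (y : RN) : nsq y <= N%:R * `|y| ^+ 2.
Proof.
rewrite /nsq (le_trans (_ : _ <= \sum_(i < N) `|y| ^+ 2))//.
  apply: ler_sum => i _; rewrite -(real_normK (num_real (y 0 i))).
  by rewrite ler_pXn2r// ?nnegrE// norm_coord_le.
by rewrite sumr_const card_ord mulr_natl.
Qed.

Lemma isp_nsq i : isp i nsq (fun y => 2 * y 0 i).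
Proof.
have H k : isp i (fun y : RN => y 0 k ^+ 2) (fun y => 2 * ((k == i)%:R * y 0 k)).
  apply: (isp_ext (isp_mul (isp_coord i k) (isp_coord i k))) => y.
    by rewrite expr2.
  by rewrite mulr_natl mulr2n; congr (_ + _); exact: mulrC.
apply: (isp_ext (isp_sum _ H)) => // y.
rewrite (bigD1 i)//= eqxx mul1r big1 ?addr0// => k /negbTE ->.
by rewrite mul0r mulr0.
Qed.

Lemma Ck_continuous k F : Ck k F -> continuous F.
Proof. by case: k => [|k] []. Qed.

Lemma Ck_isp k F (F' : 'I_N -> RN -> R) : continuous F ->
  (forall i, isp i F (F' i)) -> (forall i, Ck k (F' i)) -> Ck k.+1 F.
Proof.
move=> cF dF CF; split=> // i; split=> [y|]; first by case: (dF i y).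
by rewrite (isp_partial (dF i)).
Qed.

Lemma Ck_partial k F i : Ck k.+1 F -> isp i F (partial i F).
Proof. by move=> [_ /(_ i)[dF _]] y; apply: DeriveDef. Qed.

Lemma CkW k F : Ck k.+1 F -> Ck k F.
Proof.
elim: k F => [|k IHk] F [cF CF]; first by split.
by split=> // i; have [dF /IHk] := CF i.
Qed.

Lemma Ck_add k F G : Ck k F -> Ck k G -> Ck k (fun y => F y + G y).
Proof.
elim: k F G => [|k IHk] F G CF CG.
  by split=> //; apply: continuous_add; [exact: (Ck_continuous CF)|exact: (Ck_continuous CG)].
apply: (Ck_isp _ (fun i => isp_add (Ck_partial i CF) (Ck_partial i CG))).
  by apply: continuous_add; [exact: (Ck_continuous CF)|exact: (Ck_continuous CG)].
by move=> i; apply: IHk; [case: CF => _ /(_ i)[]|case: CG => _ /(_ i)[]].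
Qed.

Lemma Ck_mul k F G : Ck k F -> Ck k G -> Ck k (fun y => F y * G y).
Proof.
elim: k F G => [|k IHk] F G CF CG.
  by split=> //; apply: continuous_mul; [exact: (Ck_continuous CF)|exact: (Ck_continuous CG)].
apply: (Ck_isp _ (fun i => isp_mul (Ck_partial i CF) (Ck_partial i CG))).
  by apply: continuous_mul; [exact: (Ck_continuous CF)|exact: (Ck_continuous CG)].
move=> i; apply: Ck_add; apply: IHk.
- by case: CF => _ /(_ i)[].
- exact: CkW.
- exact: CkW.
- by case: CG => _ /(_ i)[].
Qed.

Lemma Ck_cst k (c : R) : Ck k (fun _ : RN => c).
Proof.
elim: k c => [|k IHk] c; first by split=> //; exact: cst_continuous.
by apply: (Ck_isp _ (fun i => isp_cst i c)) => //; exact: cst_continuous.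
Qed.

Lemma Ck_coord k i : Ck k (fun y : RN => y 0 i).
Proof.
case: k => [|k]; first by split=> //; exact: coordinate_continuous.
apply: (Ck_isp _ (fun j => isp_coord j i)) => [|j]; last exact: Ck_cst.
exact: coordinate_continuous.
Qed.

(** Here [r] is the square of the radius of the supporting Euclidean ball. The index [j] is kept so
    that derivatives stay, up to polynomial factors, in the family. *)
Definition rbump (j : nat) (r : R) (z : RN) : R := flat j (r - nsq z).

Definition rbump' (j : nat) (r : R) (i : 'I_N) (z : RN) : R :=
  - 2 * (rbump j.+2 r z - j%:R * rbump j.+1 r z) * z 0 i.

Lemma rbump_continuous j r : continuous (rbump j r).
Proof.
apply: (continuous_real_comp (@flat_continuous R j)).
by apply: continuous_sub; [exact: cst_continuous|exact: nsq_continuous].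
Qed.

Lemma isp_rbump j r i : isp i (rbump j r) (rbump' j r i).
Proof.
apply: (isp_ext (@isp_comp R N i (flat j) (fun x => flat j.+2 x - j%:R * flat j.+1 x) _ _
  (fun y => is_derive_flat j (r - nsq y))
  (isp_sub (isp_cst i r) (isp_nsq i)))) => // y.
rewrite /rbump' /rbump /=; ring.
Qed.

(** The induction closes because [j] is general: a derivative of [rbump j r] is a polynomial
    combination of [rbump j.+1 r] and [rbump j.+2 r]. *)
Lemma Ck_rbump k j r : Ck k (rbump j r).
Proof.
elim: k j => [|k IHk] j; first by split=> //; exact: rbump_continuous.
apply: (Ck_isp _ (isp_rbump j r)) => [|i]; first exact: rbump_continuous.
apply: Ck_mul; last exact: Ck_coord.
apply: Ck_mul; first exact: Ck_cst.
apply: Ck_add; first exact: IHk.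
rewrite (_ : (fun y => _) = (fun y => - j%:R * rbump j.+1 r y)).
  by apply: Ck_mul; [exact: Ck_cst|exact: IHk].
by apply/funext => y; rewrite mulNr.
Qed.

Lemma rbump_supp j r z : r < `|z| ^+ 2 -> rbump j r z = 0.
Proof. by move=> rz; rewrite /rbump flat_le0// subr_le0 (le_trans (ltW rz))// nsq_ge_norm. Qed.

Lemma rbump_supp_norm j r z : 0 <= r -> Num.sqrt r < `|z| -> rbump j r z = 0.
Proof.
move=> r0 rz; apply: rbump_supp; rewrite -(sqr_sqrtr r0).
by rewrite ltr_pXn2r// ?nnegrE ?sqrtr_ge0.
Qed.

Lemma rbump_C0c j r : 0 <= r -> C0c (rbump j r).
Proof.
move=> r0; split; first exact: rbump_continuous.
by exists (Num.sqrt r) => z; exact: rbump_supp_norm.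
Qed.

Lemma rbump'_C0c j r i : 0 <= r -> C0c (rbump' j r i).
Proof.
move=> r0; apply: (isp_C0c (isp_rbump j r i)); first exact: rbump_C0c.
by have [_ /(_ i)[_]] := Ck_rbump 1 j r; rewrite (isp_partial (isp_rbump j r i)) => -[].
Qed.

Lemma rbump_ge0 j r z : 0 <= rbump j r z.
Proof. exact: flat_ge0. Qed.

Lemma Ck_shift k F (a : RN) : Ck k F -> Ck k (fun y : RN => F (y - a)).
Proof.
elim: k F => [|k IHk] F CF.
  by split=> //; exact/continuous_translate/(Ck_continuous CF).
apply: (Ck_isp _ (fun i => isp_shift a (Ck_partial i CF))).
  exact/continuous_translate/(Ck_continuous CF).
by move=> i; apply: IHk; case: CF => _ /(_ i)[].
Qed.

Lemma C0c_shift F (a : RN) : C0c F -> C0c (fun y : RN => F (y - a)).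
Proof.
move=> [cF [M FM]]; split; first exact: continuous_translate.
exists (M + `|a|) => y ya; apply: FM.
by rewrite (lt_le_trans _ (lerB_dist _ _))// ltrBrDr.
Qed.

Lemma test_functionP F : (forall k, Ck k F) -> C0c F -> test_function F.
Proof.
move=> CF [_ [M FM]]; split => //.
apply: (@subclosed_compact _ _ [set y : RN | `|y| <= M]);
  [exact: closed_closure|exact: ball_compact|].
rewrite [X in _ `<=` X](_ : _ = closure [set y : RN | `|y| <= M]).
  apply: closure_subset => y /= Fy; rewrite leNgt; apply/negP => /FM Fy0.
  by rewrite Fy0 eqxx in Fy.
apply/closure_id; apply: (@closed_comp _ _ (fun y : RN => `|y|) [set x | x <= M]).
  by move=> y _; exact: norm_continuous.
exact: closed_le.
Qed.

Lemma test_function_rbump r (a : RN) : 0 <= r -> test_function (fun y : RN => rbump 0 r (y - a)).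
Proof.
move=> r0; apply: test_functionP; last exact/C0c_shift/rbump_C0c.
by move=> k; exact/Ck_shift/Ck_rbump.
Qed.

End smooth_kernels.

(** * Mollification by the radial kernel *)

Section mollification.
Context {R : realType} {N : nat}.
Local Notation RN := 'rV[R]_N.
Local Notation mu := (@lebesgue_tuple R N).
Implicit Types (F G K g : RN -> R) (i : 'I_N) (y z : RN).

(** A continuous majorant of the indicator of the ball of radius [M], used as a ready-made
    integrable bound. *)
Definition plateau (M : R) (y : RN) : R := Num.max 0 (M + 1 - `|y|).

Lemma plateau_ge0 M y : 0 <= plateau M y.
Proof. by rewrite /plateau le_max lexx. Qed.

Lemma plateau_ge1 M y : `|y| <= M -> 1 <= plateau M y.
Proof. by move=> yM; rewrite /plateau le_max; apply/orP; right; lra. Qed.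

Lemma plateau_C0c M : C0c (plateau M).
Proof.
split; last first.
  by exists (M + 1) => y My; rewrite /plateau; apply/max_idPl; lra.
move=> y; apply: (@continuous_max R RN (fun=> 0) (fun y => M + 1 - `|y|)); first exact: cst_continuous.
by apply: continuousB; [exact: cst_continuous|exact: norm_continuous].
Qed.

Lemma Int_sup_le (M : R) : exists2 V, 0 <= V & forall F C, C0c F ->
  (forall y, `|F y| <= C) -> (forall y, M < `|y| -> F y = 0) -> `|Int F| <= C * V.
Proof.
exists (Int (plateau M)) => [|F C cF FC FM]; first by apply: Int_ge0 => y; exact: plateau_ge0.
rewrite (le_trans (ler_norm_Int cF))// -IntZ; last exact: plateau_C0c.
apply: le_Int; [exact: C0c_norm|exact/C0cZ/plateau_C0c|move=> y].
have C0 : 0 <= C by exact: le_trans (FC y).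
have [yM|/FM->] := leP `|y| M; last by rewrite normr0 mulr_ge0// plateau_ge0.
by rewrite (le_trans (FC y))// ler_peMr// plateau_ge1.
Qed.

(** The kernel sits at [z - y] instead of [y - z]: the same for the even [rbump], but each
    derivative in [y] brings a minus sign. No normalisation here; [mollify] divides by the mass. *)
Definition moll (g K : RN -> R) (y : RN) : R := Int (fun z => g z * K (z - y)).

Lemma moll_integrand g K y : continuous g -> C0c K -> C0c (fun z => g z * K (z - y)).
Proof. by move=> cg cK; apply: C0cMl => //; exact: C0c_shift. Qed.

Lemma shift_supp (M : R) K y y' z : (forall z, M < `|z| -> K z = 0) ->
  `|y'| <= `|y| + 1 -> M + `|y| + 1 < `|z| -> K (z - y') = 0.
Proof.
move=> KM yy' Mz; apply: KM; rewrite (lt_le_trans _ (lerB_dist _ _))//.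
by rewrite ltrBrDr; lra.
Qed.

(** [K] is locally Lipschitz and, for [y'] within 1 of [y], all integrands live in the ball of
    radius [M1], so [moll g K] is Lipschitz near [y]. *)
Lemma moll_continuous g K : continuous g -> C0c K -> Ck 1 K -> continuous (moll g K).
Proof.
move=> cg cK CK y.
have dK i := Ck_partial i CK.
have cK' i : continuous (partial i K) by case: CK => _ /(_ i)[_ []].
have [cK0 [M KM]] := cK.
pose M1 := `|M| + `|y| + 1.
have [C HC] := bounded_on_ball M1 cg.
have [L L0 HL] := C1_continuous dK cK' (M1 + `|y| + 1).
have [V V0 HV] := Int_sup_le M1.
apply/(@cvgrPdist_le _ _ _ (nbhs y)) => e e0.
have Cp : 0 <= `|C| * (L * N%:R) * V by rewrite !mulr_ge0.
have Cp1 : 0 < `|C| * (L * N%:R) * V + 1 by rewrite ltr_wpDl.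
apply/nbhs_ballP; exists (Num.min (e / (`|C| * (L * N%:R) * V + 1)) 1).
  by rewrite /= lt_min ltr01 divr_gt0.
move=> y'; rewrite -ball_normE/= lt_min => /andP[/ltW yy' /ltW yy1].
have y'1 : `|y'| <= `|y| + 1.
  by rewrite -(subKr y y') (le_trans (ler_normB _ _))// lerD2l.
rewrite /moll -IntB; [|exact: moll_integrand..].
rewrite (le_trans (HV _ (`|C| * (L * N%:R) * `|y - y'|) _ _ _))//.
- by apply: C0cB; exact: moll_integrand.
- move=> z; rewrite -mulrBr; have [zM|zM] := leP `|z| M1.
    rewrite normrM -mulrA ler_pM//; first by rewrite (le_trans (HC _ zM))// ler_norm.
    rewrite (le_trans (HL (z - y') (z - y) _ _))//.
    + by rewrite (le_trans (ler_normB _ _))//; lra.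
    + by rewrite (le_trans (ler_normB _ _))//; have := normr_ge0 y; lra.
    + rewrite -mulrA ler_wpM2l// (_ : z - y - (z - y') = - (y - y')); last first.
        by apply/rowP => k; rewrite !mxE; ring.
      rewrite mulr_natl -[X in _ *+ X](card_ord N) -sumr_const; apply: ler_sum => i _.
      by rewrite mxE normrN norm_coord_le.
  have zM' : M + `|y| + 1 < `|z|.
    by rewrite (le_lt_trans _ zM)// /M1 !lerD2r ler_norm.
  rewrite (shift_supp KM y'1 zM') (shift_supp KM _ zM') ?lerDl// subrr mulr0 normr0.
  by rewrite !mulr_ge0.
- move=> z zM.
  have zM' : M + `|y| + 1 < `|z|.
    by rewrite (le_lt_trans _ zM)// /M1 !lerD2r ler_norm.
  by rewrite (shift_supp KM y'1 zM') (shift_supp KM _ zM') ?lerDl// !mulr0 subrr.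
rewrite mulrAC.
move: yy'; rewrite ler_pdivlMr// mulrC => /(le_trans _); apply.
by rewrite ler_wpM2r// lerDl.
Qed.

(** Differentiation under the integral along [t *: e_ + y] with [|t| < 1]: all supports then lie in
    one ball, and a multiple of [plateau M1] dominates the derivatives. *)
Lemma isp_moll g K K' i : continuous g -> C0c K -> isp i K K' -> continuous K' ->
  isp i (moll g K) (fun y => - moll g K' y).
Proof.
move=> cg cK dK cK' y.
have cK0 := isp_C0c dK cK cK'.
have [_ [M KM]] := cK0.
have [C HC] := C0c_bounded cK0.
pose e_ : RN := delta_mx 0 i.
pose f (t : R) (s : N.-tuple (measurableTypeR R)) : R :=
  g (row_of s) * K (row_of s - (t *: e_ + y)).
have df t s : is_derive t (1 : R) (f^~ s) (- (g (row_of s) * K' (row_of s - (t *: e_ + y)))).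
  have /is_derive_affine_path := isp_reflect (row_of s) dK (t *: e_ + y).
  move/(is_deriveZ (g (row_of s))).
  by rewrite -[X in is_derive _ _ _ X]/(_ * _) mulrN.
have d1f t s : partial1of2 f t s = - (g (row_of s) * K' (row_of s - (t *: e_ + y))).
  by rewrite partial1of2E; have [_ ->] := df t s.
pose M1 := M + `|y| + 1.
have [Cg HCg] := bounded_on_ball M1 cg.
have yt t : t \in `]-1, 1[ -> `|t *: e_ + y| <= `|y| + 1.
  rewrite in_itv/= -ltr_norml => /ltW t1.
  rewrite addrC (le_trans (ler_normD _ _))// lerD2l normrZ -(mulr1 1) ler_pM//.
  exact: norm_delta_le.
have H := @cvg_differentiation_under_integral R _ _ mu f setT measurableT 0 (-1) 1
   _ _ _ (fun s => `|Cg| * C * plateau M1 (row_of s)) _ _ _.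
have {}H : h^-1 *: (moll g K (h *: e_ + y) - moll g K y) @[h --> 0^'] --> - moll g K' y.
  have -> : - moll g K' y = \int[mu]_s partial1of2 f 0 s.
    rewrite -IntN; last exact: moll_integrand.
    rewrite IntE; apply: eq_Rintegral => s _.
    by rewrite d1f scale0r add0r.
  rewrite (_ : (fun h : R => _) = (fun h => h^-1 *: ((\int[mu]_s f (h + 0) s) - \int[mu]_s f 0 s))).
    apply: H.
    - by rewrite /= in_itv/= ltr01 oppr_lt0 ltr01.
    - move=> t _; rewrite /f.
      exact: (C0c_integrable (moll_integrand (t *: e_ + y) cg cK)).
    - by move=> t s _ _; case: (df t s).
    - move=> s; rewrite mulr_ge0 ?plateau_ge0// mulr_ge0//.
      exact: le_trans (HC 0).
    - exact: (C0c_integrable (C0cZ _ (plateau_C0c M1))).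
    - move=> t s /yt ty _; rewrite d1f normrN normrM.
      have [sM|sM] := leP `|row_of s : RN| M1.
        rewrite -[leLHS]mulr1 ler_pM ?plateau_ge1// ?mulr_ge0// ler_pM//.
        by rewrite (le_trans (HCg _ sM))// ler_norm.
      rewrite (shift_supp KM ty sM) normr0 mulr0 mulr_ge0 ?plateau_ge0// mulr_ge0//.
      exact: le_trans (HC 0).
  apply/funext => h; rewrite /moll !IntE; congr (_ *: (_ - _)).
    by rewrite addr0.
  by apply: eq_Rintegral => s _; rewrite /f scale0r add0r.
split; last exact/cvg_lim.
by apply/cvg_ex; exists (- moll g K' y).
Qed.

Lemma moll_ibp g g' K K' i y : isp i g g' -> continuous g -> continuous g' ->
  isp i K K' -> C0c K -> continuous K' ->
  - moll g K' y = moll g' K y.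
Proof.
move=> dg cg cg' dK cK cK'; rewrite /moll.
rewrite (Int_ibpr dg (isp_shift y dK) (C0c_shift y cK) cg cg')//.
exact: continuous_translate.
Qed.

Lemma isp0_cst F : (forall i, isp i F (fun=> 0)) -> forall y, F y = F 0.
Proof.
move=> dF y.
have H (t : R) : is_derive t (1 : R) (fun t : R => F (t *: y + 0)) 0.
  apply: is_derive_affine_path.
  apply: is_derive_eq; first exact: (C1_is_derive dF (fun=> @cst_continuous _ _ _)).
  by rewrite big1// => i _; rewrite mulr0.
have [c _] := mvt_origin 1 H.
by rewrite mul0r scale1r scale0r !addr0 => /eqP; rewrite subr_eq0 => /eqP.
Qed.

Definition rbump_mass (r : R) : R := Int (@rbump R N 0 r).

Lemma rbump_mass_gt0 r : 0 < r -> 0 < rbump_mass r.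
Proof.
move=> r0; apply: (@Int_gt0 _ _ _ 0); first by apply: rbump_C0c; exact: ltW.
  by move=> y; exact: rbump_ge0.
apply: flat_gt0; rewrite /nsq big1 ?subr0// => i _.
by rewrite mxE expr0n.
Qed.

Lemma rbump'_continuous r j i : continuous (@rbump' R N j r i).
Proof.
by have [_ /(_ i)[_]] := @Ck_rbump R N 1 j r; rewrite (isp_partial (isp_rbump j r i)) => -[].
Qed.

(* Translation invariance, read off the vanishing gradient of [moll 1 (rbump 0 r)]. *)
Lemma moll_rbump_mass r y : 0 < r -> Int (fun z => rbump 0 r (z - y)) = rbump_mass r.
Proof.
move=> r0; pose F := moll (fun=> 1) (rbump 0 r).
have FE y' : Int (fun z => rbump 0 r (z - y')) = F y'.
  by rewrite /F /moll; congr Int; apply/funext => z; rewrite mul1r.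
rewrite FE (@isp0_cst F) -?FE.
  by rewrite /rbump_mass; congr Int; apply/funext => z; rewrite subr0.
move=> i; have cK : C0c (@rbump R N 0 r) by apply: rbump_C0c; exact: ltW.
apply: (isp_ext (isp_moll _ cK (isp_rbump 0 r i) _)) => //.
- exact: cst_continuous.
- exact: rbump'_continuous.
move=> y'; rewrite (moll_ibp _ (isp_cst i 1) _ _ (isp_rbump 0 r i) cK)//.
- rewrite /moll -[LHS](@Int0 R N); congr Int; apply/funext => z; rewrite mul0r//.
- exact: cst_continuous.
- exact: cst_continuous.
- exact: rbump'_continuous.
Qed.

Lemma rbump_neq0 j r z : rbump j r z != 0 -> nsq z < r.
Proof.
by rewrite ltNge; apply: contra => rz; rewrite /rbump flat_le0// subr_le0.
Qed.

(** Averages do not increase deviations: [g - a] is integrated against a non-negative kernel of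
    total mass [rbump_mass r], and only its values on the support count. *)
Lemma moll_dist g r y (a e : R) : continuous g -> 0 < r ->
  (forall z, nsq (z - y) < r -> `|g z - a| <= e) ->
  `|moll g (rbump 0 r) y - a * rbump_mass r| <= e * rbump_mass r.
Proof.
move=> cg r0 H.
have cK : C0c (@rbump R N 0 r) by apply: rbump_C0c; exact: ltW.
have cKy := C0c_shift y cK.
rewrite -(moll_rbump_mass y r0) -!IntZ// /moll -IntB; last 2 first.
- exact: moll_integrand.
- exact: C0cZ.
have cI : C0c (fun z => g z * rbump 0 r (z - y) - a * rbump 0 r (z - y)).
  by apply: C0cB; [exact: moll_integrand|exact: C0cZ].
rewrite (le_trans (ler_norm_Int cI))//; apply: le_Int.
- exact: C0c_norm.
- exact: C0cZ.
- move=> z; rewrite -mulrBl normrM (ger0_norm (rbump_ge0 _ _ _)).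
  have [->|/rbump_neq0 /H h] := eqVneq (rbump 0 r (z - y)) 0; first by rewrite !mulr0.
  by rewrite ler_wpM2r// rbump_ge0.
Qed.

(** A squared radius. Being at most 1, it gives bounds on a ball that are uniform in [n] after
    enlarging the ball by 1. *)
Definition mrad (n : nat) : R := n.+1%:R^-1.

Lemma mrad_gt0 n : 0 < mrad n.
Proof. by rewrite invr_gt0. Qed.

Lemma mrad_le1 n : mrad n <= 1.
Proof. by rewrite invf_le1// ler1n. Qed.

Definition mollify (n : nat) g (y : RN) : R := moll g (rbump 0 (mrad n)) y / rbump_mass (mrad n).

Lemma mollify_dist n g y (a e : R) : continuous g ->
  (forall z, nsq (z - y) < mrad n -> `|g z - a| <= e) -> `|mollify n g y - a| <= e.
Proof.
move=> cg H; have c0 := rbump_mass_gt0 (mrad_gt0 n).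
rewrite -(ler_pM2r c0) (_ : `|_| * _ =
    `|moll g (rbump 0 (mrad n)) y - a * rbump_mass (mrad n)|).
  by apply: moll_dist => //; exact: mrad_gt0.
by rewrite -[X in _ * X]gtr0_norm// -normrM mulrBl mulfVK ?gt_eqF.
Qed.

Lemma near_mrad (e : R) : 0 < e -> \forall n \near \oo, mrad n < e.
Proof. by move=> e0; exact: near_infty_natSinv_lt (PosNum e0). Qed.

Lemma nsq_small_ball (y : RN) (P : set RN) : nbhs y P ->
  exists2 d, 0 < d & forall z, nsq (z - y) < d -> P z.
Proof.
move=> /nbhs_ballP[e /= e0 He]; exists (e ^+ 2); first by rewrite exprn_gt0.
move=> z h; apply: He; rewrite -ball_normE/= distrC.
rewrite -(@ltr_pXn2r _ 2) ?nnegrE ?(ltW e0)//.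
exact: le_lt_trans (nsq_ge_norm _) h.
Qed.

Lemma mollify_cvg g y : continuous g -> mollify n g y @[n --> \oo] --> g y.
Proof.
move=> cg; apply/cvgrPdist_le => e e0.
have /cvgrPdist_le/(_ _ e0)/nsq_small_ball[d d0 Hd] := cg y.
near=> n; rewrite distrC; apply: mollify_dist => // z zn; rewrite distrC.
apply: Hd; apply: (lt_trans zn); near: n; exact: near_mrad.
Unshelve. all: by end_near. Qed.

Lemma nsq_lt1_norm y z : nsq (z - y) < 1 -> `|z| <= `|y| + 1.
Proof.
move=> /(le_lt_trans (nsq_ge_norm _)) h.
have : `|z - y| <= 1.
  by rewrite -(@ler_pXn2r _ 2)// ?nnegrE// expr1n ltW.
by have := lerB_dist z y; lra.
Qed.

Lemma mollify_bounded g M : continuous g ->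
  exists C, forall n y, `|y| <= M -> `|mollify n g y| <= C.
Proof.
move=> cg; have [C HC] := bounded_on_ball (M + 1) cg.
exists C => n y yM; rewrite -[mollify _ _ _]subr0; apply: mollify_dist => // z zn.
rewrite subr0; apply: HC; rewrite (le_trans (@nsq_lt1_norm y z _)) ?lerD2r//.
exact: lt_le_trans zn (mrad_le1 n).
Qed.

Lemma mollify_continuous n g : continuous g -> continuous (mollify n g).
Proof.
move=> cg.
have : continuous (moll g (rbump 0 (mrad n))).
  apply: (moll_continuous cg _ (Ck_rbump 1 0 (mrad n))).
  by apply: rbump_C0c; rewrite ltW// mrad_gt0.
move=> h; apply: continuous_mul => //; exact: cst_continuous.
Qed.

End mollification.

(** * Symmetry of second derivatives and vanishing in the weak sense *)

Section weak_derivatives.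
Context {R : realType} {N : nat}.
Local Notation RN := 'rV[R]_N.
Implicit Types (F G K g : RN -> R) (i j k : 'I_N) (y z : RN) (r : R).

(** The mixed derivatives are given in closed form so that their symmetry is an algebraic
    identity. *)
Definition rbump'' r i k z : R :=
  4 * (rbump 4 r z - 2 * rbump 3 r z) * z 0 i * z 0 k - 2 * rbump 2 r z * (i == k)%:R.

Lemma rbump''C r i k : rbump'' r i k = rbump'' r k i.
Proof. by apply/funext => z; rewrite /rbump'' eq_sym; ring. Qed.

Lemma isp_rbump' r i k : isp k (rbump' 0 r i) (rbump'' r i k).
Proof.
have H := isp_mul (isp_scale (-2) (isp_sub (isp_rbump 2 r k) (isp_scale 0 (isp_rbump 1 r k))))
  (isp_coord k i).
apply: (isp_ext H) => z; rewrite /rbump' /rbump''; ring.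
Qed.

Lemma Ck_rbump' n r i : Ck n (@rbump' R N 0 r i).
Proof.
have [_ /(_ i)[_]] := @Ck_rbump R N n.+1 0 r.
by rewrite (isp_partial (isp_rbump 0 r i)).
Qed.

Lemma Ck_rbump'' n r i k : Ck n (rbump'' r i k).
Proof.
have [_ /(_ k)[_]] := Ck_rbump' n.+1 r i.
by rewrite (isp_partial (isp_rbump' r i k)).
Qed.

Lemma rbump''_C0c r i k : 0 <= r -> C0c (rbump'' r i k).
Proof.
move=> r0; apply: (isp_C0c (isp_rbump' r i k) (rbump'_C0c 0 i r0)).
exact: (Ck_continuous (Ck_rbump'' 0 r i k)).
Qed.

(** [mollify n gj] is first rewritten as minus the average of [g] against a differentiated kernel;
    in that form it can be differentiated again, although [gj] is only continuous. *)
Lemma isp_mollify2 n g gj j k : isp j g gj -> continuous g -> continuous gj ->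
  isp k (mollify n gj) (fun y => moll g (rbump'' (mrad n) j k) y / @rbump_mass R N (mrad n)).
Proof.
move=> dg cg cg'.
have r0 : 0 <= mrad n :> R by rewrite ltW// mrad_gt0.
have cK : C0c (@rbump R N 0 (mrad n)) by exact: rbump_C0c.
have H := isp_scale (- (@rbump_mass R N (mrad n))^-1) (isp_moll cg (rbump'_C0c 0 j r0)
  (isp_rbump' (mrad n) j k) (Ck_continuous (Ck_rbump'' 0 (mrad n) j k))).
apply: (isp_ext H) => y; last by rewrite mulrC mulrNN.
rewrite /mollify -(moll_ibp y dg cg cg' (isp_rbump 0 (mrad n) j) cK).
  by rewrite mulrC mulNr mulrN.
exact: rbump'_continuous.
Qed.

Lemma Int_cvgM F (G_ : nat -> RN -> R) G : C0c F -> (forall n, continuous (G_ n)) ->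
  (forall M, exists C, forall n y, `|y| <= M -> `|G_ n y| <= C) ->
  (forall y, G_ n y @[n --> \oo] --> G y) ->
  Int (fun y => F y * G_ n y) @[n --> \oo] --> Int (fun y => F y * G y).
Proof.
move=> cF cG bG GG; have [B FB] := C0c_bounded cF; have [_ [M FM]] := cF.
have [C GC] := bG M.
apply: (@Int_cvg _ _ _ _ (B * `|C|) M).
- by move=> n; apply: (C0cMr cF _).1.
- move=> n y; rewrite normrM; have [yM|/FM->] := leP `|y| M.
    by rewrite ler_pM// (le_trans (GC n _ yM))// ler_norm.
  by rewrite normr0 mul0r mulr_ge0//; exact: le_trans (FB y).
- by move=> n y /FM ->; rewrite mul0r.
- by move=> y; apply: cvgMr; exact: GG.
Qed.

Lemma Int_mollify_cvg F g : C0c F -> continuous g ->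
  Int (fun y => F y * mollify n g y) @[n --> \oo] --> Int (fun y => F y * g y).
Proof.
move=> cF cg; apply: Int_cvgM => //.
- by move=> n; exact: mollify_continuous.
- by move=> M; exact: mollify_bounded.
- by move=> y; exact: mollify_cvg.
Qed.

(* Both sides equal [- \int F d_j d_k G] when [G] is [C^2]; mollify [G]. *)
Lemma Int_swap F Fj Fk G Gj Gk j k :
  isp j F Fj -> isp k F Fk -> C0c F -> continuous Fj -> continuous Fk ->
  isp j G Gj -> isp k G Gk -> continuous G -> continuous Gj -> continuous Gk ->
  Int (fun y => Fk y * Gj y) = Int (fun y => Fj y * Gk y).
Proof.
move=> dFj dFk cF cFj cFk dGj dGk cG cGj cGk.
have h1 := Int_mollify_cvg (isp_C0c dFk cF cFk) cGj.
have h2 := Int_mollify_cvg (isp_C0c dFj cF cFj) cGk.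
suff E n : Int (fun y => Fk y * mollify n Gj y) = Int (fun y => Fj y * mollify n Gk y).
  have h1' : Int (fun y => Fj y * mollify n Gk y) @[n --> \oo] --> Int (fun y => Fk y * Gj y).
    by move: h1; under eq_fun do rewrite E.
  exact: cvg_unique h1' h2.
have r0 : 0 <= mrad n :> R by rewrite ltW// mrad_gt0.
have cH a b : continuous (fun y => moll G (rbump'' (mrad n) a b) y / @rbump_mass R N (mrad n)).
  apply: continuous_mul; last exact: cst_continuous.
  by apply: moll_continuous => //; [exact: rbump''_C0c|exact: Ck_rbump''].
rewrite (Int_ibp dFk (isp_mollify2 n k dGj cG cGj))//; last exact: mollify_continuous.
rewrite (Int_ibp dFj (isp_mollify2 n j dGk cG cGk))//; last exact: mollify_continuous.
by rewrite rbump''C.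
Qed.

(** The hypothesis says that every mollification of [g] vanishes, and these converge to [g]. *)
Lemma weak_eq0 g : continuous g ->
  (forall r (a : RN), 0 < r -> Int (fun y => g y * rbump 0 r (y - a)) = 0) -> forall y, g y = 0.
Proof.
move=> cg H y.
have : mollify n g y @[n --> \oo] --> g y by exact: mollify_cvg.
rewrite (_ : (fun n => _) = fun=> 0); last first.
  by apply/funext => n; rewrite /mollify /moll H ?mrad_gt0// mul0r.
by move=> h; exact: cvg_unique h (cvg_cst _).
Qed.

End weak_derivatives.

(** * The weak vorticity equation *)

Section vorticity_equation.
Context {R : realType} {N : nat}.
Local Notation RN := 'rV[R]_N.
Variables (v : RN -> RN) (alpha : R).
Hypotheses (halpha : -1 < alpha) (hC1 : C1_field v)
  (hv : self_similar_profile v alpha).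
Implicit Types (i j k : 'I_N) (y z : RN).

Definition grad i j (y : RN) : R := partial i (component v j) y.

Definition rate : R := (1 + alpha)^-1.

(* The field along which the profile equation transports [v] and its vorticity. *)
Definition drift k (y : RN) : R := rate * y 0 k - component v k y.

Lemma rate_gt0 : 0 < rate.
Proof. by rewrite invr_gt0 addrC -ltrBlDr sub0r. Qed.

Lemma component_continuous i : continuous (component v i).
Proof. exact: Ck_continuous (hC1 i). Qed.

Lemma isp_component i j : isp i (component v j) (grad i j).
Proof. exact: Ck_partial (hC1 j). Qed.

Lemma grad_continuous i j : continuous (grad i j).
Proof. by case: (hC1 j) => _ /(_ i)[_ []]. Qed.

Lemma drift_continuous k : continuous (drift k).
Proof.
apply: continuous_sub; last exact: component_continuous.
by apply: continuous_scale; exact: coordinate_continuous.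
Qed.

Definition drift' j k (y : RN) : R := (k == j)%:R * rate - grad j k y.

Lemma isp_drift j k : isp j (drift k) (drift' j k).
Proof.
apply: (isp_ext (isp_sub (isp_scale rate (isp_coord j k)) (isp_component j k))) => // y.
by rewrite /drift' mulrC.
Qed.

Lemma drift'_continuous j k : continuous (drift' j k).
Proof. by apply: continuous_sub; [exact: cst_continuous|exact: grad_continuous]. Qed.

Lemma divergence_eq0 y : \sum_i grad i i y = 0.
Proof.
apply: (@weak_eq0 _ _ (fun y => \sum_i grad i i y)).
  by apply: sum_continuous => i; exact: grad_continuous.
move=> r a r0; have [+ _] := hv.
move=> /(_ _ (test_function_rbump a (ltW r0))).
rewrite /regular_distribution => h; rewrite /Int [LHS]h.
by rewrite -[RHS](@Int0 R N) /Int; under eq_fun do rewrite mul0r.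
Qed.

Lemma div_drift y : \sum_k drift' k k y = N%:R * rate.
Proof.
rewrite /drift' sumrB divergence_eq0 subr0 -mulr_suml; congr (_ * _).
by under eq_bigr do rewrite eqxx; rewrite sumr_const card_ord.
Qed.

(** By the profile equation this is [d_i q] in the sense of distributions, so its curl vanishes. *)
Definition force i (y : RN) : R :=
  \sum_k drift k y * grad k i y + alpha * rate * component v i y.

Lemma forceE i y : force i y = ((1 + alpha)^-1 * advection v id i y
    + alpha / (1 + alpha) * component v i y) - advection v v i y.
Proof.
rewrite /force /advection addrAC mulr_sumr -sumrB; congr (_ + _).
by apply: eq_bigr => k _; rewrite /drift mulrBl mulrA.
Qed.

(** Equation [i] is tested on the [j]-th derivative of the kernel and conversely. The pressure then
    only meets the second derivatives [rbump''], symmetric in [i] and [j], and cancels. *)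
Lemma curl_force i j r (a : RN) : 0 < r ->
  Int (fun y => force i y * rbump' 0 r j (y - a)) =
  Int (fun y => force j y * rbump' 0 r i (y - a)).
Proof.
move=> r0; have [_ [q [_ Hq]]] := hv.
have cK m : C0c (fun y : RN => rbump' 0 r m (y - a)).
  by apply: C0c_shift; apply: rbump'_C0c; exact: ltW.
have cid m : continuous (advection v id m).
  apply: sum_continuous => k.
  by apply: continuous_mul; [exact: coordinate_continuous|exact: grad_continuous].
have cv m : continuous (advection v v m).
  apply: sum_continuous => k.
  by apply: continuous_mul; [exact: component_continuous|exact: grad_continuous].
have H m l : Int (fun y => force m y * rbump' 0 r l (y - a)) =
    - regular_distribution q (fun y => rbump'' r l m (y - a)).
  have tl : test_function (fun y => rbump' 0 r l (y - a)).
    apply: test_functionP => // n; apply: Ck_shift; exact: Ck_rbump'.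
  have := Hq m _ tl.
  rewrite /add_distribution /partial_distribution.
  rewrite (isp_partial (isp_shift a (isp_rbump' r l m))) => /esym.
  set X := (X in X + _ = _); set Y := (X in _ + X = _) => h.
  have -> : - regular_distribution q (fun y : RN => rbump'' r l m (y - a)) = Y by [].
  rewrite -[RHS](addrK X) [Y + X]addrC h /X.
  rewrite /regular_distribution -!/(Int _) -IntB; last 2 first.
  - apply: C0cMl => //; apply: continuous_add; first exact: continuous_scale.
    exact/continuous_scale/component_continuous.
  - exact: C0cMl.
  by congr Int; apply/funext => y; rewrite forceE mulrBl.
by rewrite !H rbump''C.
Qed.

(** Weak form of [d_j] applied to [force i], without second derivatives of [v]: write
    [drift k * d_j phi] as [d_j (drift k * phi)] minus [phi * d_j (drift k)], and exchange [d_j] and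
    [d_k] between [drift k * phi] and [component v i] by [Int_swap]. *)
Lemma Int_force phi (phi' : 'I_N -> RN -> R) i j : C0c phi ->
  (forall k, isp k phi (phi' k)) -> (forall k, continuous (phi' k)) ->
  Int (fun y => force i y * phi' j y) =
  Int (fun y => (N%:R * rate * phi y + \sum_k drift k y * phi' k y) * grad j i y
                - phi y * grad j i y
                + phi y * \sum_k grad j k y * grad k i y).
Proof.
move=> cphi dphi cphi'.
have cphi0 k : C0c (phi' k) by apply: isp_C0c (dphi k) _ _.
have dB m k : isp m (fun y => drift k y * phi y)
    (fun y => drift' m k y * phi y + drift k y * phi' m y).
  exact: isp_mul (isp_drift m k) (dphi m).
have cB m k : C0c (fun y => drift' m k y * phi y + drift k y * phi' m y).
  apply: C0cD; apply: C0cMl => //; [exact: drift'_continuous|exact: drift_continuous].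
have cG := grad_continuous.
have cBk k : C0c (fun y => drift k y * phi y) by apply: C0cMl => //; exact: drift_continuous.
(* The two sides of that exchange, subtracted and summed over [k]; its integral is 0. *)
pose A y := \sum_k ((drift' j k y * phi y + drift k y * phi' j y) * grad k i y -
                    (drift' k k y * phi y + drift k y * phi' k y) * grad j i y).
have cA : C0c A.
  by apply: C0c_sum => k _; apply: C0cB; apply: C0cMr.
have IA : Int A = 0.
  rewrite Int_sum => [|k _]; last by apply: C0cB; apply: C0cMr.
  apply: big1 => k _; rewrite IntB; [|exact: C0cMr..].
  rewrite (Int_swap (dB k k) (dB j k) (cBk k) (cB k k).1 (cB j k).1
    (isp_component k i) (isp_component j i)
    (@component_continuous i) (@grad_continuous _ _) (@grad_continuous _ _)).
  by rewrite subrr.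
have cv := component_continuous.
have IC : Int (fun y => grad j i y * phi y + component v i y * phi' j y) = 0.
  rewrite IntD; [|exact: C0cMl..].
  by rewrite (Int_ibpr (isp_component j i) (dphi j))// addNr.
have -> : (fun y => force i y * phi' j y) = (fun y => (A y
   + alpha * rate * (grad j i y * phi y + component v i y * phi' j y)) +
   ((N%:R * rate * phi y + \sum_k drift k y * phi' k y) * grad j i y
                - phi y * grad j i y
                + phi y * \sum_k grad j k y * grad k i y)).
  apply/funext => y.
  have -> : A y = (phi' j y * \sum_k drift k y * grad k i y + phi y * rate * grad j i y
       - phi y * \sum_k grad j k y * grad k i y)
       - (N%:R * rate * phi y + \sum_k drift k y * phi' k y) * grad j i y.
    rewrite /A sumrB; congr (_ - _).
      rewrite !mulr_sumr (_ : phi y * rate * grad j i y =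
         \sum_k (k == j)%:R * (phi y * rate * grad k i y)).
        rewrite -big_split -sumrB; apply: eq_bigr => k _ /=; rewrite /drift'; ring.
      rewrite (bigD1 j)//= eqxx mul1r big1 ?addr0// => k /negbTE ->.
      by rewrite mul0r.
    rewrite -mulr_suml; congr (_ * _); rewrite big_split -mulr_suml div_drift.
    by [].
  (* The coefficient [alpha * rate] of [v] and the [rate] produced by differentiating [y] in the
     drift add up to 1, the coefficient of [- vort] in [vort_rhs]. *)
  have aE : alpha * rate + rate = 1.
    rewrite -[X in _ + X]mul1r -mulrDl addrC /rate mulfV// gt_eqF//.
    by have := halpha; lra.
  rewrite /force.
  have -> : alpha * rate = 1 - rate by rewrite -aE addrK.
  ring.
have cS k : C0c (fun y => drift k y * phi' k y) by apply: C0cMl => //; exact: drift_continuous.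
have cL : C0c (fun y => (N%:R * rate * phi y + \sum_k drift k y * phi' k y) * grad j i y
                - phi y * grad j i y + phi y * \sum_k grad j k y * grad k i y).
  apply: C0cD.
    apply: C0cB; last exact: C0cMr.
    by apply: C0cMr => //; apply: C0cD; [exact: C0cZ|exact: C0c_sum].
  by apply: C0cMr => //; apply: sum_continuous => k; exact: continuous_mul.
have cC : C0c (fun y => grad j i y * phi y + component v i y * phi' j y).
  by apply: C0cD; exact: C0cMl.
rewrite IntD//; last by apply: C0cD => //; exact: C0cZ.
rewrite IntD//; last exact: C0cZ.
by rewrite IA IntZ// IC mulr0 !add0r.
Qed.

Definition vort i j (y : RN) : R := 2^-1 * (grad i j y - grad j i y).

(* Right-hand side of [drift . grad vort = vort_rhs]; the second term is the
   antisymmetric part of [(grad v)^2], that is strain * vort + vort * strain. *)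
Definition vort_rhs i j (y : RN) : R :=
  - vort i j y + 2^-1 * \sum_k (grad i k y * grad k j y - grad j k y * grad k i y).

Lemma vort_continuous i j : continuous (vort i j).
Proof. by apply: continuous_scale; apply: continuous_sub; exact: grad_continuous. Qed.

Lemma vort_rhs_continuous i j : continuous (vort_rhs i j).
Proof.
apply: continuous_add.
  by move=> y; apply: continuousN; exact: vort_continuous.
apply: continuous_scale; apply: sum_continuous => k; apply: continuous_sub;
  by apply: continuous_mul; exact: grad_continuous.
Qed.

(** Half the difference of [Int_force] for [(i, j)] and [(j, i)]: the gradients combine into [vort],
    the quadratic terms into [vort_rhs]. *)
Lemma Int_curl_force phi (phi' : 'I_N -> RN -> R) i j : C0c phi ->
  (forall k, isp k phi (phi' k)) -> (forall k, continuous (phi' k)) ->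
  Int (fun y => force i y * phi' j y) = Int (fun y => force j y * phi' i y) ->
  Int (fun y => (\sum_k drift k y * phi' k y) * vort i j y) =
  - (N%:R * rate * Int (fun y => vort i j y * phi y)
     + Int (fun y => vort_rhs i j y * phi y)).
Proof.
move=> cphi dphi cphi' /eqP E.
have cphi0 k : C0c (phi' k) by apply: isp_C0c (dphi k) _ _.
rewrite (Int_force i j cphi dphi cphi') (Int_force j i cphi dphi cphi') in E.
have cG := grad_continuous.
have cS k : C0c (fun y => drift k y * phi' k y) by apply: C0cMl => //; exact: drift_continuous.
have cL l m : C0c (fun y => (N%:R * rate * phi y + \sum_k drift k y * phi' k y) * grad l m y
                - phi y * grad l m y + phi y * \sum_k grad l k y * grad k m y).
  apply: C0cD.
    apply: C0cB; last exact: C0cMr.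
    by apply: C0cMr => //; apply: C0cD; [exact: C0cZ|exact: C0c_sum].
  by apply: C0cMr => //; apply: sum_continuous => k; exact: continuous_mul.
have cb : C0c (fun y => (\sum_k drift k y * phi' k y) * vort i j y).
  by apply: C0cMr; [exact: C0c_sum|exact: vort_continuous].
have cw : C0c (fun y => vort i j y * phi y) by apply: C0cMl => //; exact: vort_continuous.
have cr : C0c (fun y => vort_rhs i j y * phi y) by apply: C0cMl => //; exact: vort_rhs_continuous.
move: E; rewrite eq_sym -subr_eq0 -IntB// => E.
apply/eqP; rewrite -addr_eq0 -IntZ// -IntD//; last exact: C0cZ.
rewrite -IntD//; last by apply: C0cD => //; exact: C0cZ.
rewrite -[X in X == _]mul1r -(@mulVf _ 2%:R)// -mulrA mulf_eq0 invr_eq0.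
rewrite -IntZ; last by apply: C0cD => //; apply: C0cD => //; exact: C0cZ.
apply/orP; right; rewrite (eqP (_ : Int _ == Int (fun y =>
  ((N%:R * rate * phi y + \sum_k drift k y * phi' k y) * grad i j y
     - phi y * grad i j y + phi y * \sum_k grad i k y * grad k j y) -
  ((N%:R * rate * phi y + \sum_k drift k y * phi' k y) * grad j i y
     - phi y * grad j i y + phi y * \sum_k grad j k y * grad k i y)))) //.
apply/eqP; congr Int; apply/funext => y.
by rewrite /vort_rhs /vort sumrB; field.
Qed.

Lemma weak_vorticity i j r (a : RN) : 0 < r ->
  Int (fun y => (\sum_k drift k y * rbump' 0 r k (y - a)) * vort i j y) =
  - (N%:R * rate * Int (fun y => vort i j y * rbump 0 r (y - a))
     + Int (fun y => vort_rhs i j y * rbump 0 r (y - a))).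
Proof.
move=> r0; apply: (@Int_curl_force (fun y => rbump 0 r (y - a))
  (fun k y => rbump' 0 r k (y - a))).
- by apply/C0c_shift/rbump_C0c; exact: ltW.
- by move=> k; apply: isp_shift; exact: isp_rbump.
- by move=> k; apply: continuous_translate; exact: rbump'_continuous.
- exact: curl_force.
Qed.

End vorticity_equation.

(** * Renormalisation *)

Section locally_bounded_convergence.
Context {R : realType} {N : nat}.
Local Notation RN := 'rV[R]_N.
Implicit Types (F G : RN -> R) (Fn Gn : nat -> RN -> R).

(** Stable under sums, products and composition with continuous functions, and strong enough to pass
    to the limit against a compactly supported weight. *)
Definition lb_cvg (Fn : nat -> RN -> R) (F : RN -> R) : Prop :=
  [/\ forall n, continuous (Fn n),
      forall M, exists C, forall n y, `|y| <= M -> `|Fn n y| <= C &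
      forall y, Fn n y @[n --> \oo] --> F y].

Lemma lb_cvg_cst F : continuous F -> lb_cvg (fun=> F) F.
Proof.
move=> cF; split=> [//|M|y]; last exact: cvg_cst.
by have [C HC] := bounded_on_ball M cF; exists C.
Qed.

Lemma lb_cvg_mollify F : continuous F -> lb_cvg (fun n => mollify n F) F.
Proof.
move=> cF; split=> [n|M|y]; first exact: mollify_continuous.
- exact: mollify_bounded.
- exact: mollify_cvg.
Qed.

Lemma lb_cvgD Fn F Gn G : lb_cvg Fn F -> lb_cvg Gn G ->
  lb_cvg (fun n y => Fn n y + Gn n y) (fun y => F y + G y).
Proof.
move=> [cF bF FF] [cG bG GG]; split=> [n|M|y]; first exact: continuous_add.
- have [C HC] := bF M; have [C' HC'] := bG M; exists (C + C') => n y yM.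
  by rewrite (le_trans (ler_normD _ _))// lerD ?HC ?HC'.
- by apply: cvgD; [exact: FF|exact: GG].
Qed.

Lemma lb_cvgM Fn F Gn G : lb_cvg Fn F -> lb_cvg Gn G ->
  lb_cvg (fun n y => Fn n y * Gn n y) (fun y => F y * G y).
Proof.
move=> [cF bF FF] [cG bG GG]; split=> [n|M|y]; first exact: continuous_mul.
- have [C HC] := bF M; have [C' HC'] := bG M; exists (C * C') => n y yM.
  by rewrite normrM ler_pM ?HC ?HC'.
- by apply: cvgM; [exact: FF|exact: GG].
Qed.

Lemma lb_cvg_sum (J : Type) (s : seq J) (Fn : J -> nat -> RN -> R) (F : J -> RN -> R) :
  (forall j, lb_cvg (Fn j) (F j)) ->
  lb_cvg (fun n y => \sum_(j <- s) Fn j n y) (fun y => \sum_(j <- s) F j y).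
Proof.
move=> HF; elim: s => [|j s IHs].
  have := @lb_cvg_cst (fun=> 0) (@cst_continuous _ _ _).
  by congr lb_cvg; [apply/funext => n|]; apply/funext => y; rewrite big_nil.
have := lb_cvgD (HF j) IHs.
by congr lb_cvg; [apply/funext => n|]; apply/funext => y; rewrite big_cons.
Qed.

Lemma bounded_on_segment (f : R -> R) (C : R) : continuous f ->
  exists B, forall x, `|x| <= C -> `|f x| <= B.
Proof.
move=> cf.
have /compact_bounded[B [_ HB]] : compact (f @` `[- C, C]%classic).
  apply: continuous_compact; last exact: segment_compact.
  exact: continuous_subspaceT.
exists (`|B| + 1) => x xC; apply: HB; first by rewrite (le_lt_trans (ler_norm _))// ltrDl.
by exists x => //=; rewrite in_itv/= -ler_norml.
Qed.

Lemma lb_cvg_comp (f : R -> R) Fn F : continuous f -> lb_cvg Fn F ->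
  lb_cvg (fun n y => f (Fn n y)) (fun y => f (F y)).
Proof.
move=> cf [cF bF FF]; split=> [n|M|y]; first exact: continuous_real_comp.
- have [C HC] := bF M; have [B HB] := bounded_on_segment C cf.
  by exists B => n y yM; apply: HB; apply: HC.
- by apply: continuous_cvg; [exact: cf|exact: FF].
Qed.

Lemma Int_lb_cvg F Gn G : C0c F -> lb_cvg Gn G ->
  Int (fun y => F y * Gn n y) @[n --> \oo] --> Int (fun y => F y * G y).
Proof. by move=> cF [cG bG GG]; exact: Int_cvgM. Qed.

End locally_bounded_convergence.

(** * Regularised powers *)

Section regularised_powers.
Context {R : realType}.

(* The absolute value only makes the function continuous on the whole line. *)
Definition rpow (a s x : R) : R := (`|x| + a) `^ s.

Lemma rpow_continuous a s : 0 < a -> continuous (rpow a s).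
Proof.
move=> a0 x; rewrite /rpow.
apply: (@continuous_comp _ _ _ (fun x : R => `|x| + a) (fun z => z `^ s)).
  by apply: continuousD; [exact: norm_continuous|exact: cst_continuous].
apply: differentiable_continuous; apply/derivable1_diffP.
have xa : 0 < `|x| + a by rewrite ltr_wpDl.
by case: (is_derive1_powR s xa).
Qed.

Lemma rpow_ge0 a s x : 0 <= rpow a s x.
Proof. exact: powR_ge0. Qed.

(** Without the absolute value the function is differentiable at [x = 0] too, a value taken wherever
    the mollified vorticity vanishes. *)
Lemma is_derive_shift_powR a s (x : R) : 0 < a -> 0 <= x ->
  is_derive x (1 : R) (fun z => (z + a) `^ s) (s * rpow a (s - 1) x).
Proof.
move=> a0 x0; rewrite /rpow ger0_norm//.
have xa : 0 < x + a by rewrite ltr_wpDl.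
have H := is_deriveD (is_derive_id x (1 : R)) (is_derive_cst a x (1 : R)).
rewrite -[X in is_derive _ _ _ X]mulr1 -[X in _ * X](addr0 1).
exact: (@is_derive1_comp _ (fun z => z `^ s) (fun z => z + a) x _ _
  (is_derive1_powR s xa) H).
Qed.

(** From [x <= x + a]. It absorbs the factor [vsq] of the source estimate into the undifferentiated
    power. *)
Lemma rpowB1_le a s x : 0 < a -> 0 <= x -> 0 <= s ->
  s * rpow a (s - 1) x * x <= s * rpow a s x.
Proof.
move=> a0 x0 s0; rewrite -mulrA ler_wpM2l// /rpow ger0_norm//.
have xa : 0 < x + a by rewrite ltr_wpDl.
apply: (@le_trans _ _ ((x + a) `^ (s - 1) * (x + a))).
  by rewrite ler_wpM2l ?powR_ge0// lerDl ltW.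
have -> : (x + a) `^ s = (x + a) `^ (s - 1 + 1) by rewrite subrK.
rewrite [leRHS]powRD ?powRr1 ?(ltW xa)//.
by rewrite (gt_eqF xa) implybT.
Qed.

Lemma powR_cvg_mrad (x s : R) : 0 <= x -> 0 < s ->
  rpow (mrad n) s x @[n --> \oo] --> x `^ s.
Proof.
move=> x0 s0; rewrite /rpow ger0_norm//.
have cr : mrad n @[n --> \oo] --> (0 : R).
  apply/cvgrPdist_lt => e e0; near=> n.
  by rewrite sub0r normrN gtr0_norm ?mrad_gt0//; near: n; exact: near_mrad.
move: x0; rewrite le_eqVlt => /predU1P[<-|x0].
  rewrite powR0 ?gt_eqF//; under eq_fun do rewrite add0r.
  apply/cvgrPdist_lt => e e0; near=> n.
  rewrite sub0r normrN ger0_norm ?powR_ge0//.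
  rewrite -[X in _ < X](_ : (e `^ s^-1) `^ s = e); last first.
    by rewrite -powRrM mulVf ?gt_eqF// powRr1// ltW.
  apply: gt0_ltr_powR => //; rewrite ?nnegrE ?powR_ge0// ?ltW ?mrad_gt0//.
  by near: n; apply: near_mrad; exact: powR_gt0.
have cx : continuous_at x (fun z => z `^ s).
  apply: differentiable_continuous; apply/derivable1_diffP.
  by case: (is_derive1_powR s x0).
have h : x + mrad n @[n --> \oo] --> x.
  by rewrite -[X in _ --> X]addr0; apply: cvgD => //; exact: cvg_cst.
exact: cvg_comp h cx.
Unshelve. all: by end_near. Qed.

End regularised_powers.

(** * Kernel bounds for the commutator *)

Section commutator.
Context {R : realType} {N : nat}.
Local Notation RN := 'rV[R]_N.
Implicit Types (i j k : 'I_N) (y z : RN) (r : R).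

(** Cauchy-Schwarz, by bounding each product in the double sum by half the sum of the squares. *)
Lemma sqr_l1_le_nsq z : (\sum_i `|z 0 i|) ^+ 2 <= N%:R * nsq z.
Proof.
rewrite expr2 mulr_suml.
rewrite (@le_trans _ _ (\sum_i \sum_k (2^-1 * (z 0 i ^+ 2) + 2^-1 * z 0 k ^+ 2)))//.
  apply: ler_sum => i _; rewrite mulr_sumr; apply: ler_sum => k _.
  rewrite -(real_normK (num_real (z 0 i))) -(real_normK (num_real (z 0 k))).
  by have := sqr_ge0 (`|z 0 i| - `|z 0 k|); rewrite sqrrB; lra.
under eq_bigr => i _ do rewrite big_split/= -mulr_sumr sumr_const card_ord
  -[z 0 i ^+ 2 *+ N]mulr_natl -/(nsq z).
rewrite big_split/= sumr_const card_ord -!mulr_sumr -/(nsq z).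
rewrite -[X in _ + X]mulr_natl le_eqVlt; apply/orP; left.
by apply/eqP; field.
Qed.

Lemma rbump'0E r k z : rbump' 0 r k z = - 2 * rbump 2 r z * z 0 k.
Proof. by rewrite /rbump' mul0r subr0. Qed.

(* The kernel is radially decreasing, so that [|z| |grad rbump|] is controlled by
   [- z . grad rbump], which integrates by parts. *)
Lemma rbump'_weighted_le r z (x : 'I_N -> R) (L : R) : 0 <= L ->
  (forall k, `|x k| <= L * \sum_i `|z 0 i|) ->
  \sum_k `|x k * rbump' 0 r k z| <= - (L * N%:R) * \sum_k z 0 k * rbump' 0 r k z.
Proof.
move=> L0 Hx.
have -> : - (L * N%:R) * \sum_k z 0 k * rbump' 0 r k z = 2 * rbump 2 r z * L * (N%:R * nsq z).
  transitivity (- (L * N%:R) * (- 2 * rbump 2 r z * nsq z)); last by ring.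
  congr (_ * _); rewrite /nsq mulr_sumr; apply: eq_bigr => k _.
  by rewrite rbump'0E; ring.
apply: (@le_trans _ _ (2 * rbump 2 r z * L * (\sum_i `|z 0 i|) ^+ 2)); last first.
  by rewrite ler_wpM2l ?sqr_l1_le_nsq// !mulr_ge0// rbump_ge0.
rewrite expr2 mulrA mulr_sumr; apply: ler_sum => k _.
rewrite rbump'0E normrM [leRHS](_ : _ =
  (L * \sum_i `|z 0 i|) * (2 * rbump 2 r z * `|z 0 k|)); last by ring.
rewrite ler_pM// normrM ler_wpM2r// normrM normrN [`|2|]ger0_norm// ler_wpM2l//.
by rewrite ger0_norm// rbump_ge0.
Qed.

Lemma Int_coord_rbump' r (a : RN) k : 0 < r ->
  Int (fun z => (z - a) 0 k * rbump' 0 r k (z - a)) = - @rbump_mass R N r.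
Proof.
move=> r0.
have cK : C0c (fun z : RN => rbump 0 r (z - a)) by apply/C0c_shift/rbump_C0c; exact: ltW.
have d1 := isp_shift a (isp_coord k k).
have d2 := isp_shift a (isp_rbump 0 r k).
rewrite -[LHS]opprK -(Int_ibpr d1 d2 cK).
- by rewrite -(moll_rbump_mass a r0); congr (- Int _); apply/funext => z; rewrite eqxx mul1r.
- apply: (@continuous_translate _ _ (fun y : RN => y 0 k) a); exact: coordinate_continuous.
- exact: cst_continuous.
- by apply: continuous_translate; exact: rbump'_continuous.
Qed.

End commutator.

(** * Transport of the mollified vorticity *)

Section mollified_vorticity.
Context {R : realType} {N : nat}.
Local Notation RN := 'rV[R]_N.
Variables (v : RN -> RN) (alpha : R).
Hypotheses (halpha : -1 < alpha) (hC1 : C1_field v)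
  (hv : self_similar_profile v alpha).
Implicit Types (i j k : 'I_N) (y z : RN).

Local Notation drift := (drift v alpha).
Local Notation rate := (rate alpha).
Local Notation vort := (vort v).
Local Notation vort_rhs := (vort_rhs v).

Definition mvort n i j := mollify n (vort i j).

Definition mvort' n k i j y : R :=
  - moll (vort i j) (rbump' 0 (mrad n) k) y / @rbump_mass R N (mrad n).

Lemma isp_mvort n k i j : isp k (mvort n i j) (mvort' n k i j).
Proof.
have cK : C0c (@rbump R N 0 (mrad n)) by apply: rbump_C0c; rewrite ltW// mrad_gt0.
have H := isp_scale (@rbump_mass R N (mrad n))^-1 (isp_moll (@vort_continuous _ _ _ hC1 i j) cK
  (isp_rbump 0 (mrad n) k) (@rbump'_continuous R N _ 0 k)).
by apply: (isp_ext H) => y; rewrite mulrC.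
Qed.

Lemma mvort'_continuous n k i j : continuous (mvort' n k i j).
Proof.
apply: continuous_mul; last exact: cst_continuous.
move=> y; apply: continuousN; apply: moll_continuous.
- exact: vort_continuous.
- by apply: rbump'_C0c; rewrite ltW// mrad_gt0.
- exact: Ck_rbump'.
Qed.

Definition transport n i j y : R := \sum_k drift k y * mvort' n k i j y.

(* DiPerna-Lions commutator estimate: the difference quotients of [drift] absorb
   the derivative falling on the kernel, since [vort - a] is small on its support. *)
Lemma transport_dist n i j y (L a g e f : R) : 0 <= L -> 0 <= e ->
  (forall k z, nsq (z - y) < mrad n ->
     `|drift k z - drift k y| <= L * \sum_l `|(z - y) 0 l|) ->
  (forall z, nsq (z - y) < mrad n -> `|vort i j z - a| <= e) ->
  (forall z, nsq (z - y) < mrad n -> `|vort_rhs i j z - g| <= f) ->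
  `|transport n i j y - g| <= f + N%:R * rate * e + L * N%:R * N%:R * e.
Proof.
move=> L0 e0 HL Ha Hg.
set r := mrad n in HL Ha Hg *.
have r0 : 0 < r by exact: mrad_gt0.
set c := @rbump_mass R N r.
have c0 : 0 < c by exact: rbump_mass_gt0.
have cK : C0c (fun z : RN => rbump 0 r (z - y)) by apply/C0c_shift/rbump_C0c; exact: ltW.
have cK' k : C0c (fun z : RN => rbump' 0 r k (z - y)) by apply/C0c_shift/rbump'_C0c; exact: ltW.
have cb := drift_continuous hC1.
have cw := @vort_continuous _ _ _ hC1 i j.
have cr := @vort_rhs_continuous _ _ _ hC1 i j.
have ca : continuous (fun z => vort i j z - a) by apply: continuous_sub => //; exact: cst_continuous.
have cdb k : continuous (fun z => drift k z - drift k y).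
  by apply: continuous_sub; [exact: cb|exact: cst_continuous].
(* The commutator kernel. Its integral is minus the divergence of the drift times the mass, so
   subtracting the constant [a] from [vort] in the commutator and in the zeroth-order term changes
   nothing in total; this is [main]. *)
pose Q z := \sum_k (drift k z - drift k y) * rbump' 0 r k (z - y).
have cQ : C0c Q by apply: C0c_sum => k _; apply: C0cMl.
have IQ : Int Q == - (N%:R * rate * c).
  rewrite Int_sum => [|k _]; last exact: C0cMl.
  rewrite (eq_bigr (fun k => - Int (fun z => drift' v alpha k k z * rbump 0 r (z - y)))).
    rewrite sumrN -Int_sum => [|k _]; last by apply: C0cMl => //; exact: drift'_continuous.
    rewrite eqr_opp (_ : (fun z => _) = fun z => N%:R * rate * rbump 0 r (z - y)).
      by rewrite IntZ// moll_rbump_mass.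
    by apply/funext => z; rewrite -mulr_suml (div_drift hC1 hv).
  move=> k _.
  have dD : isp k (fun z => drift k z - drift k y) (drift' v alpha k k).
    apply: (isp_ext (isp_sub (isp_drift alpha hC1 k k) (isp_cst k (drift k y)))) => // z.
    by rewrite subr0.
  rewrite -[LHS]opprK -(Int_ibpr dD (isp_shift y (isp_rbump 0 r k)))//.
  - exact: drift'_continuous.
  - exact: (cK' k).1.
have cS : C0c (fun z => \sum_k drift k z * rbump' 0 r k (z - y)).
  by apply: C0c_sum => k _; apply: C0cMl.
have cSy : C0c (fun z => \sum_k drift k y * rbump' 0 r k (z - y)).
  by apply: C0c_sum => k _; apply: C0cZ.
have TE : transport n i j y * c ==
    - Int (fun z => (\sum_k drift k y * rbump' 0 r k (z - y)) * vort i j z).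
  rewrite (_ : (fun z => _) =
    fun z => \sum_k drift k y * (vort i j z * rbump' 0 r k (z - y))); last first.
    by apply/funext => z; rewrite mulr_suml; apply: eq_bigr => k _;
      rewrite -mulrA [rbump' _ _ _ _ * _]mulrC.
  rewrite Int_sum => [|k _]; last by apply: C0cZ; apply: C0cMl.
  rewrite -sumrN /transport mulr_suml; apply/eqP; apply: eq_bigr => k _.
  rewrite IntZ; last exact: C0cMl.
  by rewrite /mvort' -mulrA mulfVK ?gt_eqF// mulrN.
have QE : Int (fun z => Q z * vort i j z) ==
    - (N%:R * rate * Int (fun z => vort i j z * rbump 0 r (z - y))
       + Int (fun z => vort_rhs i j z * rbump 0 r (z - y))) + transport n i j y * c.
  rewrite (eqP TE) -(weak_vorticity halpha hC1 hv i j y r0) -IntB; [|exact: C0cMr..].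
  apply/eqP; congr Int; apply/funext => z; rewrite -mulrBl -sumrB; congr (_ * _).
  by apply: eq_bigr => k _; rewrite mulrBl.
have I1 : Int (fun z => Q z * (vort i j z - a)) ==
    Int (fun z => Q z * vort i j z) + a * (N%:R * rate * c).
  rewrite -[_ * (_ * c)]opprK -mulrN -(eqP IQ) -IntZ// -IntB; [|exact: C0cMr|exact: C0cZ].
  by apply/eqP; congr Int; apply/funext => z; ring.
have I2 : Int (fun z => (vort i j z - a) * rbump 0 r (z - y)) ==
    Int (fun z => vort i j z * rbump 0 r (z - y)) - a * c.
  rewrite /c -(moll_rbump_mass y r0) -IntZ// -IntB; [|exact: C0cMl|exact: C0cZ].
  by apply/eqP; congr Int; apply/funext => z; ring.
have I3 : Int (fun z => (vort_rhs i j z - g) * rbump 0 r (z - y)) ==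
    Int (fun z => vort_rhs i j z * rbump 0 r (z - y)) - g * c.
  rewrite /c -(moll_rbump_mass y r0) -IntZ// -IntB; [|exact: C0cMl|exact: C0cZ].
  by apply/eqP; congr Int; apply/funext => z; ring.
have main : (transport n i j y - g) * c ==
    Int (fun z => (vort_rhs i j z - g) * rbump 0 r (z - y)) +
    N%:R * rate * Int (fun z => (vort i j z - a) * rbump 0 r (z - y)) +
    Int (fun z => Q z * (vort i j z - a)).
  rewrite (eqP I1) (eqP I2) (eqP I3) (eqP QE); apply/eqP; ring.
have rt0 := rate_gt0 halpha.
have B1 : `|Int (fun z => (vort_rhs i j z - g) * rbump 0 r (z - y))| <= f * c.
  by rewrite (eqP I3); exact: moll_dist cr r0 Hg.
have B2 : `|Int (fun z => (vort i j z - a) * rbump 0 r (z - y))| <= e * c.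
  by rewrite (eqP I2); exact: moll_dist cw r0 Ha.
have cQ' : C0c (fun z => Q z * (vort i j z - a)) by exact: C0cMr.
(* The integrand is at most [e] times a multiple of [- z . grad rbump], each coordinate of which
   integrates to the mass [c]. *)
have B3 : `|Int (fun z => Q z * (vort i j z - a))| <= L * N%:R * N%:R * e * c.
  rewrite (le_trans (ler_norm_Int cQ'))//.
  have cP k : C0c (fun z => (z - y) 0 k * rbump' 0 r k (z - y)).
    apply: C0cMl => //; apply: (@continuous_translate _ _ (fun y : RN => y 0 k) y).
    exact: coordinate_continuous.
  have IP : Int (fun z => e * (- (L * N%:R) * \sum_k (z - y) 0 k * rbump' 0 r k (z - y))) ==
      L * N%:R * N%:R * e * c.
    rewrite IntZ; last by apply: C0cZ; apply: C0c_sum.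
    rewrite IntZ; last by apply: C0c_sum.
    rewrite Int_sum//; under eq_bigr do rewrite Int_coord_rbump'//.
    by rewrite sumr_const card_ord -/c -mulr_natl; apply/eqP; ring.
  rewrite -(eqP IP); apply: le_Int; first exact: C0c_norm.
    by do 2 apply: C0cZ; apply: C0c_sum.
  move=> z; rewrite normrM mulrC; have [zr|zr] := ltP (nsq (z - y)) r.
    apply: ler_pM => //; first exact: Ha.
    by rewrite (le_trans (ler_norm_sum _ _ _))// rbump'_weighted_le// => k; exact: HL.
  have z0 k : rbump' 0 r k (z - y) = 0.
    by rewrite rbump'0E /rbump flat_le0 ?subr_le0// mulr0 mul0r.
  rewrite /Q big1 => [|k _]; last by rewrite z0 mulr0.
  by rewrite normr0 mulr0 big1 ?mulr0// => k _; rewrite z0 mulr0.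
rewrite -(ler_pM2r c0) -[X in _ * X <= _](gtr0_norm c0) -normrM (eqP main).
rewrite (le_trans (ler_normD _ _))// mulrDl lerD//.
rewrite (le_trans (ler_normD _ _))// mulrDl lerD//.
have d0 : 0 <= N%:R * rate by rewrite mulr_ge0// ltW.
by rewrite normrM (ger0_norm d0) -[leRHS]mulrA ler_wpM2l.
Qed.

End mollified_vorticity.

(** * Renormalised inequality for powers of the vorticity *)

Section renormalisation.
Context {R : realType} {N : nat}.
Local Notation RN := 'rV[R]_N.
Variables (v : RN -> RN) (alpha : R).
Hypotheses (halpha : -1 < alpha) (hC1 : C1_field v)
  (hv : self_similar_profile v alpha).
Implicit Types (i j k : 'I_N) (y z : RN).

Local Notation drift := (drift v alpha).
Local Notation rate := (rate alpha).
Local Notation vort := (vort v).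
Local Notation vort_rhs := (vort_rhs v).
Local Notation transport := (transport v alpha).

Lemma drift_lipschitz (M : R) : exists2 L, 0 <= L & forall k y z,
  `|y| <= M -> `|z| <= M -> `|drift k z - drift k y| <= L * \sum_l `|(z - y) 0 l|.
Proof.
have H k : exists L, 0 <= L /\ forall y z, `|y| <= M -> `|z| <= M ->
    `|drift k z - drift k y| <= L * \sum_l `|(z - y) 0 l|.
  have [L L0 HL] := C1_continuous (isp_drift alpha hC1 ^~ k)
    (fun j => @drift'_continuous _ _ _ alpha hC1 j k) M.
  by exists L.
have [L HL] := choice H.
exists (\sum_k L k) => [|k y z yM zM]; first by apply: sumr_ge0 => k _; have [] := HL k.
have [_ /(_ y z yM zM)/le_trans] := HL k; apply; rewrite ler_wpM2r ?sumr_ge0//.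
by rewrite (bigD1 k)//= lerDl sumr_ge0// => l _; have [] := HL l.
Qed.

Lemma transport_continuous n i j : continuous (transport n i j).
Proof.
apply: sum_continuous => k; apply: continuous_mul; first exact: drift_continuous.
exact: mvort'_continuous.
Qed.

(** [transport_dist] is used twice: with [a = g = 0] and crude bounds for local boundedness, then
    with [a], [g] the values at [y] and a small oscillation for convergence. *)
Lemma transport_lb_cvg i j : lb_cvg (fun n => transport n i j) (vort_rhs i j).
Proof.
have rt0 := rate_gt0 halpha.
have small n y z : nsq (z - y) < mrad n -> `|z| <= `|y| + 1.
  by move=> h; apply: nsq_lt1_norm; exact: lt_le_trans h (mrad_le1 n).
have Lip M : exists2 L, 0 <= L & forall n y, `|y| <= M -> forall k z,
    nsq (z - y) < mrad n -> `|drift k z - drift k y| <= L * \sum_l `|(z - y) 0 l|.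
  have [L L0 HL] := drift_lipschitz (M + 1); exists L => // n y yM k z zn.
  by apply: HL; [lra|have := small n y z zn; lra].
split=> [n|M|y]; first exact: transport_continuous.
- have [L L0 HL] := Lip M.
  have [C HC] := bounded_on_ball (M + 1) (@vort_continuous _ _ _ hC1 i j).
  have [C' HC'] := bounded_on_ball (M + 1) (@vort_rhs_continuous _ _ _ hC1 i j).
  exists (C' + N%:R * rate * `|C| + L * N%:R * N%:R * `|C|) => n y yM.
  rewrite -[transport _ _ _ _]subr0; apply: (transport_dist halpha hC1 hv (a := 0)) => //.
  + by move=> k z; exact: HL.
  + move=> z zn; rewrite subr0 (le_trans _ (ler_norm _))// HC//.
    by have := small n y z zn; lra.
  + move=> z zn; rewrite subr0 HC'//.
    by have := small n y z zn; lra.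
- have [L L0 HL] := Lip `|y|.
  apply/cvgrPdist_le => e e0.
  pose D := 1 + N%:R * rate + L * N%:R * N%:R.
  have D0 : 0 < D.
    by rewrite /D -addrA ltr_wpDr// addr_ge0// !mulr_ge0// ltW.
  pose e' := e / D; have e'0 : 0 < e' by rewrite divr_gt0.
  have [d1 d10 H1] : exists2 d, 0 < d &
      forall z, nsq (z - y) < d -> `|vort i j z - vort i j y| <= e'.
    have /cvgrPdist_le/(_ _ e'0)/nsq_small_ball[d d0 Hd] := @vort_continuous _ _ _ hC1 i j y.
    by exists d => // z /Hd; rewrite distrC.
  have [d2 d20 H2] : exists2 d, 0 < d &
      forall z, nsq (z - y) < d -> `|vort_rhs i j z - vort_rhs i j y| <= e'.
    have /cvgrPdist_le/(_ _ e'0)/nsq_small_ball[d d0 Hd] := @vort_rhs_continuous _ _ _ hC1 i j y.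
    by exists d => // z /Hd; rewrite distrC.
  near=> n; rewrite distrC.
  have n1 : mrad n < d1 by near: n; exact: near_mrad.
  have n2 : mrad n < d2 by near: n; exact: near_mrad.
  rewrite (le_trans (transport_dist halpha hC1 hv (a := vort i j y) (e := e')
    (f := e') (L := L) _ _ _ _ _))//.
  + exact: ltW.
  + by move=> k z; exact: HL.
  + by move=> z zn; apply: H1; exact: lt_trans n1.
  + by move=> z zn; apply: H2; exact: lt_trans n2.
  + rewrite (_ : e' + _ + _ = e' * D); last by rewrite /D; ring.
    by rewrite /e' divfK// gt_eqF.
Unshelve. all: by end_near. Qed.

Definition vsq y : R := \sum_i \sum_j vort i j y ^+ 2.

Definition mvsq n y : R := \sum_i \sum_j mvort v n i j y ^+ 2.

Lemma vsq_ge0 y : 0 <= vsq y.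
Proof. by apply: sumr_ge0 => i _; apply: sumr_ge0 => j _; exact: sqr_ge0. Qed.

Lemma mvsq_ge0 n y : 0 <= mvsq n y.
Proof. by apply: sumr_ge0 => i _; apply: sumr_ge0 => j _; exact: sqr_ge0. Qed.

Lemma vsq_continuous : continuous vsq.
Proof.
apply: sum_continuous => i; apply: sum_continuous => j.
by apply: continuous_mul; exact: vort_continuous.
Qed.

Lemma mvsq_lb_cvg : lb_cvg mvsq vsq.
Proof.
apply: lb_cvg_sum => i; apply: lb_cvg_sum => j.
by apply: lb_cvgM; apply: lb_cvg_mollify; exact: vort_continuous.
Qed.

Definition mvsq' n k y : R :=
  \sum_i \sum_j 2 * (mvort v n i j y * mvort' v n k i j y).

Lemma isp_mvsq n k : isp k (mvsq n) (mvsq' n k).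
Proof.
apply: isp_sum => i; apply: isp_sum => j.
have H := isp_mvort hC1 n k i j.
apply: (isp_ext (isp_mul H H)) => y; first by rewrite expr2.
by ring.
Qed.

Lemma mvort_continuous n i j : continuous (mvort v n i j).
Proof. by apply: mollify_continuous; exact: vort_continuous. Qed.

Lemma mvsq'_continuous n k : continuous (mvsq' n k).
Proof.
apply: sum_continuous => i; apply: sum_continuous => j.
apply: continuous_scale; apply: continuous_mul; first exact: mvort_continuous.
exact: mvort'_continuous.
Qed.

(** What [drift . grad vsq] would be if [vort] were differentiable; it arises as the limit of
    [drift . grad (mvsq n)]. *)
Definition sqsource y : R := \sum_i \sum_j 2 * (vort i j y * vort_rhs i j y).

Lemma drift_mvsq' n y : \sum_k drift k y * mvsq' n k y =
  \sum_i \sum_j 2 * (mvort v n i j y * transport n i j y).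
Proof.
under eq_bigr do rewrite mulr_sumr.
rewrite exchange_big/=; apply: eq_bigr => i _.
under eq_bigr do rewrite mulr_sumr.
rewrite exchange_big/=; apply: eq_bigr => j _.
rewrite /transport !mulr_sumr; apply: eq_bigr => k _; ring.
Qed.

Lemma drift_mvsq'_lb_cvg : lb_cvg (fun n y => \sum_k drift k y * mvsq' n k y) sqsource.
Proof.
rewrite (_ : (fun n => _) = (fun n y => \sum_i \sum_j 2 * (mvort v n i j y * transport n i j y))).
  apply: lb_cvg_sum => i; apply: lb_cvg_sum => j; apply: lb_cvgM.
    by apply: lb_cvg_cst; exact: cst_continuous.
  apply: lb_cvgM; last exact: transport_lb_cvg.
  by apply: lb_cvg_mollify; exact: vort_continuous.
by apply/funext => n; apply/funext => y; exact: drift_mvsq'.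
Qed.

Section cutoff.
Variables (chi : RN -> R) (chi' : 'I_N -> RN -> R).
Hypotheses (cchi : C0c chi) (dchi : forall k, isp k chi (chi' k))
  (cchi' : forall k, continuous (chi' k)).

(** The divergence of [chi * drift]. *)
Definition div_cutoff y : R := N%:R * rate * chi y + \sum_k drift k y * chi' k y.

Lemma div_cutoff_C0c : C0c div_cutoff.
Proof.
apply: C0cD; first exact: C0cZ.
apply: C0c_sum => k _; apply: C0cMl; first exact: drift_continuous.
exact: isp_C0c (dchi k) _ _.
Qed.

Lemma Int_div_cutoff (F : RN -> R) (F' : 'I_N -> RN -> R) : continuous F ->
  (forall k, isp k F (F' k)) -> (forall k, continuous (F' k)) ->
  Int (fun y => div_cutoff y * F y) = - Int (fun y => chi y * \sum_k drift k y * F' k y).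
Proof.
move=> cF dF cF'.
have cb := drift_continuous hC1.
have cb' := @drift'_continuous _ _ _ alpha hC1.
have cchi0 k : C0c (chi' k) := isp_C0c (dchi k) cchi (@cchi' k).
have cB k : C0c (fun y => drift k y * chi y) by apply: C0cMl.
have cB' k : C0c (fun y => drift' v alpha k k y * chi y + drift k y * chi' k y).
  by apply: C0cD; apply: C0cMl.
have -> : (fun y => div_cutoff y * F y) = fun y =>
    \sum_k (drift' v alpha k k y * chi y + drift k y * chi' k y) * F y.
  apply/funext => y; rewrite /div_cutoff -mulr_suml; congr (_ * _).
  by rewrite big_split/= -mulr_suml (div_drift hC1 hv).
rewrite Int_sum => [|k _]; last exact: C0cMr.
have -> : (fun y => chi y * \sum_k drift k y * F' k y) = fun y =>
    \sum_k (drift k y * chi y) * F' k y.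
  by apply/funext => y; rewrite mulr_sumr; apply: eq_bigr => k _; ring.
rewrite Int_sum => [|k _]; last exact: C0cMr.
rewrite -sumrN; apply: eq_bigr => k _.
by apply: (Int_ibp (isp_mul (isp_drift alpha hC1 k k) (dchi k)) (dF k) (cB k) (cB' k).1).
Qed.

(** For the smooth [mvsq n] this is the chain rule and an integration by parts; both sides then
    converge as [n] grows, since the transport of the mollified vorticity converges to
    [vort_rhs]. *)
Lemma renormalised_identity (a s : R) : 0 < a ->
  Int (fun y => div_cutoff y * rpow a s (vsq y)) =
  - Int (fun y => chi y * (s * rpow a (s - 1) (vsq y) * sqsource y)).
Proof.
move=> a0.
have cd := div_cutoff_C0c.
have h1 : Int (fun y => div_cutoff y * rpow a s (mvsq n y)) @[n --> \oo] -->
    Int (fun y => div_cutoff y * rpow a s (vsq y)).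
  by apply: Int_lb_cvg => //; apply: lb_cvg_comp mvsq_lb_cvg; exact: rpow_continuous.
have h2 : Int (fun y => chi y * (s * rpow a (s - 1) (mvsq n y) *
      (\sum_k drift k y * mvsq' n k y))) @[n --> \oo] -->
    Int (fun y => chi y * (s * rpow a (s - 1) (vsq y) * sqsource y)).
  apply: Int_lb_cvg => //; apply: lb_cvgM; last exact: drift_mvsq'_lb_cvg.
  apply: lb_cvgM; first by apply: lb_cvg_cst; exact: cst_continuous.
  by apply: lb_cvg_comp mvsq_lb_cvg; exact: rpow_continuous.
have E n : Int (fun y => div_cutoff y * rpow a s (mvsq n y)) ==
    - Int (fun y => chi y * (s * rpow a (s - 1) (mvsq n y) *
      (\sum_k drift k y * mvsq' n k y))).
  have dP k : isp k (fun y => rpow a s (mvsq n y))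
      (fun y => s * rpow a (s - 1) (mvsq n y) * mvsq' n k y).
    have H := @isp_comp R N k (fun x => (x + a) `^ s) (fun x => s * rpow a (s - 1) x)
      (mvsq n) (mvsq' n k) (fun y => is_derive_shift_powR s a0 (mvsq_ge0 n y)) (isp_mvsq n k).
    apply: (isp_ext H) => // y.
    by rewrite /rpow ger0_norm// mvsq_ge0.
  have cS : continuous (mvsq n) by case: mvsq_lb_cvg => + _ _; exact.
  have cr t : continuous (fun y => rpow a t (mvsq n y)).
    by apply: continuous_real_comp cS; exact: rpow_continuous.
  apply/eqP; rewrite (Int_div_cutoff (cr s) dP).
    congr (- Int _); apply/funext => y; congr (_ * _).
    by rewrite mulr_sumr; apply: eq_bigr => k _; rewrite mulrCA.
  move=> k; apply: continuous_mul; last exact: mvsq'_continuous.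
  exact: continuous_scale.
have h3 : Int (fun y => div_cutoff y * rpow a s (mvsq n y)) @[n --> \oo] -->
    - Int (fun y => chi y * (s * rpow a (s - 1) (vsq y) * sqsource y)).
  by rewrite (eq_cvg _ _ (fun n => eqP (E n))); exact: cvgN h2.
exact: cvg_unique h1 h3.
Qed.

(** The quadratic part of [vort_rhs] is strain times vorticity plus vorticity times strain. With the
    strain entries bounded by [t], each triple product is controlled by squares of vorticity
    entries. *)
Lemma sqsource_ge y (t : R) : (forall i j, `|strain v y i j| <= t) ->
  - sqsource y <= 2 * (1 + 2 * N%:R * t) * vsq y.
Proof.
move=> ht.
have vE i j : vort_rhs i j y = - vort i j y +
    \sum_k (strain v y i k * vort k j y + vort i k y * strain v y k j).
  rewrite /vort_rhs mulr_sumr; congr (_ + _); apply: eq_bigr => k _.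
  by rewrite !mxE /vort /grad; field.
have aux i j k : - (vort i j y * (strain v y i k * vort k j y + vort i k y * strain v y k j)) <=
    t * (vort i j y ^+ 2 + 2^-1 * vort k j y ^+ 2 + 2^-1 * vort i k y ^+ 2).
  have t0 : 0 <= t by exact: le_trans (ht i j).
  have B (x w z : R) : `|x| <= t -> - (w * (x * z)) <= t * (2^-1 * (w ^+ 2 + z ^+ 2)).
    move=> xt; rewrite (le_trans (ler_norm _))// normrN !normrM mulrCA ler_pM ?mulr_ge0//.
    rewrite -(real_normK (num_real w)) -(real_normK (num_real z)).
    by have := sqr_ge0 (`|w| - `|z|); rewrite sqrrB; lra.
  have h1 := B _ (vort i j y) (vort k j y) (ht i k).
  have h2 := B _ (vort i j y) (vort i k y) (ht k j).
  have := lerD h1 h2.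
  rewrite (_ : - _ + - _ = - (vort i j y *
    (strain v y i k * vort k j y + vort i k y * strain v y k j))); last by ring.
  by rewrite (_ : t * _ + t * _ =
    t * (vort i j y ^+ 2 + 2^-1 * vort k j y ^+ 2 + 2^-1 * vort i k y ^+ 2)); last by field.
have -> : - sqsource y = 2 * vsq y + 2 * \sum_i \sum_j \sum_k
    - (vort i j y * (strain v y i k * vort k j y + vort i k y * strain v y k j)).
  rewrite /sqsource /vsq !mulr_sumr -sumrN -big_split/=; apply: eq_bigr => i _.
  rewrite !mulr_sumr -sumrN -big_split/=; apply: eq_bigr => j _.
  by rewrite vE sumrN -mulr_sumr; ring.
rewrite (_ : 2 * (1 + 2 * N%:R * t) * vsq y =
  2 * vsq y + 2 * (t * (2 * (N%:R * vsq y)))); last by ring.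
rewrite lerD2l ler_wpM2l//.
apply: (@le_trans _ _ (\sum_i \sum_j \sum_k
    t * (vort i j y ^+ 2 + 2^-1 * vort k j y ^+ 2 + 2^-1 * vort i k y ^+ 2))).
  by apply: ler_sum => i _; apply: ler_sum => j _; apply: ler_sum => k _; exact: aux.
(* Each of the three triple sums is [N * vsq y]; their weights 1, 1/2 and 1/2 account for the factor
   2. *)
have E1 : \sum_i \sum_j \sum_(k < N) vort i j y ^+ 2 = N%:R * vsq y.
  rewrite /vsq mulr_sumr; apply: eq_bigr => i _; rewrite mulr_sumr; apply: eq_bigr => j _.
  by rewrite sumr_const card_ord mulr_natl.
have E2 : \sum_(i < N) \sum_j \sum_k vort k j y ^+ 2 = N%:R * vsq y.
  by rewrite sumr_const card_ord mulr_natl; congr (_ *+ _); rewrite exchange_big.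
have E3 : \sum_i \sum_(j < N) \sum_k vort i k y ^+ 2 = N%:R * vsq y.
  rewrite /vsq mulr_sumr; apply: eq_bigr => i _.
  by rewrite sumr_const card_ord mulr_natl.
rewrite le_eqVlt; apply/orP; left; apply/eqP.
transitivity (t * (\sum_i \sum_j \sum_(k < N) vort i j y ^+ 2
  + 2^-1 * (\sum_(i < N) \sum_j \sum_k vort k j y ^+ 2)
  + 2^-1 * (\sum_i \sum_(j < N) \sum_k vort i k y ^+ 2))); last first.
  by rewrite E1 E2 E3; field.
rewrite !(mulr_sumr _ _ _ 2^-1) -2!big_split/= mulr_sumr; apply: eq_bigr => i _.
rewrite !(mulr_sumr _ _ _ 2^-1) -2!big_split/= mulr_sumr; apply: eq_bigr => j _.
by rewrite !(mulr_sumr _ _ _ 2^-1) -2!big_split/= mulr_sumr.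
Qed.

Hypothesis chi_ge0 : forall y, 0 <= chi y.

(** [t] is a continuous majorant of the strain entries, and [2 * s] is the exponent of the norm of
    the vorticity. The source in [renormalised_identity] is bounded by [sqsource_ge], then by
    [rpowB1_le]. *)
Lemma renormalised_le_regular (a s : R) (t : RN -> R) : 0 < a -> 0 < s ->
  continuous t -> (forall y, 0 <= t y) -> (forall y i j, `|strain v y i j| <= t y) ->
  Int (fun y => (div_cutoff y - 2 * s * (1 + 2 * N%:R * t y) * chi y) * rpow a s (vsq y)) <= 0.
Proof.
move=> a0 s0 ct tge0 ht.
have cd := div_cutoff_C0c.
have cr u : continuous (fun y => rpow a u (vsq y)).
  by apply: continuous_real_comp vsq_continuous; exact: rpow_continuous.
have cm : continuous (fun y => 2 * s * (1 + 2 * N%:R * t y)).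
  apply: continuous_scale; apply: continuous_add; first exact: cst_continuous.
  exact: continuous_scale.
have c1 : C0c (fun y => 2 * s * (1 + 2 * N%:R * t y) * chi y) by exact: C0cMl.
have cs : continuous sqsource.
  apply: sum_continuous => i; apply: sum_continuous => j; apply: continuous_scale.
  by apply: continuous_mul; [exact: vort_continuous|exact: vort_rhs_continuous].
under eq_fun do rewrite mulrBl; rewrite IntB; [|exact: C0cMr..].
rewrite renormalised_identity// -IntN; last first.
  by apply: C0cMr => //; apply: continuous_mul => //; exact: continuous_scale.
rewrite subr_le0; apply: le_Int.
- apply: C0cN; apply: C0cMr => //; apply: continuous_mul => //; exact: continuous_scale.
- exact: C0cMr.
move=> y; rewrite -mulrN -mulrN [leRHS](_ : _ =
  chi y * (2 * (1 + 2 * N%:R * t y) * (s * rpow a s (vsq y)))); last by ring.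
rewrite ler_wpM2l// (le_trans (ler_wpM2l _ (@sqsource_ge y (t y) (ht y))))//.
  by rewrite mulr_ge0 ?rpow_ge0// ltW.
have t0 : 0 <= 1 + 2 * N%:R * t y.
  by rewrite addr_ge0// !mulr_ge0.
rewrite [leLHS](_ : _ =
  2 * (1 + 2 * N%:R * t y) * (s * rpow a (s - 1) (vsq y) * vsq y)); last by ring.
by rewrite ler_wpM2l ?mulr_ge0// rpowB1_le ?vsq_ge0// ltW.
Qed.

Lemma renormalised_le (s : R) (t : RN -> R) : 0 < s ->
  continuous t -> (forall y, 0 <= t y) -> (forall y i j, `|strain v y i j| <= t y) ->
  Int (fun y => (div_cutoff y - 2 * s * (1 + 2 * N%:R * t y) * chi y) * vsq y `^ s) <= 0.
Proof.
move=> s0 ct tge0 ht.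
have cH : C0c (fun y => div_cutoff y - 2 * s * (1 + 2 * N%:R * t y) * chi y).
  apply: C0cB; first exact: div_cutoff_C0c.
  apply: C0cMl => //; apply: continuous_scale; apply: continuous_add.
    exact: cst_continuous.
  exact: continuous_scale.
have cr a : 0 < a -> continuous (fun y => rpow a s (vsq y)).
  by move=> a0; apply: continuous_real_comp vsq_continuous; exact: rpow_continuous.
have L : lb_cvg (fun n y => rpow (mrad n) s (vsq y)) (fun y => vsq y `^ s).
  split=> [n|M|y].
  - by apply: cr; exact: mrad_gt0.
  (* The regularised power increases with [a], so its value at [a = 1] bounds the whole sequence. *)
  - have [C HC] := bounded_on_ball M (cr 1 ltr01).
    exists C => n y yM; rewrite ger0_norm ?rpow_ge0// (le_trans _ (HC y yM))//.
    have n0 : 0 <= mrad n :> R by rewrite ltW// mrad_gt0.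
    rewrite (le_trans _ (ler_norm _))//; apply: ge0_ler_powR;
      rewrite ?nnegrE ?addr_ge0// ?lerD2l ?mrad_le1//.
    exact: ltW.
  - by apply: powR_cvg_mrad => //; exact: vsq_ge0.
have h := Int_lb_cvg cH L.
apply: (ler_cvg_to h (cvg_cst (0 : R))); apply: nearW => n.
by apply: renormalised_le_regular => //; exact: mrad_gt0.
Qed.

End cutoff.
End renormalisation.

(** * Cutoffs and growth of the drift *)

Section cutoffs.
Context {R : realType} {N : nat}.
Local Notation RN := 'rV[R]_N.
Implicit Types (k : 'I_N) (y : RN).

(** Squaring makes the positive part C^1, which is all the regularity that the cutoffs need. *)
Lemma is_derive_pos_sqr (x : R) :
  is_derive x (1 : R) (fun x => Num.max x 0 ^+ 2) (2 * Num.max x 0).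
Proof.
apply: (@is_derive_quadratic _ _ _ _ 1) => h; rewrite mul1r ler_norml.
have [hx|hx] := leP (h + x) 0; have [x0|x0] := leP x 0; apply/andP; split; nra.
Qed.

Lemma max_continuous (F : RN -> R) : continuous F -> continuous (fun y => Num.max (F y) 0).
Proof.
move=> cF y; apply: (@continuous_max R RN F (fun=> 0)); [exact: cF|exact: cst_continuous].
Qed.

Lemma inv_continuous (F : RN -> R) : continuous F -> (forall y, F y != 0) ->
  continuous (fun y => (F y)^-1).
Proof. by move=> cF F0 y; apply: continuousV; [exact: F0|exact: cF]. Qed.

(** Equal to 1 at the origin and 0 from [nsq y = exp (1 / tau) - 1] on; the radial derivative
    [y . grad] is of order [tau] wherever it is defined. *)
Definition profile (tau : R) y : R := Num.max (1 - tau * ln (1 + nsq y)) 0.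

Definition outer (tau : R) y : R := profile tau y ^+ 2.

Definition outer' (tau : R) k y : R :=
  2 * profile tau y * (- tau * (1 + nsq y)^-1) * (2 * y 0 k).

(** With [x] the positive part of [nsq y - a] this is [x^2 / (1 + x^2)]: C^1, zero on the ball,
    radially non-decreasing and below 1. *)
Definition inner (a : R) y : R := 1 - (1 + Num.max (nsq y - a) 0 ^+ 2)^-1.

Definition inner_slope (a : R) y : R :=
  2 * Num.max (nsq y - a) 0 * (1 + Num.max (nsq y - a) 0 ^+ 2) ^- 2.

Definition inner' (a : R) k y : R := inner_slope a y * (2 * y 0 k).

Lemma one_nsq_gt0 y : 0 < 1 + nsq y.
Proof. by rewrite ltr_wpDr ?nsq_ge0. Qed.

Lemma one_nsq_continuous : continuous (fun y => 1 + nsq y).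
Proof. by apply: continuous_add; [exact: cst_continuous|exact: nsq_continuous]. Qed.

Lemma profile_continuous tau : continuous (profile tau).
Proof.
apply: max_continuous; apply: continuous_sub; first exact: cst_continuous.
apply: continuous_scale => y.
apply: continuous_comp; first exact: one_nsq_continuous.
exact: continuous_ln (one_nsq_gt0 y).
Qed.

Lemma profile_ge0 tau y : 0 <= profile tau y.
Proof. by rewrite /profile le_max lexx orbT. Qed.

Lemma ln_one_nsq_ge0 y : 0 <= ln (1 + nsq y).
Proof. by rewrite ln_ge0// lerDl nsq_ge0. Qed.

Lemma profile_le1 tau y : 0 <= tau -> profile tau y <= 1.
Proof.
move=> t0; rewrite /profile ge_max ler01 andbT gerBl mulr_ge0//.
exact: ln_one_nsq_ge0.
Qed.

Lemma profile_anti tau tau' y : tau <= tau' -> profile tau' y <= profile tau y.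
Proof.
move=> tt; rewrite /profile ge_max !le_max lexx orbT andbT; apply/orP; left.
by rewrite lerD2l lerN2 ler_wpM2r// ln_one_nsq_ge0.
Qed.

Lemma profile_ge_half tau (b : R) y : 0 <= tau -> nsq y <= b -> tau * ln (1 + b) <= 2^-1 ->
  2^-1 <= profile tau y.
Proof.
move=> t0 yb tb; rewrite /profile le_max; apply/orP; left.
have : tau * ln (1 + nsq y) <= tau * ln (1 + b).
  by rewrite ler_wpM2l// ler_ln ?posrE ?lerD2l ?one_nsq_gt0// (lt_le_trans (one_nsq_gt0 y))// lerD2l.
by lra.
Qed.

Lemma profile_eq0 tau y : 0 < tau -> expR tau^-1 < `|y| -> profile tau y = 0.
Proof.
move=> t0 ey; rewrite /profile; apply/max_idPr; rewrite subr_le0.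
rewrite -[leLHS](mulfV (lt0r_neq0 t0)) ler_pM2l// -[leLHS]expRK ler_ln ?posrE ?expR_gt0 ?one_nsq_gt0//.
have e1 : 1 <= expR tau^-1 by rewrite -expR0 ler_expR invr_ge0 ltW.
have y2 : `|y| <= `|y| ^+ 2 by rewrite expr2 ler_peMl// (le_trans e1)// ltW.
rewrite (le_trans (ltW ey))// (le_trans y2)// (le_trans (nsq_ge_norm y))//.
by rewrite lerDr.
Qed.

Lemma outer_C0c tau : 0 < tau -> C0c (outer tau).
Proof.
move=> t0; split; last first.
  by exists (expR tau^-1) => y ey; rewrite /outer profile_eq0// expr0n.
by apply: continuous_mul; exact: profile_continuous.
Qed.

Lemma isp_outer tau k : isp k (outer tau) (outer' tau k).
Proof.
have H (y : RN) : is_derive (nsq y) (1 : R) (fun s => Num.max (1 - tau * ln (1 + s)) 0 ^+ 2)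
    (2 * Num.max (1 - tau * ln (1 + nsq y)) 0 * (- tau * (1 + nsq y)^-1)).
  have d1 : is_derive (nsq y) (1 : R) (fun s : R => 1 + s) (0 + 1).
    exact: is_deriveD (is_derive_cst (1 : R) _ _) (is_derive_id _ _).
  have d2 := is_derive1_comp (is_derive1_ln (one_nsq_gt0 y)) d1.
  have d3 : is_derive (nsq y) (1 : R) (fun s : R => 1 - tau * ln (1 + s))
      (0 - tau *: ((1 + nsq y)^-1 * (0 + 1))).
    exact: is_deriveB (is_derive_cst (1 : R) _ _) (is_deriveZ tau d2).
  have := @is_derive1_comp _ (fun x => Num.max x 0 ^+ 2) (fun s => 1 - tau * ln (1 + s)) _ _ _
    (is_derive_pos_sqr _) d3.
  by rewrite sub0r add0r mulr1 -[tau *: _]/(tau * _) mulNr.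
exact: (@isp_comp R N k _ (fun s => 2 * Num.max (1 - tau * ln (1 + s)) 0 * (- tau * (1 + s)^-1))
  nsq (fun y => 2 * y 0 k) H (isp_nsq k)).
Qed.

Lemma outer'_continuous tau k : continuous (outer' tau k).
Proof.
apply: continuous_mul; last by apply: continuous_scale; exact: coordinate_continuous.
apply: continuous_mul; first by apply: continuous_scale; exact: profile_continuous.
apply: continuous_scale; apply: inv_continuous => [|y]; first exact: one_nsq_continuous.
by rewrite gt_eqF// one_nsq_gt0.
Qed.

Lemma inner_den_gt0 a y : 0 < 1 + Num.max (nsq y - a) 0 ^+ 2.
Proof. by rewrite ltr_wpDr// sqr_ge0. Qed.

Lemma inner_continuous a : continuous (inner a).
Proof.
apply: continuous_sub; first exact: cst_continuous.
apply: inv_continuous => [|y]; last by rewrite gt_eqF// inner_den_gt0.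
apply: continuous_add; first exact: cst_continuous.
have c : continuous (fun y => Num.max (nsq y - a) 0).
  by apply: max_continuous; apply: continuous_sub; [exact: nsq_continuous|exact: cst_continuous].
exact: continuous_mul.
Qed.

Lemma inner_ge0 a y : 0 <= inner a y.
Proof. by rewrite subr_ge0 invf_le1 ?inner_den_gt0// lerDl sqr_ge0. Qed.

Lemma inner_le1 a y : inner a y <= 1.
Proof. by rewrite gerBl invr_ge0 ltW// inner_den_gt0. Qed.

Lemma inner_eq0 a y : nsq y <= a -> inner a y = 0.
Proof. by move=> ya; rewrite /inner max_r ?subr_le0// expr0n addr0 invr1 subrr. Qed.

Lemma inner_gt0 a y : a < nsq y -> 0 < inner a y.
Proof.
move=> ya; rewrite subr_gt0 invf_lt1 ?inner_den_gt0// ltrDl exprn_gt0//.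
by rewrite lt_max subr_gt0 ya.
Qed.

Lemma inner_slope_ge0 a y : 0 <= inner_slope a y.
Proof.
rewrite /inner_slope !mulr_ge0//; first by rewrite le_max lexx orbT.
by rewrite invr_ge0 sqr_ge0.
Qed.

Lemma inner_slope_eq0 a y : nsq y <= a -> inner_slope a y = 0.
Proof. by move=> ya; rewrite /inner_slope max_r ?subr_le0// mulr0 mul0r. Qed.

Lemma isp_inner a k : isp k (inner a) (inner' a k).
Proof.
have H (y : RN) : is_derive (nsq y) (1 : R) (fun s => 1 - (1 + Num.max (s - a) 0 ^+ 2)^-1)
    (2 * Num.max (nsq y - a) 0 * (1 + Num.max (nsq y - a) 0 ^+ 2) ^- 2).
  have d1 : is_derive (nsq y) (1 : R) (fun s : R => s - a) (1 - 0).
    exact: is_deriveB (is_derive_id _ _) (is_derive_cst a _ _).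
  have d2 := @is_derive1_comp _ (fun x => Num.max x 0 ^+ 2) (fun s => s - a) _ _ _
    (is_derive_pos_sqr _) d1.
  have d3 := is_deriveD (is_derive_cst (1 : R) (nsq y) (1 : R)) d2.
  have n0 : (cst (1 : R) + (fun x : R => Num.max x 0 ^+ 2) \o (fun s => s - a)) (nsq y) != 0.
    by rewrite gt_eqF// inner_den_gt0.
  have d4 := is_deriveB (is_derive_cst (1 : R) (nsq y) (1 : R)) (is_deriveV n0 d3).
  apply: (is_derive_eq d4).
  rewrite !sub0r /= subr0 mulr1 add0r -[_ *: _]/(_ * _) mulNr opprK mulrC.
  by [].
exact: (@isp_comp R N k _ (fun s => 2 * Num.max (s - a) 0 * (1 + Num.max (s - a) 0 ^+ 2) ^- 2)
  nsq (fun y => 2 * y 0 k) H (isp_nsq k)).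
Qed.

Lemma inner'_continuous a k : continuous (inner' a k).
Proof.
have c : continuous (fun y => Num.max (nsq y - a) 0).
  by apply: max_continuous; apply: continuous_sub; [exact: nsq_continuous|exact: cst_continuous].
have c1 : continuous (fun y => 1 + Num.max (nsq y - a) 0 ^+ 2).
  apply: continuous_add; first exact: cst_continuous.
  exact: continuous_mul.
apply: continuous_mul; last by apply: continuous_scale; exact: coordinate_continuous.
apply: continuous_mul; first exact: continuous_scale.
apply: inv_continuous => [|y]; first exact: continuous_mul.
by rewrite gt_eqF// exprn_gt0// inner_den_gt0.
Qed.

End cutoffs.

(** * Radial component of the drift *)

Section radial_growth.
Context {R : realType} {N : nat}.
Local Notation RN := 'rV[R]_N.
Variables (v : RN -> RN) (alpha : R).
Hypotheses (halpha : -1 < alpha) (hC1 : C1_field v)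
  (hstrain : is_o1_at_infinity (strain v)).
Implicit Types (i j k : 'I_N) (y : RN).

Local Notation drift := (drift v alpha).
Local Notation rate := (rate alpha).

Definition strain_norm y : R := frobenius (strain v y).

Lemma frobenius_ge0 (m n : nat) (A : 'M[R]_(m, n)) : 0 <= frobenius A.
Proof. exact: sqrtr_ge0. Qed.

Lemma frobenius_entry (m n : nat) (A : 'M[R]_(m, n)) (i : 'I_m) (j : 'I_n) : `|A i j| <= frobenius A.
Proof.
rewrite -sqrtr_sqr ler_wsqrtr// (bigD1 i)//= (bigD1 j)//= -addrA lerDl.
rewrite addr_ge0 ?sumr_ge0// => [l _|l _]; first exact: sqr_ge0.
by apply: sumr_ge0 => ? _; exact: sqr_ge0.
Qed.

Lemma strain_norm_continuous : continuous strain_norm.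
Proof.
apply: (continuous_real_comp (@sqrt_continuous R)).
apply: sum_continuous => i; apply: sum_continuous => j.
have cs : continuous (fun y => strain v y i j).
  rewrite (_ : (fun y => _) = fun y => 2^-1 * (grad v i j y + grad v j i y)).
    by apply: continuous_scale; apply: continuous_add; exact: grad_continuous.
  by apply/funext => y; rewrite mxE.
exact: continuous_mul.
Qed.

Lemma frobenius_row y : frobenius y = Num.sqrt (nsq y).
Proof. by rewrite /frobenius big_ord1. Qed.

Lemma strain_norm_bounded : exists2 M, 0 <= M & forall y, strain_norm y <= M.
Proof.
have [r Hr] := hstrain ltr01.
have [C HC] := bounded_on_ball `|r| strain_norm_continuous.
exists (`|C| + 1) => [|y]; first exact: addr_ge0.
have [yr|yr] := leP `|y| `|r|.
  rewrite (le_trans (ler_norm _))// (le_trans (HC y yr))// (le_trans (ler_norm C))//.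
  by rewrite lerDl.
rewrite ltW// (lt_le_trans (Hr y _)) ?lerDr//.
rewrite frobenius_row (le_lt_trans (ler_norm r))// (lt_le_trans yr)//.
by rewrite -(ger0_norm (normr_ge0 y)) -sqrtr_sqr ler_wsqrtr// nsq_ge_norm.
Qed.

Definition vdot (t : R) y : R := \sum_k component v k (t *: y) * y 0 k.

(** The derivative is the quadratic form of the gradient at [y], which only sees the symmetric part.
    Hence the strain alone controls the radial component of [v], with no information on the
    vorticity. *)
Lemma is_derive_vdot (t : R) y : is_derive t (1 : R) (vdot ^~ y)
  (\sum_k \sum_i y 0 i * strain v (t *: y) i k * y 0 k).
Proof.
have H k : is_derive t (1 : R) (fun t : R => component v k (t *: y) * y 0 k)
    ((\sum_i y 0 i * grad v i k (t *: y)) * y 0 k).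
  have := C1_is_derive (isp_component hC1 ^~ k) (fun i => @grad_continuous _ _ _ hC1 i k) (t *: y + 0) y.
  move/is_derive_affine_path/(is_deriveZ (y 0 k)).
  rewrite addr0 (_ : _ *: (_ : R) = (\sum_i y 0 i * grad v i k (t *: y)) * y 0 k); last exact: mulrC.
  by congr is_derive; apply/funext => u; rewrite /= addr0; exact: mulrC.
have := is_derive_sum (fun k => H k).
rewrite (_ : \sum_(k < N) (fun t : R => _) = vdot ^~ y); last first.
  by apply/funext => u; rewrite fct_sumE.
move=> K; apply: (is_derive_eq K).
have E1 : \sum_k \sum_i y 0 i * grad v i k (t *: y) * y 0 k =
    \sum_k \sum_i y 0 i * grad v k i (t *: y) * y 0 k.
  rewrite exchange_big/=; apply: eq_bigr => i _; apply: eq_bigr => k _.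
  by rewrite mulrAC [RHS]mulrAC [y 0 k * _]mulrC.
transitivity (\sum_k \sum_i y 0 i * grad v i k (t *: y) * y 0 k).
  by apply: eq_bigr => k _; rewrite mulr_suml.
transitivity (2^-1 * (\sum_k \sum_i y 0 i * grad v i k (t *: y) * y 0 k) +
              2^-1 * (\sum_k \sum_i y 0 i * grad v k i (t *: y) * y 0 k)).
  by rewrite -E1; field.
rewrite !mulr_sumr -big_split/=; apply: eq_bigr => k _.
rewrite !mulr_sumr -big_split/=; apply: eq_bigr => i _.
by rewrite mxE /grad; ring.
Qed.

Lemma strain_form_le (t : R) y (e : R) : strain_norm (t *: y) <= e ->
  `|\sum_k \sum_i y 0 i * strain v (t *: y) i k * y 0 k| <= e * (N%:R * nsq y).
Proof.
move=> He; have e0 : 0 <= e by apply: le_trans He; exact: frobenius_ge0.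
rewrite (le_trans _ (ler_wpM2l e0 (sqr_l1_le_nsq y)))// expr2 mulr_suml mulr_sumr.
rewrite (le_trans (ler_norm_sum _ _ _))//; apply: ler_sum => k _.
rewrite mulr_sumr mulr_sumr (le_trans (ler_norm_sum _ _ _))//; apply: ler_sum => i _.
rewrite !normrM mulrAC mulrC [`|y 0 k| * _]mulrC ler_wpM2r ?mulr_ge0//.
exact: le_trans (frobenius_entry _ _ _) He.
Qed.

Lemma vdot_increment (t u : R) y (e : R) : 0 <= t -> t < u ->
  (forall c, t < c < u -> strain_norm (c *: y) <= e) ->
  `|vdot u y - vdot t y| <= (u - t) * (e * (N%:R * nsq y)).
Proof.
move=> t0 tu He.
have [c] := @MVT _ (vdot ^~ y) _ _ _ tu (fun c _ => is_derive_vdot c y)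
  (continuous_subspaceT (is_derive1_continuous (is_derive_vdot ^~ y))).
rewrite in_itv/= => /He Hc ->; rewrite normrM mulrC (ger0_norm (_ : 0 <= u - t)).
  by rewrite ler_wpM2l ?strain_form_le// subr_ge0 ltW.
by rewrite subr_ge0 ltW.
Qed.

Definition v0_norm : R := \sum_k `|component v k 0|.

Lemma vdot0_le y : `|vdot 0 y| <= v0_norm * Num.sqrt (nsq y).
Proof.
rewrite /vdot /v0_norm mulr_suml (le_trans (ler_norm_sum _ _ _))//.
apply: ler_sum => k _; rewrite scale0r normrM ler_wpM2l//.
by rewrite -sqrtr_sqr ler_wsqrtr// nsq_coord.
Qed.

Definition drift_dot y : R := \sum_k drift k y * y 0 k.

Lemma drift_dotE y : drift_dot y = rate * nsq y - vdot 1 y.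
Proof.
rewrite /drift_dot /vdot /nsq mulr_sumr -sumrB; apply: eq_bigr => k _.
by rewrite scale1r /drift mulrBl -mulrA expr2.
Qed.

Lemma sqrt_nsq_sqr y : Num.sqrt (nsq y) ^+ 2 = nsq y.
Proof. by rewrite sqr_sqrtr// nsq_ge0. Qed.

(** Integrating the bounded strain along the ray gives quadratic growth, which the logarithmic
    cutoff can bear. *)
Lemma drift_dot_le : exists2 C, 0 <= C & forall y, `|drift_dot y| <= C * (1 + nsq y).
Proof.
have [M M0 HM] := strain_norm_bounded.
have rt0 := rate_gt0 halpha.
have V0 : 0 <= v0_norm by apply: sumr_ge0.
have MN0 : 0 <= M * N%:R by rewrite mulr_ge0.
exists (rate + v0_norm + M * N%:R) => [|y]; first by rewrite !addr_ge0// ltW.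
have h1 := @vdot_increment 0 1 y M (lexx 0) ltr01 (fun c _ => HM (c *: y)).
have h0 := vdot0_le y.
rewrite subr0 mul1r mulrA in h1.
have s0 := sqrtr_ge0 (nsq y); have sE := sqrt_nsq_sqr y; have n0 := nsq_ge0 y.
set s := Num.sqrt _ in h0 s0 sE.
have s1 : s <= 1 + nsq y by rewrite -sE; have := sqr_ge0 (s - 1); nra.
have h2 : v0_norm * s <= v0_norm * (1 + nsq y) by rewrite ler_wpM2l.
have h3 : M * N%:R * nsq y <= M * N%:R * (1 + nsq y) by rewrite ler_wpM2l// lerDr.
have h4 : `|rate * nsq y| <= rate * (1 + nsq y).
  by rewrite ger0_norm ?mulr_ge0 ?(ltW rt0)// ler_wpM2l ?(ltW rt0)// lerDr.
rewrite drift_dotE (_ : _ - _ = rate * nsq y + (- (vdot 1 y - vdot 0 y) - vdot 0 y)); last by ring.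
rewrite (le_trans (ler_normD _ _))//.
rewrite (le_trans (lerD h4 (ler_normB _ _)))// normrN.
by rewrite !mulrDl; lra.
Qed.

(** Cut the ray from 0 to [y] at distance [r']. The inner piece and [v 0] contribute at most
    [K * s], linear in the Euclidean norm [s]; on the outer piece the strain is below [e]. Each is
    at most a quarter of [rate * nsq y], so at least half of it survives. *)
Lemma drift_dot_ge0 : exists2 a, 0 < a & forall y, a <= nsq y -> 0 <= drift_dot y.
Proof.
have [M M0 HM] := strain_norm_bounded.
have rt0 := rate_gt0 halpha.
have V0 : 0 <= v0_norm by apply: sumr_ge0.
have N1 : 0 < N%:R + 1 :> R by rewrite ltr_wpDl.
pose e := rate / (4 * (N%:R + 1)).
have e0 : 0 < e by rewrite divr_gt0// mulr_gt0.
have [r Hr] := hstrain e0.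
pose r' := `|r| + 1.
have r'0 : 0 < r' by rewrite ltr_wpDl.
pose K := v0_norm + r' * (M * N%:R).
have K0 : 0 <= K by rewrite addr_ge0// !mulr_ge0// ltW.
pose b := r' + 4 * K / rate.
have b0 : 0 < b by rewrite ltr_wpDr// divr_ge0 ?mulr_ge0// ltW.
(* Strictly above [b ^+ 2], so that [b < s] strictly. *)
exists (b ^+ 2 + b) => [|y yb]; first by rewrite addr_gt0// exprn_gt0.
have s0 := sqrtr_ge0 (nsq y); have sE := sqrt_nsq_sqr y; have n0 := nsq_ge0 y.
have h0 := vdot0_le y.
set s := Num.sqrt _ in h0 s0 sE.
have bs : b < s.
  rewrite -(@ltr_pXn2r _ 2) ?nnegrE ?(ltW b0)// sE (lt_le_trans _ yb)//.
  by rewrite ltrDl.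
have sp : 0 < s by exact: lt_trans bs.
pose t := r' / s.
have t0 : 0 < t by rewrite divr_gt0.
have t1 : t < 1.
  by rewrite ltr_pdivrMr// mul1r (le_lt_trans _ bs)// lerDl divr_ge0 ?mulr_ge0// ltW.
have h1 := @vdot_increment 0 t y M (lexx 0) t0 (fun c _ => HM (c *: y)).
have h2 := @vdot_increment t 1 y e (ltW t0) t1.
have {}h2 := h2 _.
have {}h2 : `|vdot 1 y - vdot t y| <= (1 - t) * (e * (N%:R * nsq y)).
  apply: h2 => c /andP[tc _]; apply: ltW; apply: Hr.
  have c0 : 0 < c by exact: lt_trans tc.
  have -> : frobenius (c *: y) = c * s.
    rewrite frobenius_row /s -[c in RHS](ger0_norm (ltW c0)) -sqrtr_sqr -sqrtrM ?sqr_ge0//.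
    congr Num.sqrt; rewrite /nsq mulr_sumr; apply: eq_bigr => k _.
    by rewrite mxE exprMn.
  apply: (@lt_trans _ _ r'); first by rewrite (le_lt_trans (ler_norm r))// ltrDl.
  by rewrite -ltr_pdivrMr.
rewrite subr0 in h1.
have h1' : t * (M * (N%:R * nsq y)) = r' * (M * N%:R) * s.
  rewrite -sE /t; field; exact: lt0r_neq0.
have h2' : (1 - t) * (e * (N%:R * nsq y)) <= rate / 4 * nsq y.
  apply: (@le_trans _ _ (1 * (e * (N%:R * nsq y)))).
    have X0 : 0 <= e * (N%:R * nsq y) by rewrite !mulr_ge0// ltW.
    by rewrite ler_wpM2r// gerBl ltW.
  rewrite mul1r mulrA ler_wpM2r// /e.
  rewrite (_ : rate / (4 * (N%:R + 1)) * N%:R = rate / 4 * (N%:R / (N%:R + 1))); last first.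
    by field; exact: lt0r_neq0.
  rewrite -[leRHS]mulr1 ler_wpM2l ?divr_ge0 ?(ltW rt0)// ler_pdivrMr// mul1r.
  by rewrite lerDl.
have h3 : K * s <= rate / 4 * nsq y.
  rewrite -sE expr2 mulrA ler_wpM2r// -ler_pdivrMl ?divr_gt0//.
  rewrite (_ : _^-1 * K = 4 * K / rate); last by field; exact: lt0r_neq0.
  by rewrite (le_trans _ (ltW bs))// lerDr ltW.
have h4 : vdot 1 y <= rate / 2 * nsq y.
  rewrite h1' in h1.
  have e1 := le_trans (ler_norm _) h0.
  have e2 := le_trans (ler_norm _) h1.
  have e3 := le_trans (ler_norm _) (le_trans h2 h2').
  have eK : K * s = v0_norm * s + r' * (M * N%:R) * s by rewrite /K mulrDl.
  have eh : rate / 2 * nsq y = rate / 4 * nsq y + rate / 4 * nsq y by field.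
  by rewrite eh; lra.
rewrite drift_dotE subr_ge0 (le_trans h4)// ler_wpM2r//.
by rewrite ler_pdivrMr// ler_peMr ?(ltW rt0)// ler1n.
Qed.

End radial_growth.

(** * Vanishing of the vorticity *)

Section vorticity_vanishes.
Context {R : realType} {N : nat}.
Local Notation RN := 'rV[R]_N.

Lemma powR_norm_continuous (s : R) : 0 < s -> continuous (fun x : R => `|x| `^ s).
Proof.
move=> s0 x; have [->|x0] := eqVneq x 0.
  rewrite /continuous_at normr0 powR0 ?gt_eqF//.
  apply/cvgrPdist_lt => e e0; near=> z.
  rewrite sub0r normrN ger0_norm ?powR_ge0//.
  rewrite -[X in _ < X](_ : (e `^ s^-1) `^ s = e); last first.
    by rewrite -powRrM mulVf ?gt_eqF// powRr1// ltW.
  apply: gt0_ltr_powR => //; rewrite ?nnegrE ?powR_ge0//.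
  near: z; apply/nbhs_ballP; exists (e `^ s^-1) => [|z]; first exact: powR_gt0.
  by rewrite /ball/= sub0r normrN.
have xp : 0 < `|x| by rewrite normr_gt0.
have cx : {for `|x|, continuous (fun z => z `^ s)}.
  apply: differentiable_continuous; apply/derivable1_diffP.
  by case: (is_derive1_powR s xp).
exact: cvg_comp (@norm_continuous _ _ x) cx.
Unshelve. all: by end_near. Qed.

(** [w] need not have compact support; the finiteness of its integral is what makes [Int w] a true
    bound. *)
Lemma Int_le_integral (F w : RN -> R) (c : R) : C0c F -> continuous w ->
  (forall y, 0 <= w y) -> (integralRN setT (fun y => (w y)%:E) < +oo)%E ->
  (forall y, F y <= c * w y) -> Int F <= c * Int w.
Proof.
move=> cF cw w0 wi Fw.
have iw : (@lebesgue_tuple R N).-integrable setT (EFin \o (w \o @row_of R N)).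
  apply/integrableP; split; first by apply/measurable_EFinP; exact: measurable_row_of.
  move: wi; rewrite /integralRN preimage_setT; apply: le_lt_trans.
  rewrite le_eqVlt; apply/orP; left; apply/eqP; apply: eq_integral => t _ /=.
  by rewrite ger0_norm.
rewrite !IntE -RintegralZl//; apply: le_Rintegral => //; first exact: C0c_integrable.
exact: (integrableZl measurableT c iw).
Qed.

Variables (v : RN -> RN) (alpha : R).
Hypotheses (halpha : -1 < alpha) (hC1 : C1_field v)
  (hv : self_similar_profile v alpha) (hstrain : is_o1_at_infinity (strain v)).
Implicit Types (i j k : 'I_N) (y : RN).

Local Notation drift := (drift v alpha).
Local Notation rate := (rate alpha).
Local Notation vsq := (vsq v).
Local Notation strain_norm := (strain_norm v).
Local Notation drift_dot := (drift_dot v alpha).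

Lemma frobenius_vorticity y : frobenius (vorticity v y) = Num.sqrt (vsq y).
Proof.
by congr Num.sqrt; apply: eq_bigr => i _; apply: eq_bigr => j _; rewrite mxE.
Qed.

Lemma frobenius_vorticity_powR (p : R) y :
  frobenius (vorticity v y) `^ p = vsq y `^ (p / 2).
Proof.
by rewrite frobenius_vorticity -powR12_sqrt ?vsq_ge0// -powRrM mulrC.
Qed.

Lemma vsq_powR_continuous (s : R) : 0 < s -> continuous (fun y => vsq y `^ s).
Proof.
move=> s0; rewrite (_ : (fun y => _) = fun y => `|vsq y| `^ s).
  by apply: (continuous_real_comp (powR_norm_continuous s0)); exact: vsq_continuous.
by apply/funext => y; rewrite ger0_norm// vsq_ge0.
Qed.

Lemma drift_outer' tau y : \sum_k drift k y * outer' tau k y =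
  - (4 * profile tau y * tau * ((1 + nsq y)^-1 * drift_dot y)).
Proof.
rewrite /drift_dot !mulr_sumr -sumrN; apply: eq_bigr => k _.
by rewrite /outer'; ring.
Qed.

Lemma drift_inner' a y : \sum_k drift k y * inner' a k y = inner_slope a y * (2 * drift_dot y).
Proof.
rewrite /drift_dot !mulr_sumr; apply: eq_bigr => k _.
by rewrite /inner'; ring.
Qed.

Lemma drift_dot_quotient (C : R) y : `|drift_dot y| <= C * (1 + nsq y) ->
  `|(1 + nsq y)^-1 * drift_dot y| <= C.
Proof.
move=> h; have n0 := one_nsq_gt0 y.
by rewrite normrM normfV (gtr0_norm n0) ler_pdivrMl// mulrC.
Qed.

(* The cutoff vanishes inside a ball, and its logarithmic decay makes the error
   at infinity [O(tau)] times the integral of [|vort|^p]. *)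
Lemma vort_bounded_support (p : R) : 0 < p -> p < N%:R * rate ->
  in_Lp p (vorticity v) -> exists2 a, 0 < a & forall y, a < nsq y -> vsq y = 0.
Proof.
move=> p0 pd hvort.
have N0 : 0 <= N%:R :> R by [].
have [C C0 HC] := drift_dot_le halpha hC1 hstrain.
have [a1 a10 Ha1] := drift_dot_ge0 halpha hC1 hstrain.
(* Chosen so that a strain below [e] costs at most [delta], half of the gap between [p] and
   [N * rate]. *)
pose e := (N%:R * rate - p) / (4 * (N%:R * p + 1)).
have D0 : 0 < N%:R * p + 1 by rewrite ltr_wpDl// mulr_ge0// ltW.
have e0 : 0 < e by rewrite divr_gt0 ?subr_gt0// mulr_gt0.
have [r Hr] := hstrain e0.
(* Beyond [a] the drift points outward and the strain is below [e]. *)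
pose a := a1 + r ^+ 2.
have a0 : 0 < a by rewrite ltr_wpDr// sqr_ge0.
exists a => // y1 ay1; apply/eqP; apply: contraT => vy1.
pose s := p / 2; have s0 : 0 < s by rewrite divr_gt0.
have s2 : 2 * s = p by rewrite /s mulrC divfK.
pose w y := vsq y `^ s.
have cw : continuous w by exact: vsq_powR_continuous.
have w0 y : 0 <= w y by exact: powR_ge0.
have wi : (integralRN setT (fun y => (w y)%:E) < +oo)%E.
  move: hvort; rewrite /in_Lp; congr (_ < _)%E; congr integralRN.
  by apply/funext => y; rewrite frobenius_vorticity_powR.
pose delta := (N%:R * rate - p) / 2.
have delta0 : 0 < delta by rewrite divr_gt0// subr_gt0.
have Hdelta y : a < nsq y -> delta <= N%:R * rate - p * (1 + 2 * N%:R * strain_norm y).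
  move=> ay.
  have /ltW h : strain_norm y < e.
    apply: Hr; rewrite frobenius_row (le_lt_trans (ler_norm r))// -sqrtr_sqr.
    rewrite ltr_sqrt; last by rewrite (lt_trans a0).
    by rewrite (le_lt_trans _ ay)// lerDr ltW.
  have : p * (2 * N%:R * strain_norm y) <= p * (2 * N%:R * e).
    by rewrite ler_wpM2l ?(ltW p0)// ler_wpM2l// mulr_ge0.
  have : p * (2 * N%:R * e) <= delta.
    rewrite (_ : p * (2 * N%:R * e) = delta * (N%:R * p / (N%:R * p + 1))); last first.
      by rewrite /e /delta; field; exact: lt0r_neq0.
    rewrite -[leRHS]mulr1 ler_wpM2l ?(ltW delta0)// ler_pdivrMr// mul1r.
    by rewrite lerDl.
  by rewrite /delta; lra.
have key tau : 0 < tau ->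
    delta * Int (fun y => inner a y * outer tau y * w y) <= 4 * C * tau * Int w.
  move=> t0.
  have ci := @inner_continuous R N a.
  have co := @outer_C0c R N tau t0.
  have cchi : C0c (fun y => inner a y * outer tau y) by exact: C0cMl.
  have dchi k := isp_mul (isp_inner a k) (isp_outer tau k).
  have cchi' k : continuous (fun y => inner' a k y * outer tau y + inner a y * outer' tau k y).
    apply: continuous_add; apply: continuous_mul => //.
    - exact: inner'_continuous.
    - exact: co.1.
    - exact: outer'_continuous.
  have chi0 y : 0 <= inner a y * outer tau y by rewrite mulr_ge0 ?inner_ge0// sqr_ge0.
  have := renormalised_le halpha hC1 hv cchi dchi cchi' chi0 s0
    (strain_norm_continuous hC1) (fun y => frobenius_ge0 _) (fun y i j => frobenius_entry _ i j).
  set H := (fun y => _ * _) => IH.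
  have cd := div_cutoff_C0c alpha hC1 cchi dchi cchi'.
  have cH : C0c H.
    apply: C0cMr => //; apply: C0cB => //; apply: C0cMl => //.
    apply: continuous_scale; apply: continuous_add; first exact: cst_continuous.
    by apply: continuous_scale; exact: strain_norm_continuous.
  have co' k : C0c (outer' tau k).
    by apply: (isp_C0c (isp_outer tau k) co); exact: outer'_continuous.
  have cE : C0c (fun y => inner a y * (\sum_k drift k y * outer' tau k y) * w y).
    apply: C0cMr => //; apply: C0cMl => //; apply: C0c_sum => k _; apply: C0cMl => //.
    exact: drift_continuous.
  have cX : C0c (fun y => inner a y * outer tau y * w y) by exact: C0cMr.
  (* The gradient of [inner] contributes a non-negative term, the drift being outward where it is
     non-zero, and is dropped; only the gradient of [outer] is left as an error. *)
  have low : delta * Int (fun y => inner a y * outer tau y * w y)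
      + Int (fun y => inner a y * (\sum_k drift k y * outer' tau k y) * w y) <= Int H.
    rewrite -IntZ// -IntD//; last exact: C0cZ.
    apply: le_Int => //; first by apply: C0cD => //; exact: C0cZ.
    move=> y; rewrite /H mulrA -mulrDl -/(w y) ler_wpM2r//.
    rewrite /div_cutoff s2.
    have -> : \sum_k drift k y * (inner' a k y * outer tau y + inner a y * outer' tau k y) =
        (\sum_k drift k y * inner' a k y) * outer tau y +
        inner a y * (\sum_k drift k y * outer' tau k y).
      rewrite mulr_suml mulr_sumr -big_split/=; apply: eq_bigr => k _; ring.
    have [ya|ya] := leP (nsq y) a.
      by rewrite drift_inner' inner_slope_eq0// inner_eq0// !(mul0r, mulr0, addr0, add0r, subr0).
    have h1 : delta * (inner a y * outer tau y) <=
        (N%:R * rate - p * (1 + 2 * N%:R * strain_norm y)) * (inner a y * outer tau y).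
      by rewrite ler_wpM2r// Hdelta.
    have h2 : 0 <= (\sum_k drift k y * inner' a k y) * outer tau y.
      rewrite mulr_ge0 ?sqr_ge0// drift_inner' mulr_ge0 ?inner_slope_ge0// mulr_ge0//.
      by apply: Ha1; rewrite (le_trans _ (ltW ya))// lerDl sqr_ge0.
    set S1 := \sum_k _ in h2 *; set Z := \sum_k _.
    set X := inner a y * outer tau y in h1 *.
    rewrite [leRHS](_ : _ = (N%:R * rate - p * (1 + 2 * N%:R * strain_norm y)) * X
      + (S1 * outer tau y + inner a y * Z)); last by ring.
    by rewrite lerD// lerDr.
  have up : - Int (fun y => inner a y * (\sum_k drift k y * outer' tau k y) * w y) <=
      4 * C * tau * Int w.
    rewrite -IntN//; apply: Int_le_integral => //; first exact: C0cN.
    move=> y; rewrite -mulNr ler_wpM2r// drift_outer' mulrN opprK.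
    have hq := le_trans (ler_norm _) (drift_dot_quotient (HC y)).
    have p1 := profile_le1 y (ltW t0); have pg := profile_ge0 tau y.
    apply: (@le_trans _ _ (inner a y * (4 * profile tau y * tau * C))).
      rewrite ler_wpM2l ?inner_ge0// ler_wpM2l// !mulr_ge0// ltW//.
    rewrite -[leRHS]mul1r ler_pM ?inner_ge0 ?inner_le1//.
      by rewrite !mulr_ge0// ltW.
    rewrite [leRHS](_ : _ = 4 * 1 * tau * C); last by ring.
    by rewrite ler_wpM2r// ler_wpM2r ?(ltW t0)// ler_wpM2l.
  by lra.
pose l1 := ln (1 + nsq y1).
have l10 : 0 <= l1 by exact: ln_one_nsq_ge0.
(* Makes [outer tau0] at least 1/4 at [y1], so that the integral [c] is positive. *)
pose tau0 : R := 2^-1 / (l1 + 1).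
have tau00 : 0 < tau0 by rewrite divr_gt0// ltr_wpDl.
pose c := Int (fun y => inner a y * outer tau0 y * w y).
have cXt tau : 0 < tau -> C0c (fun y => inner a y * outer tau y * w y).
  move=> t0; apply: C0cMr => //; apply: C0cMl; first exact: inner_continuous.
  exact: outer_C0c.
have c0 : 0 < c.
  apply: (@Int_gt0 _ _ _ y1); first exact: cXt.
    by move=> y; rewrite mulr_ge0// mulr_ge0 ?inner_ge0// sqr_ge0.
  apply: mulr_gt0; last by apply: powR_gt0; rewrite lt_neqAle eq_sym vy1 vsq_ge0.
  apply: mulr_gt0; first exact: inner_gt0.
  rewrite /outer exprn_gt0//; apply: (@lt_le_trans _ _ 2^-1) => //.
  apply: (profile_ge_half (ltW tau00) (lexx _)); rewrite -/l1 /tau0.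
  rewrite -mulrA -[leRHS]mulr1 ler_wpM2l// ler_pdivrMl ?ltr_wpDl// mulr1.
  by rewrite lerDl.
have I0 : 0 <= Int w by exact: Int_ge0.
pose D := 8 * (C + 1) * (Int w + 1).
have Dp : 0 < D by rewrite !mulr_gt0// ltr_wpDl.
(* Decreasing [tau] enlarges the outer cutoff, so the left side of [key] stays at least [delta * c];
   the second bound pushes the right side down to half of that. *)
pose tau := Num.min tau0 (delta * c / D).
have taup : 0 < tau by rewrite lt_min tau00 divr_gt0// mulr_gt0.
have h1 := key tau taup.
have h2 : delta * c <= delta * Int (fun y => inner a y * outer tau y * w y).
  rewrite ler_wpM2l ?(ltW delta0)//; apply: le_Int; [exact: cXt|exact: cXt|move=> y].
  rewrite ler_wpM2r// ler_wpM2l ?inner_ge0// /outer ler_pXn2r ?nnegrE ?profile_ge0//.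
  by apply: profile_anti; rewrite ge_min lexx.
have h3 : 4 * C * tau * Int w <= delta * c / 2.
  apply: (@le_trans _ _ (tau * (D / 2))).
    rewrite /D (_ : 4 * C * tau * Int w = tau * (4 * (C * Int w))); last by ring.
    rewrite ler_wpM2l ?(ltW taup)//.
    rewrite (_ : _ / 2 = 4 * ((C + 1) * (Int w + 1))); last by field.
    by rewrite ler_wpM2l// ler_pM// lerDl.
  rewrite mulrA ler_wpM2r//; apply: (@le_trans _ _ (delta * c / D * D)).
    by rewrite ler_wpM2r ?(ltW Dp)// ge_min lexx orbT.
  by rewrite divfK// gt_eqF.
have dc : 0 < delta * c by rewrite mulr_gt0.
by have := le_trans h2 (le_trans h1 h3); lra.
Qed.

(* On the bounded support of the vorticity any exponent is integrable; for a
   small one the strain near the origin is harmless. *)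
Lemma vsq_eq0 (p : R) : 0 < p -> p < N%:R * rate ->
  in_Lp p (vorticity v) -> forall y, vsq y = 0.
Proof.
move=> p0 pd hvort.
have [a a0 Ha] := vort_bounded_support p0 pd hvort.
have [C C0 HC] := drift_dot_le halpha hC1 hstrain.
have [M M0 HM] := strain_norm_bounded hC1 hstrain.
set d := N%:R * rate in pd *.
have d0 : 0 < d by exact: lt_trans pd.
have m0 : 0 < 1 + 2 * N%:R * M by rewrite ltr_wpDr// !mulr_ge0.
(* With this exponent the zeroth-order loss is at most [d / 2], even where the strain is as large as
   [M]. *)
pose s := d / (4 * (1 + 2 * N%:R * M)).
have s0 : 0 < s by rewrite divr_gt0// mulr_gt0.
have l0 : 0 <= ln (1 + a) by rewrite ln_ge0// lerDl ltW.
(* The first bound keeps the profile above 1/2 on the ball; the second limits the cutoff error to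
   [d / 8] times the profile, less than the remaining [d / 2] times its square. *)
pose tau := Num.min (2^-1 / (ln (1 + a) + 1)) (d / (32 * (C + 1))).
have t0 : 0 < tau.
  rewrite lt_min; apply/andP; split; apply: divr_gt0 => //; first by rewrite ltr_wpDl.
  by rewrite mulr_gt0// ltr_wpDl.
have tl : tau * ln (1 + a) <= 2^-1.
  apply: (@le_trans _ _ (2^-1 / (ln (1 + a) + 1) * ln (1 + a))).
    by rewrite ler_wpM2r// ge_min lexx.
  by rewrite -mulrA -[leRHS]mulr1 ler_wpM2l// ler_pdivrMl ?ltr_wpDl// mulr1 lerDl.
have tC : tau * C <= d / 32.
  apply: (@le_trans _ _ (d / (32 * (C + 1)) * (C + 1))).
    apply: ler_pM => //; [exact: ltW|by rewrite ge_min lexx orbT|by rewrite lerDl].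
  by rewrite le_eqVlt; apply/orP; left; apply/eqP; field; rewrite gt_eqF// ltr_wpDl.
have co := @outer_C0c R N tau t0.
pose H y := div_cutoff v alpha (outer tau) (outer' tau) y
  - 2 * s * (1 + 2 * N%:R * strain_norm y) * outer tau y.
have cH : Int (fun y => H y * vsq y `^ s) <= 0 :=
  renormalised_le halpha hC1 hv co (isp_outer tau) (@outer'_continuous R N tau)
  (fun y => sqr_ge0 _) s0 (strain_norm_continuous hC1)
  (fun y => frobenius_ge0 _) (fun y i j => frobenius_entry _ i j).
have Hpos y : nsq y <= a -> 0 < H y.
  move=> ya.
  have P1 := profile_ge_half (ltW t0) ya tl.
  have hq := le_trans (ler_norm _) (drift_dot_quotient (HC y)).
  rewrite /H /div_cutoff drift_outer' -/d.
  have hM : 2 * s * (1 + 2 * N%:R * strain_norm y) <= d / 2.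
    apply: (@le_trans _ _ (2 * s * (1 + 2 * N%:R * M))).
      have s2 : 0 <= 2 * s by rewrite mulr_ge0// ltW.
      have N2 : 0 <= 2 * N%:R :> R by rewrite mulr_ge0.
      by rewrite (ler_wpM2l s2)// lerD2l (ler_wpM2l N2).
    by rewrite le_eqVlt /s; apply/orP; left; apply/eqP; field; exact: lt0r_neq0.
  have h1 : 2 * s * (1 + 2 * N%:R * strain_norm y) * outer tau y <= d / 2 * outer tau y.
    by rewrite ler_wpM2r// sqr_ge0.
  have h2 : 4 * profile tau y * tau * ((1 + nsq y)^-1 * drift_dot y) <=
      4 * profile tau y * (d / 32).
    rewrite -mulrA ler_wpM2l ?mulr_ge0 ?profile_ge0// (le_trans _ tC)//.
    by rewrite ler_wpM2l// ltW.
  have h3 : 4 * profile tau y * (d / 32) < d / 2 * outer tau y.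
    rewrite (_ : 4 * profile tau y * (d / 32) = d / 2 * (4^-1 * profile tau y)); last by field.
    have Pp : 0 < profile tau y by rewrite (lt_le_trans _ P1).
    have hh : 4^-1 * profile tau y < outer tau y.
      by rewrite /outer expr2 ltr_pM2r//; lra.
    by rewrite ltr_pM2l// divr_gt0.
  have h4 : d * outer tau y = d / 2 * outer tau y + d / 2 * outer tau y by field.
  by lra.
have cw := vsq_powR_continuous s0.
have cHw : C0c (fun y => H y * vsq y `^ s).
  apply: C0cMr => //; apply: C0cB.
    by apply: div_cutoff_C0c => //; [exact: isp_outer|exact: outer'_continuous].
  apply: C0cMl => //; apply: continuous_scale; apply: continuous_add.
    exact: cst_continuous.
  by apply: continuous_scale; exact: strain_norm_continuous.
have Hge0 y : 0 <= H y * vsq y `^ s.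
  have [ya|/Ha ->] := leP (nsq y) a.
    by rewrite mulr_ge0 ?powR_ge0// ltW// Hpos.
  by rewrite powR0 ?mulr0// gt_eqF.
move=> y; have [ya|/Ha//] := leP (nsq y) a.
have := Int_eq0 cHw Hge0 cH y => /eqP; rewrite mulf_eq0 gt_eqF ?Hpos//=.
by rewrite powR_eq0 => /andP[/eqP].
Qed.

End vorticity_vanishes.

(** * Liouville theorem *)

Section maximum_principle.
Context {R : realType} {N : nat}.
Local Notation RN := 'rV[R]_N.
Implicit Types (k : 'I_N) (y : RN).

(** The first derivative vanishes at 0; if [l] were positive it would be positive just to the right,
    and the mean value theorem would give a larger value of [f]. *)
Lemma second_derivative_at_max (f f1 : R -> R) (l : R) :
  (forall x : R, is_derive x (1 : R) f (f1 x)) -> is_derive (0 : R) (1 : R) f1 l ->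
  (forall x, `|x| <= 1 -> f x <= f 0) -> l <= 0.
Proof.
move=> df df1 fmax; rewrite leNgt; apply/negP => l0.
have m1 (x : R) : x \in `]-1, 1[ -> `|x| <= 1.
  by rewrite in_itv/= => /andP[? ?]; rewrite ler_norml !ltW.
have f10 : f1 0 = 0.
  have D0 : is_derive (0 : R) (1 : R) f 0.
    apply: (@derive1_at_max R f (-1) 1 0).
    - by rewrite (le_trans (_ : _ <= 0)) ?oppr_le0.
    - by move=> t _; case: (df t).
    - by rewrite in_itv/= ltr01 oppr_lt0 ltr01.
    - by move=> t /m1; exact: fmax.
  by have [_ <-] := df 0; have [_ ->] := D0.
have cv : (fun h : R => h^-1 *: ((f1 \o shift 0) (h *: (1 : R)) - f1 0)) @ 0^' --> l.
  by have [h <-] := df1; exact: h.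
have l2 : 0 < l / 2 by rewrite divr_gt0.
have /cvgrPdist_lt/(_ _ l2)/nbhs_ballP[d /= d0 Hd] := cv.
pose x := Num.min (d / 2) 1.
have x0 : 0 < x by rewrite lt_min divr_gt0/=.
have x1 : x <= 1 by rewrite ge_min lexx orbT.
have xd : x < d by rewrite (le_lt_trans (_ : x <= d / 2)) ?ge_min ?lexx//; lra.
have [c] := @MVT _ f f1 _ _ x0 (fun x _ => df x) (continuous_subspaceT (is_derive1_continuous df)).
rewrite in_itv/= => /andP[c0 cx] E.
have : 0 < f1 c.
  have := Hd c; rewrite /ball/= sub0r normrN gtr0_norm// => /(_ (lt_trans cx xd)) /(_ (lt0r_neq0 c0)).
  rewrite f10 subr0 addr0 [c *: 1]mulr1 -[_ *: _]/(_ * _) ltr_norml => /andP[_ h].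
  have : 0 < c^-1 * f1 c by lra.
  by rewrite pmulr_rgt0// invr_gt0.
have : f x <= f 0 by apply: fmax; rewrite gtr0_norm.
by move: E; rewrite subr0 => E; rewrite -subr_le0 E => /[swap] h; rewrite leNgt mulr_gt0.
Qed.

(** Adding [eta * nsq] makes the Laplacian strictly positive, which is impossible at an interior
    maximum; for small [eta] the decay of [W] keeps the maximum inside. *)
Lemma harmonic_le0 (W : RN -> R) (W1 W2 : 'I_N -> RN -> R) : (0 < N)%N ->
  continuous W -> (forall k, isp k W (W1 k)) -> (forall k, isp k (W1 k) (W2 k)) ->
  (forall y, \sum_k W2 k y = 0) ->
  (forall e, 0 < e -> exists r, forall y, r < `|y| -> W y <= e) ->
  forall y, W y <= 0.
Proof.
move=> Npos cW dW dW1 harm vanish y0; rewrite leNgt; apply/negP => m0.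
set m := W y0 in m0.
have m2 : 0 < m / 2 by rewrite divr_gt0.
have [r Hr] := vanish _ m2.
pose rho := `|r| + `|y0|.
have rho0 : 0 <= rho by exact: addr_ge0.
have N0 : 0 < N%:R :> R by rewrite ltr0n.
have q0 : 0 < N%:R * (rho + 1) ^+ 2.
  by rewrite mulr_gt0// exprn_gt0// ltr_wpDl.
(* On the ball of radius [rho + 1] the perturbation is at most [m / 4], so where [W] is below
   [m / 2] the sum stays under [m]. *)
pose eta := m / 4 / (N%:R * (rho + 1) ^+ 2).
have eta0 : 0 < eta by rewrite divr_gt0// divr_gt0.
pose Z y := W y + eta * nsq y.
have cZ : continuous Z.
  by apply: continuous_add => //; apply: continuous_scale; exact: nsq_continuous.
have [c /= cball cmax] : exists2 c : RN, c \in [set y : RN | `|y| <= rho + 1] &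
    forall t : RN, t \in [set y : RN | `|y| <= rho + 1] -> Z t <= Z c.
  apply: EVT_max_rV.
  - by exists y0; rewrite /= /rho -addrA addrCA lerDl addr_ge0.
  - exact: ball_compact.
  - exact: continuous_subspaceT.
rewrite inE/= in cball.
have Zc : m <= Z c.
  apply: (@le_trans _ _ (Z y0)); first by rewrite lerDl mulr_ge0 ?nsq_ge0// ltW.
  by apply: cmax; rewrite inE/= /rho -addrA addrCA lerDl addr_ge0.
(* The maximum is at distance at least 1 from the edge of the ball, leaving room for the unit
   segments on which the second derivative test is applied. *)
have crho : `|c| <= rho.
  rewrite leNgt; apply/negP => rc.
  have h1 : W c <= m / 2.
    by apply: Hr; rewrite (le_lt_trans _ rc)// (le_trans (ler_norm r))// lerDl.
  have h2 : eta * nsq c <= m / 4.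
    apply: (@le_trans _ _ (eta * (N%:R * (rho + 1) ^+ 2))).
      rewrite ler_wpM2l ?(ltW eta0)// (le_trans (nsq_le_norm c))// ler_wpM2l ?(ltW N0)//.
      by rewrite ler_pXn2r ?nnegrE// addr_ge0.
    by rewrite /eta divfK// gt_eqF.
  by move: Zc; rewrite /Z; lra.
have dZ k : isp k Z (fun y => W1 k y + eta * (2 * y 0 k)).
  exact: isp_add (dW k) (isp_scale eta (isp_nsq k)).
have dZ1 k : isp k (fun y => W1 k y + eta * (2 * y 0 k)) (fun y => W2 k y + eta * 2).
  apply: (isp_ext (isp_add (dW1 k) (isp_scale eta (isp_scale 2 (isp_coord k k))))) => // y.
  by rewrite eqxx mulr1.
have test k : W2 k c + eta * 2 <= 0.
  apply: (@second_derivative_at_max (fun t : R => Z (t *: delta_mx 0 k + c))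
    (fun t : R => W1 k (t *: delta_mx 0 k + c) + eta * (2 * (t *: delta_mx 0 k + c) 0 k))).
  - by move=> t; apply: is_derive_affine_path; exact: dZ.
  - have := dZ1 k c; rewrite -[X in is_derive X _ _ _](add0r c)
      -[X in is_derive (X + _) _ _ _](scale0r (delta_mx 0 k)).
    by move/is_derive_affine_path.
  - move=> t t1; rewrite scale0r add0r; apply: cmax; rewrite inE/=.
    rewrite addrC (le_trans (ler_normD _ _))// lerD// normrZ -(mulr1 1) ler_pM//.
    exact: norm_delta_le.
have : \sum_k (W2 k c + eta * 2) <= 0 by apply: sumr_le0 => k _; exact: test.
rewrite big_split/= harm add0r sumr_const card_ord leNgt.
by rewrite pmulrn_lgt0// mulr_gt0.
Qed.

End maximum_principle.

Section liouville.
Context {R : realType} {N : nat}.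
Local Notation RN := 'rV[R]_N.
Variable v : RN -> RN.
Hypotheses (Npos : (0 < N)%N) (hC1 : C1_field v)
  (hdiv : forall y, \sum_k grad v k k y = 0)
  (hcurl : forall i j y, grad v i j y = grad v j i y)
  (hdecay : forall (e : R), 0 < e -> exists r : R, forall y i j, r < `|y| -> `|grad v i j y| <= e).
Implicit Types (i j k : 'I_N) (y : RN).

(** With [phi] the kernel, [d_j v_i d_k d_k phi] becomes [d_k v_i d_j d_k phi] by exchanging
    derivatives, then [d_i v_k d_j d_k phi] by vanishing curl, then [d_k v_k d_i d_j phi] by a
    second exchange; the sum over [k] is a divergence. *)
Lemma grad_weak_harmonic r (a : RN) i j : 0 < r ->
  \sum_k Int (fun z => grad v j i z * rbump'' r k k (z - a)) = 0.
Proof.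
move=> r0.
have cv m : continuous (component v m) by exact: component_continuous.
have cg m l : continuous (grad v m l) by exact: grad_continuous.
have cK' k : C0c (fun z : RN => rbump' 0 r k (z - a)) by apply/C0c_shift/rbump'_C0c; exact: ltW.
have cK'' k l : C0c (fun z : RN => rbump'' r k l (z - a)) by apply/C0c_shift/rbump''_C0c; exact: ltW.
have dK k l := isp_shift a (isp_rbump' r k l).
have step k : Int (fun z => grad v j i z * rbump'' r k k (z - a)) =
    Int (fun z => rbump'' r j i (z - a) * grad v k k z).
  transitivity (Int (fun z => rbump'' r k k (z - a) * grad v j i z)).
    by congr Int; apply/funext => z; rewrite mulrC.
  rewrite (Int_swap (dK k j) (dK k k) (cK' k) (cK'' k j).1 (cK'' k k).1
    (isp_component hC1 j i) (isp_component hC1 k i) (@cv i) (@cg j i) (@cg k i)).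
  transitivity (Int (fun z => rbump'' r j k (z - a) * grad v i k z)).
    by congr Int; apply/funext => z; rewrite rbump''C hcurl.
  exact: (Int_swap (dK j i) (dK j k) (cK' j) (cK'' j i).1 (cK'' j k).1
    (isp_component hC1 i k) (isp_component hC1 k k) (@cv k) (@cg i k) (@cg k k)).
rewrite (eq_bigr _ (fun k _ => step k)) -Int_sum => [|k _]; last exact: C0cMr.
rewrite -[RHS](@Int0 R N); congr Int; apply/funext => z.
by rewrite -mulr_sumr hdiv mulr0.
Qed.

(** Weak harmonicity makes the mollified gradient classically harmonic, and it inherits the decay.
    The factor [c] treats both signs at once. *)
Lemma signed_grad_le0 (c : R) n i j y : `|c| = 1 -> c * mollify n (grad v j i) y <= 0.
Proof.
move=> c1.
have r0 : 0 < mrad n :> R by exact: mrad_gt0.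
have cg : continuous (grad v j i) by exact: grad_continuous.
pose q := c / @rbump_mass R N (mrad n).
have cK : C0c (@rbump R N 0 (mrad n)) by apply: rbump_C0c; exact: ltW.
have cK' k : C0c (@rbump' R N 0 (mrad n) k) by apply: rbump'_C0c; exact: ltW.
have H1 k := isp_moll cg cK (isp_rbump 0 (mrad n) k) (@rbump'_continuous R N _ 0 k).
have H2 k := isp_moll cg (cK' k) (isp_rbump' (mrad n) k k)
  (Ck_continuous (Ck_rbump'' 0 (mrad n) k k)).
apply: (@harmonic_le0 R N (fun y => c * mollify n (grad v j i) y)
  (fun k y => q * - moll (grad v j i) (rbump' 0 (mrad n) k) y)
  (fun k y => q * moll (grad v j i) (rbump'' (mrad n) k k) y)) => //.
- by apply: continuous_scale; exact: mollify_continuous.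
- move=> k; apply: (isp_ext (isp_scale q (H1 k))) => // z.
  by rewrite /mollify /q; ring.
- move=> k; apply: (isp_ext (isp_scale (- q) (H2 k))) => z.
    by rewrite mulrN mulNr.
  by rewrite mulrNN.
- by move=> z; rewrite -mulr_sumr grad_weak_harmonic// mulr0.
- move=> e e0; have [r Hr] := hdecay e0; exists (r + 1) => z rz.
  rewrite (le_trans (ler_norm _))// normrM c1 mul1r -[mollify _ _ _]subr0.
  apply: mollify_dist => // x xz; rewrite subr0; apply: Hr.
  have := @nsq_lt1_norm R N x z; rewrite (_ : nsq (z - x) = nsq (x - z)).
    by move=> /(_ (lt_le_trans xz (mrad_le1 n))); lra.
  by apply: eq_bigr => l _; rewrite !mxE -sqrrN opprB.
Qed.

Lemma grad_eq0 i j y : grad v j i y = 0.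
Proof.
have cg : continuous (grad v j i) by exact: grad_continuous.
have h : mollify n (grad v j i) y @[n --> \oo] --> grad v j i y by exact: mollify_cvg.
have E n : mollify n (grad v j i) y = 0.
  apply/eqP; rewrite eq_le; apply/andP; split.
    by have := @signed_grad_le0 1 n i j y (normr1 _); rewrite mul1r.
  have := @signed_grad_le0 (-1) n i j y; rewrite normrN normr1 mulN1r oppr_le0.
  by apply.
move: h; under eq_fun do rewrite E.
by move=> h; exact: cvg_unique h (cvg_cst _).
Qed.

Lemma field_constant y : v y = v 0.
Proof.
apply/rowP => i; apply: (@isp0_cst R N (component v i)) => k.
by apply: (isp_ext (isp_component hC1 k i)) => // z; rewrite grad_eq0.
Qed.

End liouville.

Theorem theorem4p1 (R : realType) (N : nat) (hN : (2 <= N)%N)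
    (alpha p : R) (v : 'rV[R]_N -> 'rV[R]_N)
    (halpha : -1 < alpha)
    (hC1 : C1_field v)
    (hv : self_similar_profile v alpha)
    (hstrain : is_o1_at_infinity (strain v))
    (hp0 : 0 < p) (hp : p < N%:R / (1 + alpha))
    (hvort : in_Lp p (vorticity v)) :
  exists c : 'rV[R]_N, forall y, v y = c.
Proof.
have w0 := vsq_eq0 halpha hC1 hv hstrain hp0 hp hvort.
have curl0 i j y : grad v i j y = grad v j i y.
  have := w0 y; move=> /eqP; rewrite psumr_eq0 => [|k _]; last first.
    by apply: sumr_ge0 => l _; exact: sqr_ge0.
  move=> /allP/(_ i (mem_index_enum _)); rewrite psumr_eq0 => [|l _]; last exact: sqr_ge0.
  move=> /allP/(_ j (mem_index_enum _)); rewrite sqrf_eq0 mulf_eq0 invr_eq0 pnatr_eq0/=.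
  by rewrite subr_eq0 => /eqP.
exists (v 0); apply: field_constant => //.
- exact: ltn_trans hN.
- exact: divergence_eq0 hv.
- move=> e e0; have [r Hr] := hstrain e e0; exists `|r| => y i j ry.
  (* Once the curl vanishes the gradient is the strain, so the decay of the strain becomes decay of
     the whole gradient. *)
  have -> : grad v i j y = strain v y i j.
    by rewrite mxE -/(grad v i j y) -/(grad v j i y) (curl0 j i); field.
  rewrite (le_trans (frobenius_entry _ i j))// ltW//; apply: Hr.
  rewrite frobenius_row (le_lt_trans (ler_norm r))// (lt_le_trans ry)//.
  by rewrite -(ger0_norm (normr_ge0 y)) -sqrtr_sqr ler_wsqrtr// nsq_ge_norm.
Qed.
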